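(* Let $u_0\in\mathcal{M}$. There exist constants $C_u,C_g>0$ and $0<C_\alpha\le1$, depending only on $\Omega$, $d$, $\beta$, $V$ and $\|u_0\|_{H_0^1(\Omega)}$ and having the energy-decay property for the $H^1$-scheme started at $u_0$ (defined in the context), such that the following holds. Suppose $0<\alpha_{\min}\le\alpha_n\le\alpha_{\max}\le C_\alpha$ for all $n\ge0$, and let $\{u_n\}_{n=0}^\infty\subset\mathcal{M}$ be the iterates of the $H^1$-scheme $u_{n+1}=R\big(u_n-\alpha_n\nabla^{\mathcal{R}}_{H^1}E(u_n)\big)$, $n\ge0$, started at $u_0$. Then for any weak limit $u^*$ of $\{u_n\}_{n=0}^\infty$ in $H_0^1(\Omega)$ (that is, any weak limit in $H_0^1(\Omega)$ of a subsequence), $u^*$ is a critical point of the problem of minimizing $E$ over $\mathcal{M}$, i.e. $u^*\in\mathcal{M}$ and $\nabla^{\mathcal{R}}_{H^1}E(u^* )=0$, and $\{u_n\}_{n=0}^\infty$ has a subsequence converging to $u^*$ strongly in $H_0^1(\Omega)$.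
   Context: Standing assumptions: $d\in\{1,2,3\}$, $\Omega\subset\mathbb{R}^d$ is a bounded Lipschitz domain, $V\in L^\infty(\Omega)$ with $0\le V\le V_{\max}<\infty$, $\beta\ge 0$; functions are real-valued. $H_0^1(\Omega)$ carries the inner product $(z,w)_{H_0^1(\Omega)}=(\nabla z,\nabla w)_{L^2(\Omega)}$ and the induced norm. Energy: $E(u)=\int_\Omega\frac12|\nabla u|^2+\frac12V|u|^2+\frac{\beta}{4}|u|^4$ for $u\in H_0^1(\Omega)$. Manifold: $\mathcal{M}=\{u\in H_0^1(\Omega):\|u\|_{L^2(\Omega)}=1\}$. Retraction: $R(u)=u/\|u\|_{L^2(\Omega)}$ for $u\in H_0^1(\Omega)\setminus\{0\}$. Green's operator: for $w\in L^2(\Omega)$, $\mathcal{G}_{H^1}w\in H_0^1(\Omega)$ is the unique element with $(z,\mathcal{G}_{H^1}w)_{H_0^1(\Omega)}=(z,w)_{L^2(\Omega)}$ for all $z\in H_0^1(\Omega)$. $H^1$-gradient: $\nabla_{H^1}E(u)=u+\mathcal{G}_{H^1}(Vu+\beta|u|^2u)$. Riemannian $H^1$-gradient at $u\in\mathcal{M}$: $$\nabla^{\mathcal{R}}_{H^1}E(u)=u+\mathcal{G}_{H^1}(Vu+\beta|u|^2u)-\frac{1+(\mathcal{G}_{H^1}(Vu+\beta|u|^2u),u)_{L^2(\Omega)}}{\|\mathcal{G}_{H^1}u\|_{H_0^1(\Omega)}^2}\,\mathcal{G}_{H^1}u.$$ Energy-decay property of $(C_u,C_g,C_\alpha)$ for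 the $H^1$-scheme started at $u_0$: for all $0<\alpha_{\min}\le\alpha_{\max}\le C_\alpha$ and all sequences $\alpha_n\in[\alpha_{\min},\alpha_{\max}]$, the iterates satisfy for every $n\ge0$: (i) $\|u_n\|_{H_0^1(\Omega)}\le C_u$; (ii) $\|\nabla^{\mathcal{R}}_{H^1}E(u_n)\|_{H_0^1(\Omega)}\le\|\nabla_{H^1}E(u_n)\|_{H_0^1(\Omega)}\le C_g$; (iii) $E(u_n)-E(u_{n+1})\ge\frac{\alpha_{\min}}{2}\|\nabla^{\mathcal{R}}_{H^1}E(u_n)\|_{H_0^1(\Omega)}^2$. *)

(* Defs.v *)
From HB Require Import structures.
From mathcomp Require Import all_boot all_order all_algebra.
From mathcomp Require Import all_classical all_reals all_analysis.
From mathcomp Require Import ring lra.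

Set Implicit Arguments.
Unset Strict Implicit.
Unset Printing Implicit Defensive.
Import Order.TTheory GRing.Theory Num.Theory.
Import numFieldNormedType.Exports.
Local Open Scope classical_set_scope.
Local Open Scope ring_scope.

(* The product sigma-algebra on row vectors; over a realType it contains the
   open sets (open_measurable_rV), so it is the Borel sigma-algebra. *)
Definition measure_row_display : measure_display -> measure_display.
Proof. exact. Qed.

Section measurable_row.
Context {d : measure_display} {T : sigmaRingType d}.
Variable n : nat.

Definition row_coord (i : 'I_n) (x : 'rV[T]_n) : T := x ord0 i.

Let row_set0 : g_sigma_preimage row_coord set0.
Proof. exact: sigma_algebra0. Qed.

Let row_setC A : g_sigma_preimage row_coord A -> g_sigma_preimage row_coord (~` A).
Proof. exact: sigma_algebraC. Qed.

Let row_bigcup (F : _^nat) : (forall i, g_sigma_preimage row_coord (F i)) ->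
  g_sigma_preimage row_coord (\bigcup_i (F i)).
Proof. exact: sigma_algebra_bigcup. Qed.

HB.instance Definition _ := @isMeasurable.Build (measure_row_display d)
  'rV[T]_n (g_sigma_preimage row_coord) row_set0 row_setC row_bigcup.

End measurable_row.

Section lebesgue_rV.
Context {R : realType}.

Lemma measurable_row_coord n (i : 'I_n) :
  measurable_fun [set: 'rV[R]_n] (row_coord i).
Proof.
move=> _ Y mY; rewrite setTI; apply: sub_sigma_algebra.
rewrite -bigcup_seq; exists i; first exact: mem_index_enum.
by exists Y => //; rewrite setTI.
Qed.

Lemma measurable_row_funP d0 (T : measurableType d0) n (f : T -> 'rV[R]_n) :
  (forall i, measurable_fun [set: T] (fun x => f x ord0 i)) ->
  measurable_fun [set: T] f.
Proof.
move=> mf _ Y mY.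
suff : (g_sigma_preimage (@row_coord _ R n)) `<=` (image_set_system setT f measurable).
  by move=> /(_ _ mY).
apply: smallest_sub; first exact/sigma_algebra_image/sigma_algebra_measurable.
rewrite -bigcup_seq/= => A [i _] [B mB <-].
rewrite /image_set_system /= setTI; exact: mf.
Qed.

Definition rV_cons n (p : R * 'rV[R]_n) : 'rV[R]_n.+1 := row_mx p.1%:M p.2.

Lemma rV_cons0 n (p : R * 'rV[R]_n) : rV_cons p ord0 ord0 = p.1.
Proof.
transitivity (row_mx p.1%:M p.2 ord0 (lshift n ord0)).
  by congr (rV_cons _ _ _); exact/val_inj.
by rewrite row_mxEl mxE eqxx mulr1n.
Qed.

Lemma rV_consS n (p : R * 'rV[R]_n) i :
  rV_cons p ord0 (lift ord0 i) = p.2 ord0 i.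
Proof.
transitivity (row_mx p.1%:M p.2 ord0 (rshift 1 i)).
  by congr (rV_cons _ _ _); exact/val_inj.
by rewrite row_mxEr.
Qed.

Lemma measurable_rV_cons n : measurable_fun setT (@rV_cons n).
Proof.
apply: measurable_row_funP => i; case: (unliftP ord0 i) => [j|] ->.
  under eq_fun do rewrite rV_consS.
  by apply: (measurableT_comp (measurable_row_coord j)); exact: measurable_snd.
under eq_fun do rewrite rV_cons0.
exact: measurable_fst.
Qed.


Section lebesgue_rVS.
Variables (n : nat) (mu : {sigma_finite_measure set 'rV[R]_n -> \bar R}).
Local Open Scope ereal_scope.

Definition lebesgue_rVS : set 'rV[R]_n.+1 -> \bar R :=
  pushforward (lebesgue_measure \x mu) (@rV_cons n).

Let lebesgue_rVS0 : lebesgue_rVS set0 = 0.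
Proof. by rewrite /lebesgue_rVS /pushforward preimage_set0 measure0. Qed.

Let lebesgue_rVS_ge0 A : 0 <= lebesgue_rVS A.
Proof. by rewrite /lebesgue_rVS /pushforward measure_ge0. Qed.

Let lebesgue_rVS_sigma_additive : semi_sigma_additive lebesgue_rVS.
Proof.
have mf := @measurable_rV_cons n.
move=> F mF tF mUF; rewrite /lebesgue_rVS /pushforward preimage_bigcup.
apply: measure_semi_sigma_additive.
- by move=> k; rewrite -[X in measurable X]setTI; exact: mf.
- apply/trivIsetP => /= i j _ _ ij; rewrite -preimage_setI.
  by move/trivIsetP : tF => /(_ _ _ _ _ ij) ->//; rewrite preimage_set0.
- by rewrite -preimage_bigcup -[X in measurable X]setTI; exact: mf.
Qed.

HB.instance Definition _ := isMeasure.Build _ _ _ lebesgue_rVS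
  lebesgue_rVS0 lebesgue_rVS_ge0 lebesgue_rVS_sigma_additive.

Lemma lebesgue_rVS_cons (A : set R) (B : set 'rV[R]_n) :
  measurable A -> measurable B ->
  lebesgue_rVS [set x : 'rV[R]_n.+1 | A (x ord0 ord0) /\ B (\row_i x ord0 (lift ord0 i))] =
  lebesgue_measure A * mu B.
Proof.
move=> mA mB; rewrite -product_measure1E// /lebesgue_rVS /pushforward.
congr product_measure1; apply/seteqP; split => -[a b] /=.
  by rewrite rV_cons0 => -[? Bb]; split => //=; congr B: Bb; apply/rowP => i;
    rewrite mxE rV_consS.
by move=> [/= ? Bb]; rewrite rV_cons0; split => //; congr B: Bb; apply/rowP => i;
    rewrite mxE rV_consS.
Qed.

Lemma measurable_rV_consX (A : set R) (B : set 'rV[R]_n) :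
  measurable A -> measurable B ->
  measurable [set x : 'rV[R]_n.+1 |
    A (x ord0 ord0) /\ B (\row_i x ord0 (lift ord0 i))].
Proof.
move=> mA mB.
have mt : measurable_fun [set: 'rV[R]_n.+1]
    (fun x => \row_i x ord0 (lift ord0 i) : 'rV[R]_n).
  apply: measurable_row_funP => i; under eq_fun do rewrite mxE.
  exact: measurable_row_coord.
apply: measurableI.
  by have := measurable_row_coord (ord0 : 'I_n.+1) measurableT mA; rewrite setTI.
by have := mt measurableT _ mB; rewrite setTI.
Qed.

Let lebesgue_rVS_sigma_finite : sigma_finite setT lebesgue_rVS.
Proof.
have /sigma_finiteP[F [TF ndF Foo]] :=
  sigma_finiteT (@lebesgue_measure R : {sigma_finite_measure set (measurableTypeR R) -> \bar R}).
have /sigma_finiteP[G [TG ndG Goo]] := sigma_finiteT mu.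
exists (fun k => [set x : 'rV[R]_n.+1 | F k (x ord0 ord0) /\
                          G k (\row_i x ord0 (lift ord0 i))]).
  apply/esym; rewrite -subTset => x _.
  have [i _ Fi] : (\bigcup_k F k) (x ord0 ord0) by rewrite -TF.
  have [j _ Gj] : (\bigcup_k G k) (\row_i x ord0 (lift ord0 i)) by rewrite -TG.
  exists (maxn i j) => //; split.
    by move: Fi; exact/subsetPset/ndF/leq_maxl.
  by move: Gj; exact/subsetPset/ndG/leq_maxr.
move=> k; have [? ?] := Foo k; have [? ?] := Goo k.
split; first exact: measurable_rV_consX.
by rewrite lebesgue_rVS_cons// lte_mul_pinfty// ge0_fin_numE.
Qed.

HB.instance Definition _ := Measure_isSigmaFinite.Build _ _ _ lebesgue_rVS
  lebesgue_rVS_sigma_finite.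

End lebesgue_rVS.

Lemma measurable_rV_box n (A : 'I_n -> set R) : (forall i, measurable (A i)) ->
  measurable [set x : 'rV[R]_n | forall i, A i (x ord0 i)].
Proof.
elim: n A => [|n IH] A mA.
  rewrite (_ : [set x | _] = setT)//.
  by apply/seteqP; split => // x _ [].
have -> : [set x : 'rV[R]_n.+1 | forall i, A i (x ord0 i)] =
  [set x | A ord0 (x ord0 ord0) /\
     [set x : 'rV_n | forall i, A (lift ord0 i) (x ord0 i)]
       (\row_i x ord0 (lift ord0 i))].
  apply/seteqP; split => x /= H.
    by split => // i; rewrite mxE.
  move: H => [H0 H] i; case: (unliftP ord0 i) => [j|] -> //.
  by have := H j; rewrite mxE.
apply: (measurable_rV_consX (mA ord0)).
exact: (IH _ (fun i => mA (lift ord0 i))).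
Qed.

Lemma open_measurable_rV n (U : set 'rV[R]_n) : open U -> measurable U.
Proof.
move=> oU.
pose B (p : 'rV[rat]_n * nat) : set 'rV[R]_n :=
  [set x | forall i, `](ratr (p.1 ord0 i) - p.2.+1%:R^-1),
                      (ratr (p.1 ord0 i) + p.2.+1%:R^-1)[%classic (x ord0 i)].
rewrite (_ : U = \bigcup_(p in [set p | B p `<=` U]) B p); last first.
  apply/seteqP; split => [x Ux|x [p /=]]; last by move=> + Bx; apply.
  have /nbhs_ballP[e /= e0 eU] := open_nbhs_nbhs (conj oU Ux : open_nbhs x U).
  have [k ke] : exists k, k.+1%:R^-1 < e / 2 :> R.
    exists (Num.truncn (e / 2)^-1).
    by rewrite invf_plt ?posrE ?divr_gt0 ?ltr0n// truncnS_gt.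
  have k0 : 0 < k.+1%:R^-1 :> R by rewrite invr_gt0 ltr0n.
  have /choice[q qx] : forall i, exists q : rat,
      ratr q \in `](x ord0 i - k.+1%:R^-1), (x ord0 i + k.+1%:R^-1)[.
    move=> i; apply: rat_in_itvoo.
    by rewrite ltrD2l (lt_trans _ k0)// oppr_lt0.
  exists (\row_i q i, k) => /=.
    move=> y /= By; apply: eU; split=> // i j; rewrite (ord1 i : i = ord0) /ball /=.
    have := By j; have := qx j; rewrite /= !mxE !in_itv/= => /andP[+ +] /andP[].
    move: (y ord0 j) (x ord0 j) (ratr (q j)) (k.+1%:R^-1) ke => a b c t ? ? ? ? ?.
    rewrite ltr_norml; apply/andP; split; lra.
  move=> i /=; have := qx i; rewrite mxE !in_itv/= => /andP[].
  move: (x ord0 i) (ratr (q i)) (k.+1%:R^-1) => a c t ? ?.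
  apply/andP; split; lra.
rewrite bigcup_mkcond; apply: countable_bigcupT_measurable => [|p].
  exact: countableP.
case: ifP => // _; apply: (@measurable_rV_box _ (fun i =>
  `](ratr (p.1 ord0 i) - p.2.+1%:R^-1),
    (ratr (p.1 ord0 i) + p.2.+1%:R^-1)[%classic)) => i.
exact: measurable_itv.
Qed.

(* Lebesgue measure on R^n, as an iterated product; lebesgue_rV_box gives its
   values on boxes, which characterize it. *)
Fixpoint lebesgue_rV n : {sigma_finite_measure set 'rV[R]_n -> \bar R} :=
  match n with
  | 0%N => \d_(0 : 'rV[R]_0)
  | m.+1 => lebesgue_rVS (lebesgue_rV m)
  end.

Local Open Scope ereal_scope.
Lemma lebesgue_rV_box n (A : 'I_n -> set R) : (forall i, measurable (A i)) ->
  lebesgue_rV n [set x : 'rV[R]_n | forall i, A i (x ord0 i)] =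
  \prod_(i < n) lebesgue_measure (A i).
Proof.
elim: n A => [|n IH] A mA.
  rewrite big_ord0 (_ : [set x | _] = setT).
    exact: diracT.
  by apply/seteqP; split => // x _ [].
transitivity (lebesgue_rVS (lebesgue_rV n) [set x : 'rV[R]_n.+1 | A ord0 (x ord0 ord0) /\
     [set x : 'rV_n | forall i, A (lift ord0 i) (x ord0 i)]
       (\row_i x ord0 (lift ord0 i))]).
  congr (lebesgue_rVS _ _); apply/seteqP; split => x /= H.
    by split => // i; rewrite mxE.
  move: H => [H0 H] i; case: (unliftP ord0 i) => [j|] -> //.
  by have := H j; rewrite mxE.
rewrite lebesgue_rVS_cons//.
  by rewrite big_ord_recl (IH (fun i => A (lift ord0 i))).
by apply: (@measurable_rV_box _ (fun i => A (lift ord0 i))) => i; exact: mA.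
Qed.

End lebesgue_rV.

Section smooth_functions.
Context {R : realType} {d : nat}.
Implicit Types (Omega : set 'rV[R]_d) (f phi : 'rV[R]_d -> R).

Definition partial (i : 'I_d) f : 'rV[R]_d -> R :=
  fun x => 'D_(delta_mx ord0 i) f x.

(* C^oo: every iterated partial derivative is (Frechet) differentiable, hence
   continuous. *)
Definition smooth f :=
  forall (s : seq 'I_d) (x : 'rV[R]_d), differentiable (foldr partial f s) x.

Definition support_of f : set 'rV[R]_d := closure [set x : 'rV[R]_d | f x != 0].

(* C_c^oo(Omega) *)
Definition test_function Omega phi :=
  [/\ smooth phi, compact (support_of phi) & support_of phi `<=` Omega].

(* Near each boundary point, and after an orthogonal change of coordinates
   y |-> y *m Q, Omega is the strict epigraph of a Lipschitz function of the
   coordinates other than the i-th. *)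
Definition lipschitz_boundary Omega :=
  forall x : 'rV[R]_d, (closure Omega `\` Omega°) x ->
  exists (Q : 'M[R]_d) (i : 'I_d) (gamma : 'rV[R]_d.-1 -> R),
    [/\ Q *m Q^T = 1%:M,
        lipschitz gamma &
        \forall y \near x,
          Omega y <-> gamma (col' i (y *m Q)) < (y *m Q) ord0 i].

Definition bounded_lipschitz_domain Omega :=
  [/\ open Omega, connected Omega, Omega !=set0, bounded_set Omega &
      lipschitz_boundary Omega].

End smooth_functions.

(* Elements of L^2(Omega) and H_0^1(Omega) are represented by functions on the
   whole space of which only the values on Omega, up to null sets, matter. *)
Section sobolev.
Context {R : realType} {d : nat}.
Variable Omega : set 'rV[R]_d.
Implicit Types (u v w z phi : 'rV[R]_d -> R) (g : 'I_d -> 'rV[R]_d -> R).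

Local Notation leb := (lebesgue_rV d : {measure set 'rV[R]_d -> \bar R}).

Definition L2 u :=
  measurable_fun Omega u /\ leb.-integrable Omega (fun x => (u x ^+ 2)%:E).

Definition L2_inner u v : R := \int[leb]_(x in Omega) (u x * v x).

Definition L2_norm u : R := Num.sqrt (L2_inner u u).

Definition weak_gradient u g :=
  forall (i : 'I_d) phi, test_function Omega phi ->
  L2_inner u (partial i phi) = - L2_inner (g i) phi.

(* u is in H_0^1(Omega), the closure of C_c^oo(Omega) in H^1(Omega), and g is
   its weak gradient. *)
Definition H10_with_gradient u g :=
  [/\ L2 u, forall i, L2 (g i), weak_gradient u g &
      forall e : R, 0 < e -> exists2 phi, test_function Omega phi &
        L2_norm (u \- phi) ^+ 2 +
        \sum_(i < d) L2_norm (g i \- partial i phi) ^+ 2 < e].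

Definition H10 u := exists g, H10_with_gradient u g.

(* By uniqueness of weak gradients up to null sets, the choice of a
   representative is immaterial; likewise for green below. *)
Definition grad u : 'I_d -> 'rV[R]_d -> R :=
  xget (fun=> cst 0) [set g : 'I_d -> 'rV[R]_d -> R | H10_with_gradient u g].

Definition H10_inner u v : R := \sum_(i < d) L2_inner (grad u i) (grad v i).

Definition H10_norm u : R := Num.sqrt (H10_inner u u).

Definition H10_dual (F : ('rV[R]_d -> R) -> R) :=
  (forall (a : R) u v, H10 u -> H10 v ->
     F (fun x => a * u x + v x) = a * F u + F v) /\
  exists C : R, forall u, H10 u -> `|F u| <= C * H10_norm u.

Definition H10_weak_cvg (u_ : nat -> 'rV[R]_d -> R) u :=
  forall F, H10_dual F -> (F \o u_) @ \oo --> F u.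

Definition H10_strong_cvg (u_ : nat -> 'rV[R]_d -> R) u :=
  (fun n => H10_norm (u_ n \- u)) @ \oo --> (0 : R).

(* The Green operator G_{H^1} *)
Definition green w : 'rV[R]_d -> R :=
  xget (cst 0) [set v : 'rV[R]_d -> R |
    H10 v /\ forall z, H10 z -> H10_inner z v = L2_inner z w].

End sobolev.

Section gross_pitaevskii.
Context {R : realType} {d : nat}.
Variables (Omega : set 'rV[R]_d) (V : 'rV[R]_d -> R) (beta : R).
Implicit Types (u : 'rV[R]_d -> R) (alpha : nat -> R).

Local Notation leb := (lebesgue_rV d : {measure set 'rV[R]_d -> \bar R}).

Definition energy u : R :=
  \int[leb]_(x in Omega)
    (2^-1 * (\sum_(i < d) grad Omega u i x ^+ 2) + 2^-1 * (V x * `|u x| ^+ 2) +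
     beta / 4 * `|u x| ^+ 4).

Definition on_manifold u := H10 Omega u /\ L2_norm Omega u = 1.

Definition retraction u : 'rV[R]_d -> R := fun x => u x / L2_norm Omega u.

Definition green_nonlinear u : 'rV[R]_d -> R :=
  green Omega (fun x => V x * u x + beta * `|u x| ^+ 2 * u x).

Definition H1_gradient u : 'rV[R]_d -> R := fun x => u x + green_nonlinear u x.

Definition riemannian_H1_gradient u : 'rV[R]_d -> R := fun x =>
  u x + green_nonlinear u x -
  (1 + L2_inner Omega (green_nonlinear u) u) /
    H10_norm Omega (green Omega u) ^+ 2 * green Omega u x.

Fixpoint H1_scheme alpha u0 (n : nat) : 'rV[R]_d -> R :=
  if n is m.+1 then
    let um := H1_scheme alpha u0 m in
    retraction (fun x => um x - alpha m * riemannian_H1_gradient um x)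
  else u0.

Definition energy_decay_property (Cu Cg Ca : R) u0 :=
  forall (amin amax : R) alpha,
    0 < amin -> amin <= amax -> amax <= Ca ->
    (forall n, amin <= alpha n <= amax) ->
  forall n, let un := H1_scheme alpha u0 n in
  [/\ H10_norm Omega un <= Cu,
      H10_norm Omega (riemannian_H1_gradient un) <=
        H10_norm Omega (H1_gradient un) <= Cg &
      energy un - energy (H1_scheme alpha u0 n.+1) >=
        amin / 2 * H10_norm Omega (riemannian_H1_gradient un) ^+ 2].

Definition weak_limit_point (u_ : nat -> 'rV[R]_d -> R) u :=
  H10 Omega u /\ exists2 k : nat -> nat, {homo k : m n / (m < n)%N >-> (m < n)%N} &
    H10_weak_cvg Omega (u_ \o k) u.

Definition critical_point u :=
  on_manifold u /\
  {ae leb, forall x, Omega x -> riemannian_H1_gradient u x = 0}.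

End gross_pitaevskii.

(* Main.v *)
Require Import Defs.
From mathcomp Require Import all_boot all_order all_algebra.
From mathcomp Require Import all_classical all_reals all_analysis.
From mathcomp Require Import measurable_realfun ring lra.

Set Implicit Arguments.
Unset Strict Implicit.
Unset Printing Implicit Defensive.
Import Order.TTheory GRing.Theory Num.Theory.
Import numFieldNormedType.Exports.
Local Open Scope classical_set_scope.
Local Open Scope ring_scope.

(** The scheme is a Riemannian descent method on a sphere, and its analysis only
    needs three facts on H_0^1: the Poincare inequality, an embedding into
    L^4, and compactness of the embedding into L^2.

    The descent argument is carried out for a pair of abstract semi-inner
    products a (for H_0^1) and m (for L^2) and an energy N u ^+ 2 / 2 + F u.
    The Riemannian gradient g of the energy at u is m-orthogonal to u, and
    N g ^+ 2 is the derivative of the energy in the direction g.  If the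
    remainder of F after a step of length t is at most t ^+ 2 * K * N g ^+ 2, a
    step of length t <= 1 / (1 + 2 K) lowers the energy by at least
    t * N g ^+ 2 / 2 (sphere_energy_step).  By orthogonality the step leaves the
    unit ball of m, so the retraction is a contraction and lowers the energy
    further (retraction_step).  The energy therefore decreases, the iterates
    stay in the sublevel set of u_0, on which all the constants are uniform,
    and the squared norms of the gradients are summable (sphere_gradient_cvg0).

    Along a weakly convergent subsequence the iterates converge in L^2 by
    compactness.  Hence the nonlinear term and the multiplier in
      u_n = g_n + c_n * GU (u_n) - GN (u_n)
    converge strongly, and g_n tends to 0, so u_n converges strongly; its limit
    is the weak limit, which satisfies the same equation with g = 0
    (descent_weak_limit).

    The facts on H_0^1 are proved for C1 functions supported in a cube, slicing
    along the first coordinate and applying the fundamental theorem of calculus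
    on each line, and extended to H_0^1 by density of the test functions.  The
    L^4 bound is Ladyzhenskaya's inequality (H10_quartic), for d at most 3.
    Compactness is stated quantitatively: up to an arbitrarily small multiple of
    the H_0^1 norm, finitely many linear functionals control the L^2 norm
    (H10_finite_rank).  Riesz representation (si_riesz) together with the
    completeness of H_0^1 (H10_complete) shows that the Green operator satisfies
    its defining equation, also for the cubic term, which defines a bounded
    functional on H_0^1 by the L^4 bound alone. *)

(** * Semi-inner products and the Riesz representation *)

Lemma quadratic_discriminant {R : realType} (a b c : R) : 0 <= a ->
  (forall t, 0 <= c + 2 * t * b + t ^+ 2 * a) -> b ^+ 2 <= a * c.
Proof.
move=> a0 H; have [az|an0] := eqVneq a 0.
  rewrite {}az in H *; rewrite mul0r; have [->|bn0] := eqVneq b 0; first by rewrite expr0n.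
  have := H (- (c + 1) / (2 * b)).
  have -> : c + 2 * (- (c + 1) / (2 * b)) * b + (- (c + 1) / (2 * b)) ^+ 2 * 0 = - 1.
    by field.
  by rewrite oppr_ge0 ler10.
have ap : 0 < a by rewrite lt_def an0.
have := H (- b / a).
have -> : c + 2 * (- b / a) * b + (- b / a) ^+ 2 * a = (a * c - b ^+ 2) / a.
  by field.
by rewrite pmulr_lge0 ?invr_gt0// subr_ge0.
Qed.

Section real_sequences.
Context {R : realType}.
Implicit Types a b : nat -> R.

Lemma cvg_ler_norm0 a b : (forall n, `|a n| <= b n) ->
  b @ \oo --> 0 -> a @ \oo --> 0.
Proof.
move=> ab b0; apply: norm_cvg0; apply: (squeeze_cvgr _ (cvg_cst 0) b0).
by near=> n; rewrite normr_ge0 ab.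
Unshelve. all: by end_near. Qed.

Lemma cvg_ler_dist a b l : (forall n, `|a n - l| <= b n) ->
  b @ \oo --> 0 -> a @ \oo --> l.
Proof.
move=> ab b0; have c := cvg_ler_norm0 ab b0.
have : (a n - l) + l @[n --> \oo] --> 0 + l by apply: cvgD => //; exact: cvg_cst.
by rewrite add0r; under eq_fun do rewrite subrK.
Qed.

Lemma cvgr0_nat a : (forall e, 0 < e -> exists N, forall n, (N <= n)%N -> `|a n| <= e) ->
  a @ \oo --> 0.
Proof.
move=> H; apply/cvgrPdist_le => e /H[N HN]; near=> n.
by rewrite sub0r normrN HN//; near: n; exact: nbhs_infty_ge.
Unshelve. all: by end_near. Qed.

Lemma cvgr0_natE a e : a @ \oo --> 0 -> 0 < e ->
  exists N, forall n, (N <= n)%N -> `|a n| <= e.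
Proof.
move=> /cvgrPdist_le/[apply] -[N _ HN]; exists N => n Nn.
by have := HN n Nn; rewrite /= sub0r normrN.
Qed.

Lemma cvgr_infty_subseq a (k : nat -> nat) (l : R) :
  {homo k : m n / (m < n)%N >-> (m < n)%N} ->
  a @ \oo --> l -> (a \o k) @ \oo --> l.
Proof.
move=> kinc; have kge n : (n <= k n)%N.
  by elim: n => // n IH; rewrite (leq_ltn_trans IH)// kinc.
move=> al; apply: (@cvg_comp _ _ _ k a \oo \oo _ _ al) => A [N _ NA]; exists N => // n /= Nn.
by apply: NA => /=; rewrite (leq_trans Nn).
Qed.

Lemma cvgr_sqrt a (l : R) : a @ \oo --> l -> Num.sqrt (a n) @[n --> \oo] --> Num.sqrt l.
Proof.
move=> al; apply: (@cvg_comp _ _ _ a Num.sqrt _ (nbhs l)) => //.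
exact: sqrt_continuous.
Qed.

Lemma cvgr_exp k a (l : R) : a @ \oo --> l -> a n ^+ k @[n --> \oo] --> l ^+ k.
Proof.
move=> al; apply: (@cvg_comp _ _ _ a (fun y => y ^+ k) _ (nbhs l)) => //.
exact: exprn_continuous.
Qed.

Lemma cvgr_sqrt_harmonic : Num.sqrt (n.+1%:R^-1) @[n --> \oo] --> (0 : R).
Proof. by have := cvgr_sqrt (@cvg_harmonic R); rewrite sqrtr0. Qed.

End real_sequences.

Section semi_inner_product.
Context {R : realType} {E : lmodType R}.

(** The form is only semidefinite, since functions are not identified when they
    agree almost everywhere; S is the subspace on which it makes sense. *)
Record semi_inner (S : set E) (B : E -> E -> R) : Prop := SemiInner {
  si_zero : S 0;
  si_lin : forall a u v, S u -> S v -> S (a *: u + v);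
  si_sym : forall u v, S u -> S v -> B u v = B v u;
  si_linl : forall a u v w, S u -> S v -> S w ->
    B (a *: u + v) w = a * B u w + B v w;
  si_ge0 : forall u, S u -> 0 <= B u u }.

Definition si_norm (B : E -> E -> R) (u : E) : R := Num.sqrt (B u u).

Variables (S : set E) (B : E -> E -> R).
Hypothesis SB : semi_inner S B.
Local Notation nrm := (si_norm B).

Lemma si_Z a u : S u -> S (a *: u).
Proof. by move=> Su; rewrite -[_ *: _]addr0; apply: (si_lin SB) => //; exact: si_zero SB. Qed.

Lemma si_D u v : S u -> S v -> S (u + v).
Proof. by move=> Su Sv; rewrite -[u]scale1r; exact: (si_lin SB). Qed.

Lemma si_N u : S u -> S (- u).
Proof. by move=> Su; rewrite -scaleN1r; exact: si_Z. Qed.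

Lemma si_B u v : S u -> S v -> S (u - v).
Proof. by move=> Su Sv; apply: si_D => //; exact: si_N. Qed.

Lemma si_B0l v : S v -> B 0 v = 0.
Proof.
move=> Sv; have S0 := si_zero SB.
have := si_linl SB 1 S0 S0 Sv; rewrite scaler0 addr0 mul1r => /eqP.
by rewrite -subr_eq subrr eq_sym => /eqP.
Qed.

Lemma si_DBl u v w : S u -> S v -> S w -> B (u + v) w = B u w + B v w.
Proof. by move=> *; rewrite -[u]scale1r (si_linl SB)// mul1r scale1r. Qed.

Lemma si_ZBl a u w : S u -> S w -> B (a *: u) w = a * B u w.
Proof.
move=> Su Sw; rewrite -[_ *: _]addr0 (si_linl SB)//; last exact: si_zero SB.
by rewrite si_B0l// addr0.
Qed.

Lemma si_NBl u w : S u -> S w -> B (- u) w = - B u w.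
Proof. by move=> *; rewrite -scaleN1r si_ZBl// mulN1r. Qed.

Lemma si_BBl u v w : S u -> S v -> S w -> B (u - v) w = B u w - B v w.
Proof. by move=> *; rewrite si_DBl ?si_NBl//; exact: si_N. Qed.

Lemma si_DBr u v w : S u -> S v -> S w -> B w (u + v) = B w u + B w v.
Proof.
move=> Su Sv Sw; rewrite (si_sym SB)//; last exact: si_D.
by rewrite si_DBl// (si_sym SB Su)// (si_sym SB Sv).
Qed.

Lemma si_ZBr a u w : S u -> S w -> B w (a *: u) = a * B w u.
Proof.
move=> Su Sw; rewrite (si_sym SB)//; last exact: si_Z.
by rewrite si_ZBl// (si_sym SB Su).
Qed.

Lemma si_BBr u v w : S u -> S v -> S w -> B w (u - v) = B w u - B w v.
Proof.
move=> Su Sv Sw; rewrite (si_sym SB)//; last exact: si_B.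
by rewrite si_BBl// (si_sym SB Su)// (si_sym SB Sv).
Qed.

Lemma si_sqrD t u v : S u -> S v ->
  B (u + t *: v) (u + t *: v) = B u u + 2 * t * B u v + t ^+ 2 * B v v.
Proof.
move=> Su Sv; have Stv := si_Z t Sv; have Suv := si_D Su Stv.
rewrite si_DBl// !si_DBr// !si_ZBr// !si_ZBl// (si_sym SB Sv Su); ring.
Qed.

Lemma si_norm_ge0 u : 0 <= nrm u. Proof. exact: sqrtr_ge0. Qed.

Lemma si_norm_sqr u : S u -> nrm u ^+ 2 = B u u.
Proof. by move=> Su; rewrite sqr_sqrtr// (si_ge0 SB). Qed.

Lemma si_cauchy_schwarz_sqr u v : S u -> S v -> B u v ^+ 2 <= B u u * B v v.
Proof.
move=> Su Sv; rewrite mulrC; apply: quadratic_discriminant.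
  exact: (si_ge0 SB).
move=> t; rewrite -si_sqrD//; apply: (si_ge0 SB); apply: si_D => //; exact: si_Z.
Qed.

Lemma si_cauchy_schwarz u v : S u -> S v -> `|B u v| <= nrm u * nrm v.
Proof.
move=> Su Sv; rewrite -ler_sqr ?nnegrE ?mulr_ge0 ?si_norm_ge0//.
by rewrite exprMn !si_norm_sqr// real_normK ?num_real// si_cauchy_schwarz_sqr.
Qed.

Lemma si_normZ a u : S u -> nrm (a *: u) = `|a| * nrm u.
Proof.
move=> Su; have Sau := si_Z a Su; rewrite /si_norm si_ZBl// si_ZBr// mulrA -expr2.
by rewrite sqrtrM ?sqr_ge0// sqrtr_sqr.
Qed.

Lemma si_normN u : S u -> nrm (- u) = nrm u.
Proof. by move=> Su; rewrite -scaleN1r si_normZ// normrN normr1 mul1r. Qed.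

Lemma si_norm_distC u v : S u -> S v -> nrm (u - v) = nrm (v - u).
Proof. by move=> Su Sv; rewrite -opprB si_normN//; exact: si_B. Qed.

Lemma si_norm_triangle u v : S u -> S v -> nrm (u + v) <= nrm u + nrm v.
Proof.
move=> Su Sv; rewrite -ler_sqr ?nnegrE ?addr_ge0 ?si_norm_ge0//.
rewrite si_norm_sqr; last exact: si_D.
have := si_sqrD 1 Su Sv; rewrite scale1r expr1n mul1r mulr1 => ->.
rewrite sqrrD !si_norm_sqr// -mulr_natl.
have := le_trans (ler_norm _) (si_cauchy_schwarz Su Sv); lra.
Qed.

Lemma si_norm_triangleB u v : S u -> S v -> nrm (u - v) <= nrm u + nrm v.
Proof.
by move=> Su Sv; rewrite -(si_normN Sv); apply: si_norm_triangle => //; exact: si_N.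
Qed.

Lemma si_norm_dist u v : S u -> S v -> `|nrm u - nrm v| <= nrm (u - v).
Proof.
move=> Su Sv; have Suv := si_B Su Sv; rewrite ler_norml; apply/andP; split.
  by rewrite lerNl opprB lerBlDr si_norm_distC// -{1}(subrK u v)
    si_norm_triangle//; exact: si_B.
by rewrite lerBlDr -{1}(subrK v u) si_norm_triangle.
Qed.

Lemma si_norm_inj u v : S u -> S v -> nrm (u - v) = 0 -> nrm u = nrm v.
Proof.
move=> Su Sv e; apply/eqP; rewrite -subr_eq0 -normr_le0 -e; exact: si_norm_dist.
Qed.

(** This replaces definiteness, which fails for functions that vanish only almost
    everywhere. *)
Lemma si_norm0_l u v : S u -> S v -> nrm u = 0 -> B u v = 0.
Proof.
move=> Su Sv u0; apply/eqP; rewrite -normr_le0 (le_trans (si_cauchy_schwarz Su Sv))//.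
by rewrite u0 mul0r.
Qed.

Lemma si_cvg_l (u_ : nat -> E) u v : (forall n, S (u_ n)) -> S u -> S v ->
  nrm (u_ n - u) @[n --> \oo] --> 0 -> B (u_ n) v @[n --> \oo] --> B u v.
Proof.
move=> Su_ Su Sv cu; apply: (@cvg_ler_dist _ _ (fun n => nrm (u_ n - u) * nrm v)).
  by move=> n; rewrite -si_BBl// si_cauchy_schwarz//; exact: si_B.
rewrite -(mul0r (nrm v)); apply: cvgM => //; exact: cvg_cst.
Qed.

Lemma si_cvg_norm (u_ : nat -> E) u : (forall n, S (u_ n)) -> S u ->
  nrm (u_ n - u) @[n --> \oo] --> 0 -> nrm (u_ n) @[n --> \oo] --> nrm u.
Proof.
move=> Su_ Su cu; apply: cvg_ler_dist cu => n; exact: si_norm_dist.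
Qed.

Definition si_complete := forall u_ : nat -> E, (forall n, S (u_ n)) ->
  (forall e, 0 < e -> exists N, forall m n, (N <= m)%N -> (N <= n)%N ->
     nrm (u_ m - u_ n) <= e) ->
  exists2 u, S u & nrm (u_ n - u) @[n --> \oo] --> 0.

(** The Riesz representative minimises J v = B v v - 2 F v, which is bounded
    below by - C^2.  A minimising sequence is Cauchy by the parallelogram
    identity.  Stationarity is read off the sequence itself: J (u_n) being
    within e of the infimum forces (B u_n z - F z)^2 <= e * B z z. *)
Lemma si_riesz (F : E -> R) (C : R) : si_complete ->
  (forall a u v, S u -> S v -> F (a *: u + v) = a * F u + F v) ->
  (forall u, S u -> `|F u| <= C * nrm u) ->
  exists2 v, S v & forall z, S z -> B z v = F z.
Proof.
move=> Scpl Flin Fbnd.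
pose J v := B v v - 2 * F v.
have J_ge v : S v -> - C ^+ 2 <= J v.
  move=> Sv; have := Fbnd _ Sv; rewrite ler_norml /J -si_norm_sqr// => /andP[_].
  have := sqr_ge0 (nrm v - C); nra.
pose A := [set J v | v in S].
have infA : has_inf A.
  split; first by exists (J 0); exists 0 => //; exact: si_zero SB.
  by exists (- C ^+ 2) => _ [v Sv <-]; exact: J_ge.
have J_inf v : S v -> inf A <= J v.
  by move=> Sv; apply: ge_inf; [exact: infA.2|exists v].
have /choice[u_ /all_and2[Su_ Ju_]] : forall n : nat, exists u,
    S u /\ J u <= inf A + n.+1%:R^-1.
  move=> n; have : 0 < (n.+1%:R^-1 : R) by rewrite invr_gt0 ltr0n.
  by move=> /(inf_adherent)/(_ infA)[_ [v Sv <-] /ltW Jv]; exists v.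
have FD u v : S u -> S v -> F (u + v) = F u + F v.
  by move=> Su Sv; rewrite -[u in LHS]scale1r Flin// mul1r.
have F0 : F 0 = 0.
  by have := FD _ _ (si_zero SB) (si_zero SB); rewrite addr0; lra.
have FZ a u : S u -> F (a *: u) = a * F u.
  by move=> Su; rewrite -[X in F X]addr0 Flin ?F0 ?addr0//; exact: si_zero SB.
have stat n z : S z -> (B (u_ n) z - F z) ^+ 2 <= B z z * n.+1%:R^-1.
  move=> Sz; apply: quadratic_discriminant; first exact: (si_ge0 SB).
  move=> t; have Stz := si_Z t Sz; have := J_inf _ (si_D (Su_ n) Stz).
  have := Ju_ n; rewrite /J si_sqrD// FD// FZ//.
  move: (B _ _) (B _ _) (B _ _) (F _) (F _) (inf A) (_^-1) => b1 b2 b3 f1 f2 m k; lra.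
have ucauchy e : 0 < e -> exists N, forall m n, (N <= m)%N -> (N <= n)%N ->
     nrm (u_ m - u_ n) <= e.
  move=> e0; have e20 : 0 < e ^+ 2 / 4 by rewrite divr_gt0 ?exprn_gt0.
  have [N _ HN] := near_infty_natSinv_lt (PosNum e20).
  exists N => m n Nm Nn.
  rewrite -ler_sqr ?nnegrE ?si_norm_ge0 ?(ltW e0)// si_norm_sqr; last exact: si_B.
  have : inf A <= J (2^-1 *: (u_ m + u_ n)).
    by apply: J_inf; apply: si_Z; exact: si_D.
  have := HN m Nm; have := HN n Nn; have := Ju_ m; have := Ju_ n => /=.
  rewrite /J !si_ZBl ?si_ZBr ?FZ ?FD ?si_BBl ?si_BBr ?si_DBl ?si_DBr//;
    do ?[exact: si_D|exact: si_B|by apply: si_Z; exact: si_D].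
  rewrite (si_sym SB (Su_ n) (Su_ m)).
  move: (B _ _) (B _ _) (B _ _) (F _) (F _) (inf A) (n.+1%:R^-1) (m.+1%:R^-1).
  move=> b1 b2 b3 f1 f2 i k l; lra.
have [v Sv uv] := Scpl _ Su_ ucauchy; exists v => // z Sz.
have c1 := si_cvg_l Su_ Sv Sz uv.
have c2 : B (u_ n) z @[n --> \oo] --> F z.
  apply: (@cvg_ler_dist _ _ (fun n => Num.sqrt (B z z) * Num.sqrt (n.+1%:R^-1))).
    by move=> n; rewrite -sqrtrM ?(si_ge0 SB)// -sqrtr_sqr ler_wsqrtr// stat.
  rewrite -(mulr0 (Num.sqrt (B z z))); apply: cvgM; first exact: cvg_cst.
  exact: cvgr_sqrt_harmonic.
by rewrite (si_sym SB)//; exact: (cvg_unique _ c1 c2).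
Qed.

End semi_inner_product.

(** * Square-integrable functions *)

Section square_integrable.
Context {R : realType} {d : measure_display} {T : measurableType d}.
Variables (mu : {measure set T -> \bar R}) (D : set T).
Hypothesis mD : measurable D.
Implicit Types f g h : T -> R.

Definition sq_integrable : set (T -> R) := [set f : T -> R |
  measurable_fun D f /\ mu.-integrable D (fun x => (f x ^+ 2)%:E)].

Definition l2_inner f g : R := \int[mu]_(x in D) (f x * g x).

Local Notation nrm := (si_norm l2_inner).

Lemma sq_integrable_mul f g : sq_integrable f -> sq_integrable g ->
  mu.-integrable D (EFin \o (f \* g)).
Proof.
move=> [mf f2] [mg g2].
have : mu.-integrable D (fun x => (f x ^+ 2)%:E + (g x ^+ 2)%:E)%E by exact: integrableD.
apply: le_integrable => //; first exact/measurable_EFinP/measurable_funM.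
move=> x _; rewrite /= lee_fin [leRHS]ger0_norm ?addr_ge0 ?sqr_ge0// normrM.
rewrite -(@real_normK _ (f x)) ?num_real// -(@real_normK _ (g x)) ?num_real//.
have := sqr_ge0 (`|f x| - `|g x|); have := normr_ge0 (f x); have := normr_ge0 (g x).
nra.
Qed.

Lemma sq_integrable0 : sq_integrable 0.
Proof.
split; first exact: measurable_cst.
by rewrite (_ : (fun x => _) = cst 0)//; [exact: integrable0|apply/funext => x; rewrite /= expr0n].
Qed.

Lemma sq_integrable_lin a f g : sq_integrable f -> sq_integrable g ->
  sq_integrable (a *: f + g).
Proof.
move=> sf sg; have [mf f2] := sf; have [mg g2] := sg; split.
  by apply: measurable_funD => //; exact: measurable_funM.
have := integrableD mD (integrableD mD (integrableZl mD (a ^+ 2) f2) g2)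
  (integrableZl mD (2 * a) (sq_integrable_mul sf sg)).
apply: eq_integrable => // x _ /=; rewrite -!EFinM -!EFinD; congr EFin.
rewrite (_ : (_ + _) x = a * f x + g x)//; ring.
Qed.

Lemma l2_semi_inner : semi_inner sq_integrable l2_inner.
Proof.
split => [|a u v|u v Su Sv|a u v w Su Sv Sw|u Su].
- exact: sq_integrable0.
- exact: sq_integrable_lin.
- by apply: eq_Rintegral => x _; rewrite mulrC.
- rewrite /l2_inner -RintegralZl ?sq_integrable_mul//.
  rewrite -RintegralD//; last 2 first.
  + by have := integrableZl mD a (sq_integrable_mul Su Sw); apply: eq_integrable.
  + exact: sq_integrable_mul.
  by apply: eq_Rintegral => x _; rewrite /= mulrDl mulrA.
- by apply: Rintegral_ge0 => x _; rewrite -expr2 sqr_ge0.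
Qed.

Lemma l2_inner_ae f f' g : sq_integrable f -> sq_integrable f' -> sq_integrable g ->
  {ae mu, forall x, D x -> f x = f' x} -> l2_inner f g = l2_inner f' g.
Proof.
move=> Sf Sf' Sg ff'; congr fine; apply: ae_eq_integral => //.
- exact: measurable_int (sq_integrable_mul Sf Sg).
- exact: measurable_int (sq_integrable_mul Sf' Sg).
- by apply: filterS ff' => x + Dx => /(_ Dx) ->.
Qed.

Lemma l2_norm0_ae f : sq_integrable f -> nrm f = 0 ->
  {ae mu, forall x, D x -> f x = 0}.
Proof.
move=> Sf f0; have mf2 := measurable_int _ (sq_integrable_mul Sf Sf).
have : (\int[mu]_(x in D) `|(EFin \o (f \* f)%R) x| = 0)%E.
  rewrite -[LHS]fineK; last first.
    rewrite ge0_fin_numE; last exact: integral_ge0.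
    by have /integrableP[] := sq_integrable_mul Sf Sf.
  have := f0; move/(congr1 (fun x => x ^+ 2)).
  rewrite (si_norm_sqr l2_semi_inner)// expr0n => e; congr EFin.
  rewrite -[RHS]e /l2_inner /Rintegral; congr fine; apply: eq_integral => x _.
  by rewrite /= ger0_norm// -expr2 sqr_ge0.
move/(ae_eq_integral_abs mu mD mf2); apply: filterS => x + Dx => /(_ Dx)/= -[] /eqP.
by rewrite mulf_eq0 orbb => /eqP.
Qed.

Lemma l2_norm0_of_ae f : sq_integrable f -> {ae mu, forall x, D x -> f x = 0} -> nrm f = 0.
Proof.
move=> Sf f0; rewrite /si_norm (l2_inner_ae Sf sq_integrable0 Sf f0).
by rewrite (si_B0l l2_semi_inner)// sqrtr0.
Qed.

Lemma sq_integrable_le f g : measurable_fun D f -> sq_integrable g ->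
  (forall x, D x -> `|f x| <= `|g x|) -> sq_integrable f.
Proof.
move=> mf [mg g2] fg; split => //; apply: le_integrable g2 => //.
  exact/measurable_EFinP/measurable_funX.
move=> x Dx; rewrite /= lee_fin !ger0_norm ?sqr_ge0//.
by rewrite -(@real_normK _ (f x)) ?num_real// -(@real_normK _ (g x)) ?num_real//
  ler_pXn2r ?nnegrE ?fg.
Qed.

Lemma l2_norm_le f g : sq_integrable f -> sq_integrable g ->
  (forall x, D x -> `|f x| <= `|g x|) -> nrm f <= nrm g.
Proof.
move=> Sf Sg fg; apply: ler_wsqrtr; apply: le_Rintegral => //.
- exact: (sq_integrable_mul Sf Sf).
- exact: (sq_integrable_mul Sg Sg).
- move=> x Dx; rewrite -!expr2 -(@real_normK _ (f x)) ?num_real//.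
  by rewrite -(@real_normK _ (g x)) ?num_real// ler_pXn2r ?nnegrE ?fg.
Qed.

(** Fatou's lemma, phrased with a bound so that no limit of integrals has to exist. *)
Lemma fatou_bound (g_ : nat -> T -> R) (g : T -> R) (K : R) :
  (forall n, measurable_fun D (g_ n)) -> measurable_fun D g ->
  (forall n x, D x -> 0 <= g_ n x) -> (forall x, D x -> 0 <= g x) ->
  {ae mu, forall x, D x -> g_ n x @[n --> \oo] --> g x} ->
  (forall n, \int[mu]_(x in D) (g_ n x)%:E <= K%:E)%E ->
  (\int[mu]_(x in D) (g x)%:E <= K%:E)%E.
Proof.
move=> mg_ mg g_0 g0 cg gK.
have mE n : measurable_fun D (fun x => (g_ n x)%:E) by exact/measurable_EFinP.
have ml : measurable_fun D (fun x => limn_einf (fun n => (g_ n x)%:E)).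
  under eq_fun do rewrite -[limn_einf _]oppeK -limn_esupN.
  apply: measurableT_comp => //; apply: measurable_fun_limn_esup => n.
  exact: measurableT_comp.
rewrite (ae_eq_integral (fun x => limn_einf (fun n => (g_ n x)%:E)))//.
- apply: (le_trans (fatou mu mD mE _)); first by move=> n x Dx; rewrite lee_fin g_0.
  rewrite limn_einf_lim; apply: lime_le; first exact: is_cvg_einfs.
  apply: nearW => n; apply: le_trans (gK n).
  by apply: ereal_inf_lbound; exists n => /=.
- exact/measurable_EFinP.
- apply: filterS cg => x + Dx => /(_ Dx) c.
  rewrite (cvg_limn_einf_sup (_ : (g_ n x)%:E @[n --> \oo] --> (g x)%:E)).1//.
  by apply: cvg_EFin => //; exact: nearW.
Qed.

Lemma integral_le_integrable f (K : R) : measurable_fun D f -> (forall x, D x -> 0 <= f x) ->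
  (\int[mu]_(x in D) (f x)%:E <= K%:E)%E -> mu.-integrable D (EFin \o f).
Proof.
move=> mf f0 fK; apply/integrableP; split; first exact/measurable_EFinP.
apply: le_lt_trans (ltry K); apply: le_trans fK; rewrite le_eqVlt; apply/predU1l.
by apply: eq_integral => x /set_mem Dx; rewrite /= ger0_norm ?f0.
Qed.

Lemma integrable_EFin_sum (J : Type) (s : seq J) (f : J -> T -> R) :
  (forall j, mu.-integrable D (EFin \o f j)) ->
  mu.-integrable D (EFin \o (fun x => \sum_(j <- s) f j x)).
Proof.
move=> fi; have := integrable_sum mD s (P := xpredT) (fun j _ => fi j).
by apply: eq_integrable => // x _; rewrite /= -sumEFin.
Qed.

Lemma Rintegral_sum (J : Type) (s : seq J) (f : J -> T -> R) :
  (forall j, mu.-integrable D (EFin \o f j)) ->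
  \int[mu]_(x in D) (\sum_(j <- s) f j x) = \sum_(j <- s) \int[mu]_(x in D) f j x.
Proof.
move=> fi; elim: s => [|j s IH].
  by rewrite big_nil; under eq_Rintegral do rewrite big_nil; rewrite Rintegral_cst// mul0r.
rewrite big_cons; under eq_Rintegral do rewrite big_cons.
by rewrite RintegralD ?IH//; exact: integrable_EFin_sum.
Qed.

Lemma Rintegral_fine f : mu.-integrable D (EFin \o f) ->
  (\int[mu]_(x in D) (f x)%:E = (\int[mu]_(x in D) f x)%:E)%E.
Proof. by move=> fi; rewrite /Rintegral fineK//; exact: integrable_fin_num. Qed.

Hypothesis muD : (mu D < +oo)%E.

Lemma sq_integrable_bounded f (K : R) : measurable_fun D f ->
  (forall x, D x -> `|f x| <= K) -> sq_integrable f.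
Proof.
move=> mf fK; split => //; apply: measurable_bounded_integrable => //.
  exact: measurable_funX.
exists (K ^+ 2); split; first exact: num_real.
move=> y Ky x Dx; rewrite /= ger0_norm ?sqr_ge0// (le_trans _ (ltW Ky))//.
have K0 : 0 <= K by rewrite (le_trans _ (fK x Dx)).
by rewrite -(@real_normK _ (f x)) ?num_real// ler_pXn2r ?nnegrE ?fK.
Qed.

Lemma sq_integrable_cst (a : R) : sq_integrable (cst a).
Proof. by apply: (@sq_integrable_bounded _ `|a|) => //; exact: measurable_cst. Qed.

(** Since D has finite measure, the L1 norms of h_j are bounded by a convergent
    geometric series, so that the sum of the |h_j| is integrable. *)
Lemma sq_integrable_summable (h_ : nat -> T -> R) :
  (forall j, sq_integrable (h_ j)) -> (forall j, nrm (h_ j) <= 2^-1 ^+ j) ->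
  {ae mu, forall x, D x -> cvgn (series (fun j => `|h_ j x|))}.
Proof.
move=> Sh hj.
have mh j : measurable_fun D (fun x => `|h_ j x|%:E).
  by apply/measurable_EFinP/measurableT_comp => //; exact: (Sh j).1.
have c0 : 0 <= nrm (cst 1) by exact: si_norm_ge0.
have h1 j : (\int[mu]_(x in D) `|h_ j x|%:E <= (nrm (cst 1) * 2^-1 ^+ j)%:E)%E.
  have Sa : sq_integrable (fun x => `|h_ j x|).
    apply: (@sq_integrable_le _ (h_ j)) => //; last by move=> x _; rewrite normr_id.
    by apply: measurableT_comp => //; exact: (Sh j).1.
  have i1 : mu.-integrable D (EFin \o (cst 1 \* (fun x => `|h_ j x|))).
    by apply: sq_integrable_mul => //; exact: sq_integrable_cst.
  have := si_cauchy_schwarz l2_semi_inner (sq_integrable_cst 1) Sa.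
  have -> : nrm (fun x => `|h_ j x|) = nrm (h_ j).
    congr Num.sqrt; apply: eq_Rintegral => x _.
    by rewrite -expr2 real_normK ?num_real.
  move=> /(le_trans (ler_norm _)) H.
  have := Rintegral_fine i1; under eq_integral do rewrite /= mul1r; move=> ->.
  by rewrite lee_fin (le_trans H)// ler_wpM2l.
have : mu.-integrable D (fun x => \sum_(0 <= j <oo) `|h_ j x|%:E)%E.
  apply/integrableP; split.
    apply: ge0_emeasurable_sum => // k x Dx _; by rewrite lee_fin.
  rewrite (eq_integral (fun x => \sum_(0 <= j <oo) `|h_ j x|%:E)%E); last first.
    by move=> x _; rewrite gee0_abs// nneseries_ge0// => *; rewrite lee_fin.
  rewrite integral_nneseries//.
  apply: (@le_lt_trans _ _ (nrm (cst 1) * 2)%:E); last exact: ltry.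
  apply: lime_le.
    by apply: is_cvg_nneseries => n _ _; apply: integral_ge0 => x _; rewrite lee_fin.
  apply: nearW => n.
  apply: (@le_trans _ _ (\sum_(0 <= j < n) (nrm (cst 1) * 2^-1 ^+ j)%:E)%E).
    exact: lee_sum.
  rewrite sumEFin lee_fin -mulr_sumr ler_wpM2l//.
  have -> : \sum_(0 <= i < n) (2^-1 : R) ^+ i = 2 - 2 * 2^-1 ^+ n.
    elim: n => [|n IH]; first by rewrite big_nil expr0; ring.
    by rewrite big_nat_recr//= IH exprS; field.
  by rewrite lerBlDr lerDl mulr_ge0 ?exprn_ge0 ?invr_ge0.
move/(integrable_ae mD); apply: filterS => x + Dx => /(_ Dx) xfin.
apply: nondecreasing_is_cvgn.
  by apply: nondecreasing_series => n _ _; rewrite normr_ge0.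
exists (fine (\sum_(0 <= j <oo) `|h_ j x|%:E)%E) => _ [n _ <-].
rewrite -lee_fin fineK// /series/= -sumEFin.
by apply: nneseries_lim_ge => *; rewrite lee_fin.
Qed.

Lemma geometric_subseq (P : nat -> nat -> Prop) :
  (forall j, exists N, forall n, (N <= n)%N -> P j n) ->
  exists2 k : nat -> nat, {homo k : m n / (m < n)%N >-> (m < n)%N} &
    forall j n, (k j <= n)%N -> P j n.
Proof.
move=> /choice[N HN].
pose k := fix k j := if j is i.+1 then maxn (N j) (k i).+1 else N 0%N.
exists k.
  apply: homo_ltn => [x y z|j]; first exact: ltn_trans.
  by rewrite /= leq_maxr.
case=> [|j] n /= kn; apply: HN => //; rewrite (leq_trans _ kn)//; exact: leq_maxl.
Qed.

Lemma l2_cvg_ae_subseq (u_ : nat -> T -> R) (u : T -> R) :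
  (forall n, sq_integrable (u_ n)) -> sq_integrable u ->
  nrm (u_ n - u) @[n --> \oo] --> 0 ->
  exists2 k : nat -> nat, {homo k : m n / (m < n)%N >-> (m < n)%N} &
    {ae mu, forall x, D x -> u_ (k j) x @[j --> \oo] --> u x}.
Proof.
move=> Su_ Su cu.
have [k kinc kP] : exists2 k : nat -> nat, {homo k : m n / (m < n)%N >-> (m < n)%N} &
    forall j n, (k j <= n)%N -> nrm (u_ n - u) <= 2^-1 ^+ j.
  apply: geometric_subseq => j; have [|N HN] := cvgr0_natE cu (_ : 0 < 2^-1 ^+ j).
    by rewrite exprn_gt0// invr_gt0.
  by exists N => n /HN; apply: le_trans; rewrite ler_norm.
exists k => //.
have := @sq_integrable_summable (fun j => u_ (k j) - u) _ (fun j => kP j _ (leqnn _)).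
move=> /(_ (fun j => si_B l2_semi_inner (Su_ _) Su)).
apply: filterS => x + Dx => /(_ Dx)/cvg_series_cvg_0 c.
by apply: cvg_ler_dist c => n.
Qed.

(** Riesz-Fischer: a fast Cauchy subsequence converges almost everywhere, and
    Fatou's lemma bounds the distance to its pointwise limit. *)
Lemma l2_complete : si_complete sq_integrable l2_inner.
Proof.
move=> u_ Su_ cu.
have [k kinc kP] : exists2 k : nat -> nat, {homo k : m n / (m < n)%N >-> (m < n)%N} &
    forall j n, (k j <= n)%N -> forall m, (n <= m)%N -> nrm (u_ m - u_ n) <= 2^-1 ^+ j.
  apply: geometric_subseq => j; have [|N HN] := cu (2^-1 ^+ j).
    by rewrite exprn_gt0// invr_gt0.
  by exists N => n Nn m nm; apply: HN => //; rewrite (leq_trans Nn).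
have kge n : (n <= k n)%N by elim: n => // n IH; rewrite (leq_ltn_trans IH)// kinc.
pose v j : T -> R := u_ (k j).
(* The upper limit is measurable, and equals the limit where there is one. *)
pose f x : R := fine (limn_esup (fun j => (v j x)%:E)).
have mf : measurable_fun D f.
  apply: (measurableT_comp (@fine_measurable R setT measurableT)).
  by apply: measurable_fun_limn_esup => n; apply/measurable_EFinP; exact: (Su_ _).1.
have vf : {ae mu, forall x, D x -> v j x @[j --> \oo] --> f x}.
  have Sh j : sq_integrable (v j.+1 - v j) by exact: (si_B l2_semi_inner (Su_ _) (Su_ _)).
  have hj j : nrm (v j.+1 - v j) <= 2^-1 ^+ j.
    by apply: (kP j (k j) (leqnn _)); rewrite ltnW ?kinc.
  have := sq_integrable_summable Sh hj.
  apply: filterS => x + Dx => /(_ Dx)/normed_cvg c.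
  have {c} : cvgn (fun j => v j x).
    rewrite (_ : (fun j => v j x) =
      (fun j => v 0%N x + series (fun j => (v j.+1 - v j) x) j)).
      by apply: is_cvgD; [exact: is_cvg_cst|exact: c].
    apply/funext => j; rewrite /series/= -[in LHS](subrK (v 0%N x) (v j x)) addrC.
    by rewrite -(@telescope_sumr _ 0 j (fun i => v i x)).
  move=> c; have cE : (v j x)%:E @[j --> \oo] --> (limn (fun j => v j x))%:E.
    by apply: cvg_EFin => //; exact: nearW.
  by rewrite /f (cvg_limn_einf_sup cE).2.
have key j n : (k j <= n)%N ->
    sq_integrable (f - u_ n) /\ nrm (f - u_ n) <= 2^-1 ^+ j.
  move=> kjn; have e0 : 0 <= (2^-1 ^+ j : R) by rewrite exprn_ge0// invr_ge0.
  have mfu : measurable_fun D (f - u_ n).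
    by apply: measurable_funB => //; exact: (Su_ _).1.
  have Svu i : sq_integrable (v i - u_ n) by exact: (si_B l2_semi_inner (Su_ _) (Su_ _)).
  have fat : (\int[mu]_(x in D) (((f - u_ n) x) ^+ 2)%:E <= ((2^-1 ^+ j) ^+ 2)%:E)%E.
    apply: (@fatou_bound (fun i x => ((v (i + n)%N - u_ n) x) ^+ 2)).
    - by move=> i; apply: measurable_funX; exact: (Svu _).1.
    - exact: measurable_funX.
    - by move=> *; exact: sqr_ge0.
    - by move=> *; exact: sqr_ge0.
    - apply: filterS vf => x + Dx => /(_ Dx) c.
      have {}c : v (i + n)%N x - u_ n x @[i --> \oo] --> f x - u_ n x.
        apply: cvgB; last exact: cvg_cst.
        by apply: (@cvgr_infty_subseq _ (fun i => v i x) (addn^~ n)) c => a b; rewrite ltn_add2r.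
      by rewrite [in X in _ --> X]expr2; under eq_fun do rewrite expr2; exact: cvgM.
    - move=> i.
      rewrite [leLHS](@Rintegral_fine (fun x => ((v (i + n)%N - u_ n) x) ^+ 2)).
        have := si_norm_sqr l2_semi_inner (Svu (i + n)%N).
        rewrite /l2_inner; under eq_Rintegral do rewrite -expr2; move=> <-.
        rewrite lee_fin ler_sqr ?nnegrE ?si_norm_ge0//.
        by apply: kP => //; rewrite (leq_trans _ (kge _)) ?leq_addl.
      exact: (Svu _).2.
  have Sfu : sq_integrable (f - u_ n).
    split=> //; apply: integral_le_integrable fat; first exact: measurable_funX.
    by move=> *; exact: sqr_ge0.
  split=> //; rewrite -ler_sqr ?nnegrE ?si_norm_ge0//.
  rewrite (si_norm_sqr l2_semi_inner Sfu) -lee_fin; apply: le_trans fat.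
  by rewrite (@Rintegral_fine (fun x => ((f - u_ n) x) ^+ 2)) ?lee_fin; [|exact: Sfu.2].
have Sf : sq_integrable f.
  rewrite -(subrK (u_ (k 0%N)) f); apply: (si_D l2_semi_inner) => //.
  exact: (key 0%N _ (leqnn _)).1.
exists f => //; apply: cvgr0_nat => e e0.
have [N _ HN] := near_infty_natSinv_lt (PosNum e0).
exists (k N) => n /key[_]; rewrite (si_norm_distC l2_semi_inner)// ger0_norm ?si_norm_ge0//.
move/le_trans; apply; apply: le_trans (ltW (HN N (leqnn N))).
rewrite exprVn lef_pV2 ?posrE ?exprn_gt0 ?ltr0n// -natrX ler_nat.
exact: ltn_expl.
Qed.

End square_integrable.

(** * Bounded measurable functions supported in a set of finite measure *)

Section bounded_supported.
Context {R : realType} {d : measure_display} {T : measurableType d}.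
Implicit Types (B : set T) (f g : T -> R).

(** A class that is stable under products, slicing and partial integration, and
    whose members are integrable as soon as B has finite measure. *)
Definition bounded_supp B f :=
  [/\ measurable_fun setT f, exists K, forall x, `|f x| <= K &
      forall x, ~ B x -> f x = 0].

Lemma bounded_supp_out B f x : bounded_supp B f -> ~ B x -> f x = 0.
Proof. by case=> _ _; apply. Qed.

Lemma bounded_suppD B f g : bounded_supp B f -> bounded_supp B g ->
  bounded_supp B (fun x => f x + g x).
Proof.
move=> [mf [K fK] fB] [mg [L gL] gB]; split; first exact: measurable_funD.
  by exists (K + L) => x; rewrite (le_trans (ler_normD _ _))// lerD.
by move=> x Bx; rewrite fB// gB// addr0.
Qed.

Lemma bounded_suppM B f g : bounded_supp B f -> measurable_fun setT g ->
  (exists K, forall x, `|g x| <= K) -> bounded_supp B (fun x => f x * g x).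
Proof.
move=> [mf [K fK] fB] mg [L gL]; split; first exact: measurable_funM.
  by exists (K * L) => x; rewrite normrM ler_pM.
by move=> x Bx; rewrite fB// mul0r.
Qed.

Lemma bounded_suppMM B f g : bounded_supp B f -> bounded_supp B g ->
  bounded_supp B (fun x => f x * g x).
Proof. by move=> Bf [mg bg _]; exact: bounded_suppM. Qed.

Lemma bounded_suppX B f n : bounded_supp B f -> bounded_supp B (fun x => f x ^+ n.+1).
Proof.
move=> Bf; elim: n => [|n IH]; first by under eq_fun do rewrite expr1.
by under eq_fun do rewrite exprS; exact: bounded_suppMM.
Qed.

Lemma bounded_suppZ B (a : R) f : bounded_supp B f -> bounded_supp B (fun x => a * f x).
Proof.
move=> Bf; under eq_fun do rewrite mulrC; apply: (@bounded_suppM _ _ (cst a)) => //.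
by exists `|a| => x.
Qed.

Lemma bounded_suppB B f g : bounded_supp B f -> bounded_supp B g ->
  bounded_supp B (fun x => f x - g x).
Proof.
move=> Bf Bg; under eq_fun do rewrite -mulN1r; apply: bounded_suppD => //.
exact: bounded_suppZ.
Qed.

Lemma bounded_supp_norm B f : bounded_supp B f -> bounded_supp B (fun x => `|f x|).
Proof.
move=> [mf [K fK] fB]; split; first exact: measurableT_comp.
  by exists K => x; rewrite normr_id.
by move=> x Bx; rewrite fB// normr0.
Qed.

Lemma bounded_supp0 B : bounded_supp B (fun=> 0 : R).
Proof. by split => //; exists 0 => x; rewrite normr0. Qed.

Lemma bounded_supp_sum B (I : Type) (s : seq I) (f : I -> T -> R) :
  (forall i, bounded_supp B (f i)) -> bounded_supp B (fun x => \sum_(i <- s) f i x).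
Proof.
move=> Bf; elim: s => [|i s IH].
  by under eq_fun do rewrite big_nil; exact: bounded_supp0.
by under eq_fun do rewrite big_cons; exact: bounded_suppD.
Qed.

Lemma bounded_supp_indic B C : measurable C -> C `<=` B ->
  bounded_supp B (\1_C : T -> R).
Proof.
move=> mC CB; split => [||x Bx]; first exact: measurable_indic.
  exists 1 => x; rewrite indicE; case: (_ \in _); first by rewrite normr1.
  by rewrite normr0.
by rewrite indicE memNset// => /CB.
Qed.

Variables (mu : {measure set T -> \bar R}) (B : set T).
Hypotheses (mB : measurable B) (muB : (mu B < +oo)%E).

Lemma bounded_supp_integrable f : bounded_supp B f -> mu.-integrable setT (EFin \o f).
Proof.
move=> [mf [K fK] fB].
have -> : EFin \o f = (EFin \o f) \_ B.
  apply/funext => x; rewrite patchE; case: ifPn => // xB /=.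
  by rewrite fB// => /mem_set; exact/negP.
apply/(integrable_restrict _ _ _ _).1 => //; rewrite setTI.
apply: measurable_bounded_integrable => //; first exact: measurable_funTS.
exists K; split; first exact: num_real.
by move=> y Ky x Bx; rewrite /= (le_trans (fK x))// ltW.
Qed.

Lemma bounded_supp_sq_integrable f : bounded_supp B f -> sq_integrable mu setT f.
Proof.
move=> Bf; have [mf _ _] := Bf; split=> //.
exact: (bounded_supp_integrable (bounded_suppX 1 Bf)).
Qed.

Local Notation I f := (\int[mu]_x f x).

Lemma bsint_ge0 f : (forall x, 0 <= f x) -> 0 <= I f.
Proof. by move=> f0; apply: Rintegral_ge0. Qed.

Lemma bsint_le f g : bounded_supp B f -> bounded_supp B g ->
  (forall x, f x <= g x) -> I f <= I g.
Proof. by move=> Bf Bg fg; apply: le_Rintegral => //; exact: bounded_supp_integrable. Qed.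

Lemma bsintD f g : bounded_supp B f -> bounded_supp B g ->
  \int[mu]_x (f x + g x) = I f + I g.
Proof. by move=> Bf Bg; rewrite RintegralD//; exact: bounded_supp_integrable. Qed.

Lemma bsintB f g : bounded_supp B f -> bounded_supp B g ->
  \int[mu]_x (f x - g x) = I f - I g.
Proof. by move=> Bf Bg; rewrite RintegralB//; exact: bounded_supp_integrable. Qed.

Lemma bsintZ a f : bounded_supp B f -> \int[mu]_x (a * f x) = a * I f.
Proof. by move=> Bf; rewrite RintegralZl//; exact: bounded_supp_integrable. Qed.

Lemma bsint_sum (J : Type) (s : seq J) (f : J -> T -> R) :
  (forall j, bounded_supp B (f j)) ->
  \int[mu]_x (\sum_(j <- s) f j x) = \sum_(j <- s) I (f j).
Proof.
by move=> Bf; apply: Rintegral_sum => // j; exact: bounded_supp_integrable.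
Qed.

Lemma bsint_cauchy_schwarz f g : bounded_supp B f -> bounded_supp B g ->
  (\int[mu]_x (f x * g x)) ^+ 2 <= (\int[mu]_x (f x ^+ 2)) * \int[mu]_x (g x ^+ 2).
Proof.
move=> Bf Bg.
apply: le_trans (si_cauchy_schwarz_sqr (l2_semi_inner mu measurableT)
  (bounded_supp_sq_integrable Bf) (bounded_supp_sq_integrable Bg)) _.
by rewrite le_eqVlt; apply/predU1l; congr (_ * _); apply: eq_Rintegral => x _;
  rewrite expr2.
Qed.

Lemma bsint_norm f : bounded_supp B f -> `|I f| <= \int[mu]_x `|f x|.
Proof. by move=> Bf; apply: le_normr_Rintegral => //; exact: bounded_supp_integrable. Qed.

(** Brings the integrals over intervals that come from the fundamental theorem of
    calculus back to the whole space. *)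
Lemma bsint_indic f C : measurable C -> \int[mu]_(x in C) f x = \int[mu]_x (f x * \1_C x).
Proof.
move=> mC; rewrite Rintegral_mkcond; apply: eq_Rintegral => x _.
by rewrite patchE indicE; case: ifP; rewrite ?mulr1 ?mulr0.
Qed.

End bounded_supported.

(** * Iterated integration *)

Section bounded_supported_prod.
Context {R : realType} {d1 d2 : measure_display}
  {T1 : measurableType d1} {T2 : measurableType d2}.
Variables (m1 : {sigma_finite_measure set T1 -> \bar R})
  (m2 : {sigma_finite_measure set T2 -> \bar R}) (B1 : set T1) (B2 : set T2).
Hypotheses (mB1 : measurable B1) (mB2 : measurable B2)
  (m1B1 : (m1 B1 < +oo)%E) (m2B2 : (m2 B2 < +oo)%E).
Implicit Types f : T1 * T2 -> R.

Lemma bounded_supp_section1 f x : bounded_supp (B1 `*` B2) f ->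
  bounded_supp B2 (fun y => f (x, y)).
Proof.
move=> [mf [K fK] fB]; split; first exact: measurable_fun_pair2.
  by exists K => y.
by move=> y By; rewrite fB// => -[].
Qed.

Lemma bounded_supp_section2 f y : bounded_supp (B1 `*` B2) f ->
  bounded_supp B1 (fun x => f (x, y)).
Proof.
move=> [mf [K fK] fB]; split; first exact: measurable_fun_pair1.
  by exists K => x.
by move=> x Bx; rewrite fB// => -[].
Qed.

Let prod_fin : ((m1 \x m2)%E (B1 `*` B2) < +oo)%E.
Proof. by rewrite product_measure1E// lte_mul_pinfty// ge0_fin_numE. Qed.

Let prod_int f : bounded_supp (B1 `*` B2) f ->
  (m1 \x m2)%E.-integrable setT (EFin \o f).
Proof. by apply: bounded_supp_integrable => //; exact: measurableX. Qed.

Lemma bounded_supp_fubini1 f : bounded_supp (B1 `*` B2) f ->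
  bounded_supp B1 (fun x => \int[m2]_y f (x, y)).
Proof.
move=> Bf; have [mf [K fK] fB] := Bf; split.
- apply: (measurableT_comp (@fine_measurable R setT measurableT)).
  exact: measurable_fubini_F (prod_int Bf).
- exists (K * fine (m2 B2)) => x; have Bfx := bounded_supp_section1 x Bf.
  rewrite (le_trans (bsint_norm mB2 m2B2 Bfx))//.
  apply: (@le_trans _ _ (\int[m2]_y (K * \1_B2 y))).
    apply: (bsint_le mB2 m2B2); first exact: bounded_supp_norm.
      by apply: bounded_suppZ; exact: bounded_supp_indic.
    move=> y; rewrite indicE; have [yB|yB] := boolP (y \in B2); first by rewrite mulr1.
    by rewrite mulr0 fB ?normr0// => -[_ /mem_set]; exact/negP.
  rewrite (bsintZ mB2 m2B2); last exact: bounded_supp_indic.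
  have := bsint_indic m2 (cst 1) mB2; under [in RHS]eq_Rintegral do rewrite mul1r.
  by move=> <-; rewrite Rintegral_cst// mul1r.
- move=> x Bx; rewrite -[RHS](mul0r (fine (m2 setT))) -Rintegral_cst//.
  by apply: eq_Rintegral => y _; rewrite fB// => -[].
Qed.

Lemma bounded_supp_fubini2 f : bounded_supp (B1 `*` B2) f ->
  bounded_supp B2 (fun y => \int[m1]_x f (x, y)).
Proof.
move=> Bf; have [mf [K fK] fB] := Bf; split.
- apply: (measurableT_comp (@fine_measurable R setT measurableT)).
  exact: measurable_fubini_G (prod_int Bf).
- exists (K * fine (m1 B1)) => y; have Bfy := bounded_supp_section2 y Bf.
  rewrite (le_trans (bsint_norm mB1 m1B1 Bfy))//.
  apply: (@le_trans _ _ (\int[m1]_x (K * \1_B1 x))).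
    apply: (bsint_le mB1 m1B1); first exact: bounded_supp_norm.
      by apply: bounded_suppZ; exact: bounded_supp_indic.
    move=> x; rewrite indicE; have [xB|xB] := boolP (x \in B1); first by rewrite mulr1.
    by rewrite mulr0 fB ?normr0// => -[/mem_set xB' _]; move/negP : xB.
  rewrite (bsintZ mB1 m1B1); last exact: bounded_supp_indic.
  have := bsint_indic m1 (cst 1) mB1; under [in RHS]eq_Rintegral do rewrite mul1r.
  by move=> <-; rewrite Rintegral_cst// mul1r.
- move=> y By; rewrite -[RHS](mul0r (fine (m1 setT))) -Rintegral_cst//.
  by apply: eq_Rintegral => x _; rewrite fB// => -[].
Qed.

Lemma bsint_prod1 f : bounded_supp (B1 `*` B2) f ->
  \int[(m1 \x m2)%E]_z f z = \int[m1]_x \int[m2]_y f (x, y).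
Proof.
move=> Bf; rewrite /Rintegral -(integral12_prod_meas1 (prod_int Bf)).
congr fine; apply: eq_integral => x _.
by rewrite -Rintegral_fine//; exact: bounded_supp_integrable (bounded_supp_section1 x Bf).
Qed.

Lemma bsint_prod2 f : bounded_supp (B1 `*` B2) f ->
  \int[(m1 \x m2)%E]_z f z = \int[m2]_y \int[m1]_x f (x, y).
Proof.
move=> Bf; rewrite /Rintegral -(integral21_prod_meas1 (prod_int Bf)).
congr fine; apply: eq_integral => y _.
by rewrite -Rintegral_fine//; exact: bounded_supp_integrable (bounded_supp_section2 y Bf).
Qed.

End bounded_supported_prod.

Section bounded_supported_rV.
Context {R : realType}.
Implicit Types (M : R) (n : nat).

Definition seg M : set (measurableTypeR R) := `[- M, M]%classic.

Definition cube n M : set 'rV[R]_n := [set x | forall i, seg M (x ord0 i)].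

Arguments cube : clear implicits.

Lemma measurable_seg M : measurable (seg M).
Proof. exact: measurable_itv. Qed.

Lemma measurable_cube n M : measurable (cube n M).
Proof. by apply: (@measurable_rV_box _ _ (fun=> seg M)) => i; exact: measurable_seg. Qed.

Lemma lebesgue_segment_fin M : (@lebesgue_measure R (seg M) < +oo)%E.
Proof. by rewrite /seg lebesgue_measure_itv/=; case: ifPn => // _; rewrite -EFinD ltry. Qed.

Lemma lebesgue_cube_fin n M : (lebesgue_rV n (cube n M) < +oo)%E.
Proof.
rewrite (lebesgue_rV_box (A := fun=> seg M)); last first.
  by move=> i; exact: measurable_seg.
suff /andP[] : (0 <= \prod_(i < n) @lebesgue_measure R (seg M) < +oo)%E by [].
apply: (big_ind (fun x => 0 <= x < +oo)%E) => [|x y /andP[x0 xy] /andP[y0 yy]|i _].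
- by rewrite lee_fin ler01 ltry.
- by rewrite mule_ge0//= lte_mul_pinfty// ge0_fin_numE.
- by rewrite measure_ge0 lebesgue_segment_fin.
Qed.

Local Notation J n f := (\int[lebesgue_rV n]_x f x).

Variables (n : nat) (M : R) (f : 'rV[R]_n.+1 -> R).
Hypothesis Bf : bounded_supp (cube n.+1 M) f.

Let measurable_cons :
  measurable_fun setT (@rV_cons R n : measurableTypeR R * 'rV[R]_n -> 'rV[R]_n.+1).
Proof. exact: measurable_rV_cons. Qed.

Lemma bounded_supp_rV_cons :
  @bounded_supp R _ (measurableTypeR R * 'rV[R]_n)%type (seg M `*` cube n M)
    (fun z => f (rV_cons z)).
Proof.
have [mf [K fK] fB] := Bf; split.
- exact: (measurableT_comp mf measurable_cons).
- by exists K => x; exact: fK.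
- move=> [t x] /= tx; rewrite fB// => H; apply: tx; split.
    by have := H ord0; rewrite rV_cons0.
  by move=> i; have := H (lift ord0 i); rewrite rV_consS.
Qed.

Lemma bounded_supp_slice t : bounded_supp (cube n M) (fun x => f (rV_cons (t, x))).
Proof. exact: (bounded_supp_section1 t bounded_supp_rV_cons). Qed.

Lemma bounded_supp_line x : bounded_supp (seg M) (fun t : measurableTypeR R => f (rV_cons (t, x))).
Proof. exact: (bounded_supp_section2 x bounded_supp_rV_cons). Qed.

Let intrVE : J n.+1 f = \int[(lebesgue_measure \x lebesgue_rV n)%E]_z f (rV_cons z).
Proof.
have [mf _ _] := Bf.
have H := integral_pushforward measurable_cons
  (mu := (lebesgue_measure \x lebesgue_rV n)%E) (D := setT) (f := EFin \o f).
rewrite /Rintegral; congr fine; apply: etrans (H _ _ _) _ => //.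
- exact/measurable_EFinP.
- rewrite preimage_setT; apply: (@bounded_supp_integrable _ _ _ _ (seg M `*` cube n M)).
  + apply: measurableX; [exact: measurable_seg|exact: measurable_cube].
  + rewrite /= product_measure1E ?lte_mul_pinfty// ?ge0_fin_numE//.
    * exact: lebesgue_segment_fin.
    * exact: lebesgue_cube_fin.
    * exact: measurable_seg.
    * exact: measurable_cube.
  + exact: bounded_supp_rV_cons.
Qed.

Lemma int_rVS1 : J n.+1 f = \int[lebesgue_measure]_t J n (fun x => f (rV_cons (t, x))).
Proof.
rewrite intrVE; apply: (bsint_prod1 _ _ _ _ bounded_supp_rV_cons).
- exact: measurable_seg.
- exact: measurable_cube.
- exact: lebesgue_segment_fin.
- exact: lebesgue_cube_fin.
Qed.

Lemma int_rVS2 : J n.+1 f = J n (fun x => \int[lebesgue_measure]_t f (rV_cons (t, x))).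
Proof.
rewrite intrVE; apply: (bsint_prod2 _ _ _ _ bounded_supp_rV_cons).
- exact: measurable_seg.
- exact: measurable_cube.
- exact: lebesgue_segment_fin.
- exact: lebesgue_cube_fin.
Qed.

Lemma bounded_supp_int_slice :
  bounded_supp (seg M) (fun t : measurableTypeR R => J n (fun x => f (rV_cons (t, x)))).
Proof.
apply: (bounded_supp_fubini1 _ _ _ _ bounded_supp_rV_cons).
- exact: measurable_seg.
- exact: measurable_cube.
- exact: lebesgue_segment_fin.
- exact: lebesgue_cube_fin.
Qed.

Lemma bounded_supp_int_line :
  bounded_supp (cube n M) (fun x => \int[lebesgue_measure]_t f (rV_cons (t, x))).
Proof.
apply: (bounded_supp_fubini2 _ _ _ _ bounded_supp_rV_cons).
- exact: measurable_seg.
- exact: measurable_cube.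
- exact: lebesgue_segment_fin.
- exact: lebesgue_cube_fin.
Qed.

End bounded_supported_rV.
Arguments cube {R} n M.
Arguments measurable_cube : clear implicits.
Arguments measurable_cube {R} n M.
Arguments lebesgue_cube_fin : clear implicits.
Arguments lebesgue_cube_fin {R} n M.
Arguments measurable_seg : clear implicits.
Arguments measurable_seg {R} M.

(** * Compactly supported functions of one variable *)

Section continuous_rV.
Context {R : realType}.

Lemma continuous_rV (T : topologicalType) n (h : T -> 'rV[R]_n) :
  (forall i, continuous (fun x => h x ord0 i)) -> continuous h.
Proof.
move=> ch x A [P hP PA].
apply: (@filterS _ (nbhs x) _ (fun y => forall i, P ord0 i (h y ord0 i))).
  by move=> y Py; apply: PA => i j; rewrite (ord1 i).
by apply: filter_forall => i; exact: (ch i x _ (hP ord0 i)).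
Qed.

Lemma continuous_measurable_rV n (f : 'rV[R]_n -> R) :
  continuous f -> measurable_fun setT f.
Proof.
move=> /continuousP cf; apply: (measurability _ (RGenOpens.measurableE R)).
move=> _ [_ [a [b ->] <-]]; rewrite setTI; apply: open_measurable_rV.
exact/cf/interval_open.
Qed.

Lemma continuous_bounded_cube n M (f : 'rV[R]_n -> R) : continuous f ->
  (forall x, ~ cube n M x -> f x = 0) -> exists K, forall x, `|f x| <= K.
Proof.
move=> cf f0.
have cc : compact (cube n M) by exact: (@rV_compact R n (fun=> `[- M, M]%classic) (fun=> @segment_compact R (- M) M)).
have /compact_bounded[K [_ HK]] : compact (f @` cube n M).
  by apply: continuous_compact => //; exact: continuous_subspaceT.
exists (`|K| + 1) => x; have [xc|xc] := pselect (cube n M x).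
  by apply: HK; [rewrite (le_lt_trans (ler_norm _))// ltrDl|exists x].
by rewrite f0// normr0 addr_ge0.
Qed.

Lemma continuous_bounded_supp n M (f : 'rV[R]_n -> R) : continuous f ->
  (forall x, ~ cube n M x -> f x = 0) -> bounded_supp (cube n M) f.
Proof.
move=> cf f0; split => //; first exact: continuous_measurable_rV.
exact: continuous_bounded_cube cf f0.
Qed.

Lemma continuous_rV_consl n (x : 'rV[R]_n) : continuous (fun t => rV_cons (t, x)).
Proof.
apply: continuous_rV => i; case: (unliftP ord0 i) => [j|] ->.
  under eq_fun do rewrite rV_consS /=; exact: cst_continuous.
under eq_fun do rewrite rV_cons0 /=; move=> t; exact: cvg_id.
Qed.

Lemma continuous_rV_consr n (t : R) : continuous (fun x : 'rV[R]_n => rV_cons (t, x)).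
Proof.
apply: continuous_rV => i; case: (unliftP ord0 i) => [j|] ->.
  under eq_fun do rewrite rV_consS /=; exact: coord_continuous.
under eq_fun do rewrite rV_cons0 /=; exact: cst_continuous.
Qed.

End continuous_rV.

Section line.
Context {R : realType}.
Local Notation leb := (@lebesgue_measure R).
Variables (M : R) (F f : R -> R).
Hypotheses (Fd : forall t, is_derive t (1 : R) F (f t)) (cf : continuous f).
Hypotheses (BF : @bounded_supp R _ (measurableTypeR R) (seg M) F)
           (Bf : @bounded_supp R _ (measurableTypeR R) (seg M) f).

Lemma is_derive1_continuous (G g : R -> R) :
  (forall t, is_derive t (1 : R) G (g t)) -> continuous G.
Proof. by move=> Gd t; apply: differentiable_continuous; apply/derivable1_diffP; exact: (@ex_derive _ _ _ _ _ _ _ (Gd t)). Qed.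

Lemma ftc_line (G g : R -> R) (a b : R) : (forall t, is_derive t (1 : R) G (g t)) ->
  continuous g -> a < b -> \int[leb]_(t in `[a, b]) g t = G b - G a.
Proof.
move=> Gd cg ab; rewrite /Rintegral (@continuous_FTC2 _ g G)//.
- exact: continuous_subspaceT.
- have cG := is_derive1_continuous Gd; split.
  + by move=> x _; exact: (@ex_derive _ _ _ _ _ _ _ (Gd x)).
  + exact: cvg_at_right_filter (cG a).
  + exact: cvg_at_left_filter (cG b).
- by move=> x _; rewrite derive1E; exact: (@derive_val _ _ _ _ _ _ _ (Gd x)).
Qed.

Lemma seg_widen (N : R) (h : R -> R) : M <= N ->
  @bounded_supp R _ (measurableTypeR R) (seg M) h ->
  @bounded_supp R _ (measurableTypeR R) (seg N) h.
Proof.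
move=> MN [mh hK h0]; split=> // x Nx; apply: h0 => Mx; apply: Nx.
move: Mx; rewrite /seg/= !in_itv/= => /andP[? ?]; lra.
Qed.

(** Cauchy-Schwarz in the fundamental theorem of calculus. *)
Lemma line_holder a b : (F b - F a) ^+ 2 <= `|b - a| * \int[leb]_t (f t ^+ 2).
Proof.
wlog ab : a b / a <= b => [H|].
  have [/H//|/ltW/H] := leP a b; by rewrite distrC -sqrrN opprB.
move: ab; rewrite le_eqVlt => /predU1P[->|ab].
  by rewrite !subrr expr0n normr0 mul0r.
pose N := `|a| + `|b| + `|M|.
have MN : M <= N by rewrite /N (le_trans (ler_norm M))// lerDr addr_ge0.
have BNf := seg_widen MN Bf.
have BI : @bounded_supp R _ (measurableTypeR R) (seg N) (\1_`[a, b]).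
  apply: bounded_supp_indic; first exact: measurable_itv.
  move=> x; rewrite /seg /N/= !in_itv/= => /andP[ax xb]; apply/andP.
  have := ler_norm b; have := ler_norm (- a); rewrite normrN.
  have := normr_ge0 a; have := normr_ge0 b; have := normr_ge0 M; split; lra.
rewrite -(ftc_line Fd cf ab) bsint_indic; last exact: measurable_itv.
apply: le_trans (bsint_cauchy_schwarz (measurable_seg N) (lebesgue_segment_fin N) BNf BI) _.
rewrite mulrC ler_wpM2r//; first by apply: Rintegral_ge0 => t _; exact: sqr_ge0.
have -> : \int[leb]_t (\1_(`[a, b]%classic : set R) t ^+ 2) = b - a; last exact: ler_norm.
have := @bsint_indic R _ (measurableTypeR R) leb (cst 1) `[a, b]%classic (measurable_itv _).
rewrite Rintegral_cst ?mul1r; last exact: measurable_itv.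
rewrite /= lebesgue_measure_itv/= lte_fin ab/= => ->; apply: eq_Rintegral => t _.
by rewrite mul1r indicE; case: (_ \in _); rewrite ?expr1n ?expr0n.
Qed.

(** The derivative of F ^+ 2 is 2 * F * f, and F vanishes far to the left. *)
Lemma line_sup t : F t ^+ 2 <= \int[leb]_s (2 * `|F s * f s|).
Proof.
have BFf : @bounded_supp R _ (measurableTypeR R) (seg M) (fun s => 2 * `|F s * f s|).
  by apply: bounded_suppZ; apply: bounded_supp_norm; exact: bounded_suppMM.
have BG : @bounded_supp R _ (measurableTypeR R) (seg M) (fun s => 2 * (F s * f s)).
  by apply: bounded_suppZ; exact: bounded_suppMM.
have [mt|/(bounded_supp_out BF)->] := pselect (seg M t); last first.
  by rewrite expr0n; apply: Rintegral_ge0 => s _; rewrite mulr_ge0.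
pose a := - `|M| - 1.
have at_ : a < t.
  move: mt; rewrite /seg/= in_itv/= /a => /andP[Mt _].
  have := ler_norm M; lra.
have Fa : F a = 0.
  apply: (bounded_supp_out BF); rewrite /seg/= in_itv/= /a; move=> /andP[Ma _].
  have := ler_norm M; lra.
have Gd s : is_derive s (1 : R) (fun x => F x ^+ 2) (2 * (F s * f s)).
  have H := is_deriveX 2 (Fd s).
  rewrite (_ : (fun x => F x ^+ 2) = F ^+ 2); last by apply/funext => x.
  by apply: is_derive_eq; rewrite /GRing.scale/= expr1 mulrA.
have cG : continuous (fun s => 2 * (F s * f s)).
  move=> s; apply: cvgM; first exact: cvg_cst.
  by apply: cvgM; [exact: (is_derive1_continuous Fd)|exact: cf].
have := ftc_line Gd cG at_; rewrite Fa expr0n subr0 => <-.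
rewrite bsint_indic; last exact: measurable_itv.
apply: (bsint_le (measurable_seg M) (lebesgue_segment_fin M)) => //.
  apply: bounded_suppM BG _ _; first exact: measurable_indic (measurable_itv _).
  by exists 1 => s; rewrite indicE; case: (_ \in _); rewrite ?normr1 ?normr0.
move=> s; rewrite indicE; case: (_ \in _); rewrite ?mulr1 ?mulr0 ?mulr_ge0//.
by rewrite ler_pM2l// ler_norm.
Qed.

End line.

Section mesh.
Context {R : realType}.
Local Notation leb := (@lebesgue_measure R).
Local Notation bsupp M := (@bounded_supp R _ (measurableTypeR R) (seg M)).

(** On a cell of length h the function is within sqrt (h * H) of its mean. *)
Lemma mesh_cell (M : R) (a : R -> R) (H b h : R) : 0 < h -> 0 <= H ->
  bsupp M a ->
  (forall s t, (a t - a s) ^+ 2 <= `|t - s| * H) ->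
  \int[leb]_t (a t ^+ 2 * \1_`[b, b + h[ t) <=
  2 / h * (\int[leb]_t (a t * \1_`[b, b + h[ t)) ^+ 2 + 2 * h ^+ 2 * H.
Proof.
move=> h0 H0 Ba Ha; set I := `[b, b + h[%classic.
have mI : measurable (I : set (measurableTypeR R)) by exact: measurable_itv.
pose N := `|b| + h + `|M|.
have MN : M <= N by rewrite /N (le_trans (ler_norm M))// lerDr addr_ge0// ltW.
have BNa := seg_widen MN Ba.
have BI : bsupp N (\1_I).
  apply: bounded_supp_indic => //.
  move=> x; rewrite /I /seg /N/= !in_itv/= => /andP[ax xb]; apply/andP.
  have := ler_norm b; have := ler_norm (- b); rewrite normrN.
  have := normr_ge0 M; split; lra.
have IE : \int[leb]_t \1_I t = h.
  have := @bsint_indic R _ (measurableTypeR R) leb (cst 1) I mI.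
  rewrite Rintegral_cst ?mul1r// /= lebesgue_measure_itv/= lte_fin ltrDl h0/=.
  rewrite addrAC subrr add0r => ->.
  by apply: eq_Rintegral => t _; rewrite mul1r.
have BaI : bsupp N (fun t => a t * \1_I t) by exact: bounded_suppMM.
set A := \int[leb]_t (a t * \1_I t).
pose K := Num.sqrt (h * H).
have K0 : 0 <= K by exact: sqrtr_ge0.
have KE : K ^+ 2 = h * H by rewrite sqr_sqrtr// mulr_ge0// ltW.
have aK s t : I s -> I t -> `|a t - a s| <= K.
  move=> Is It; rewrite -ler_sqr ?nnegrE// KE real_normK ?num_real//.
  apply: le_trans (Ha s t) _; rewrite ler_wpM2r//.
  move: Is It; rewrite /I/= !in_itv/= => /andP[? ?] /andP[? ?].
  rewrite ler_norml; apply/andP; split; lra.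
have avg t : I t -> `|h * a t - A| <= h * K.
  move=> It; have B1 c : bsupp N (fun s => c * \1_I s) by exact: bounded_suppZ.
  have intc c : \int[leb]_s (c * \1_I s) = c * h.
    by rewrite (bsintZ (measurable_seg N) (lebesgue_segment_fin N))// IE.
  have up : A <= (a t + K) * h.
    rewrite -intc; apply: (bsint_le (measurable_seg N) (lebesgue_segment_fin N)) => //.
    move=> s; rewrite indicE; have [/set_mem Is|_] := boolP (s \in I); last by rewrite !mulr0.
    by rewrite !mulr1 -lerBlDl (le_trans (ler_norm _))// aK.
  have lo : (a t - K) * h <= A.
    rewrite -intc; apply: (bsint_le (measurable_seg N) (lebesgue_segment_fin N)) => //.
    move=> s; rewrite indicE; have [/set_mem Is|_] := boolP (s \in I); last by rewrite !mulr0.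
    by rewrite !mulr1 lerBlDl -lerBlDr (le_trans (ler_norm _))// aK.
  rewrite ler_norml; apply/andP; split; nra.
apply: (@le_trans _ _ (\int[leb]_t ((2 * (A / h) ^+ 2 + 2 * K ^+ 2) * \1_I t))).
  apply: (bsint_le (measurable_seg N) (lebesgue_segment_fin N)).
  - by apply: bounded_suppMM => //; exact: (bounded_suppX 1).
  - exact: bounded_suppZ.
  - move=> t; rewrite indicE; have [/set_mem It|_] := boolP (t \in I); last by rewrite !mulr0.
    rewrite !mulr1; have := avg t It.
    have -> : h * a t - A = h * (a t - A / h) by field; rewrite gt_eqF.
    rewrite normrM gtr0_norm// ler_pM2l// ler_norml => /andP[l1 l2].
    move: l1 l2; move: (A / h) (a t) => x y l1 l2.
    have : 0 <= (K - (y - x)) * (K + (y - x)) by apply: mulr_ge0; lra.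
    have := sqr_ge0 (y - 2 * x); nra.
rewrite (bsintZ (measurable_seg N) (lebesgue_segment_fin N))// IE KE.
by rewrite le_eqVlt; apply/predU1l; field; rewrite gt_eqF.
Qed.

(** A function that is Hoelder continuous of exponent 1/2 is determined, up to
    a small error in L2, by its means over the cells of a fine mesh. *)
Lemma mesh_approx (M e : R) : 0 <= M -> 0 < e ->
  exists (L : nat) (v : 'I_L -> R -> R),
    (forall l, bsupp M (v l)) /\
    forall (a : R -> R) (H : R), 0 <= H -> bsupp M a ->
      (forall s t, (a t - a s) ^+ 2 <= `|t - s| * H) ->
      \int[leb]_t (a t ^+ 2) <= \sum_l (\int[leb]_t (a t * v l t)) ^+ 2 + e * H.
Proof.
move=> M0 e0; pose D := 2 * M + 1; have D0 : 0 < D by rewrite /D; lra.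
have [L L0 Le] : exists2 L : nat, (0 < L)%N & 2 * D ^+ 2 / L%:R <= e.
  exists (Num.truncn (2 * D ^+ 2 / e)).+1 => //.
  by rewrite ler_pdivrMr ?ltr0n// -ler_pdivrMl// mulrC ltW// truncnS_gt //.
pose h := D / L%:R; have h0 : 0 < h by rewrite divr_gt0 ?ltr0n.
pose b (l : nat) := - M + l%:R * h.
pose c := Num.sqrt (2 / h).
have cE : c ^+ 2 = 2 / h by rewrite sqr_sqrtr// divr_ge0 ?ltW.
exists L, (fun (l : 'I_L) t => c * (\1_(seg M) t * \1_`[b l, b l + h[ t)).
have B1 (l : nat) : bsupp M (fun t => \1_(seg M) t * \1_`[b l, b l + h[ t).
  apply: bounded_suppM.
  - by apply: bounded_supp_indic => //; exact: measurable_seg.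
  - exact: measurable_indic (measurable_itv _).
  - by exists 1 => s; rewrite indicE; case: (_ \in _); rewrite ?normr1 ?normr0.
split=> [l|a H H0 Ba Ha]; first by apply: bounded_suppZ.
have BaI (l : nat) : bsupp M (fun t => a t * \1_`[b l, b l + h[ t).
  apply: bounded_suppM => //.
  by exists 1 => s; rewrite indicE; case: (_ \in _); rewrite ?normr1 ?normr0.
have Ba2 (l : nat) : bsupp M (fun t => a t ^+ 2 * \1_`[b l, b l + h[ t).
  apply: bounded_suppM => //; first exact: (bounded_suppX 1).
  by exists 1 => s; rewrite indicE; case: (_ \in _); rewrite ?normr1 ?normr0.
apply: (@le_trans _ _ (\sum_(l < L) \int[leb]_t (a t ^+ 2 * \1_`[b l, b l + h[ t))).
  rewrite -(bsint_sum (measurable_seg M) (lebesgue_segment_fin M)); last by move=> l; exact: Ba2.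
  apply: (bsint_le (measurable_seg M) (lebesgue_segment_fin M)).
  - exact: (bounded_suppX 1).
  - by apply: bounded_supp_sum => l; exact: Ba2.
  - move=> t; have [mt|/(bounded_supp_out Ba)->] := pselect (seg M t); last first.
      by rewrite expr0n; apply: sumr_ge0 => l _; rewrite mul0r.
    have tM0 : 0 <= (t + M) / h.
      by rewrite divr_ge0 ?(ltW h0)//; move: mt; rewrite /seg/= in_itv/= => /andP[? _]; lra.
    pose l := Num.truncn ((t + M) / h).
    have /andP[l1 l2] : l%:R <= (t + M) / h < l.+1%:R by exact: truncn_itv.
    have lL : (l < L)%N.
      rewrite -(ltr_nat R) (le_lt_trans l1)// /h ltr_pdivrMr// mulrCA divff ?mulr1 ?pnatr_eq0 -?lt0n//.
      by move: mt; rewrite /seg/= in_itv/= => /andP[_ ?]; rewrite /D; lra.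
    rewrite (bigD1 (Ordinal lL))//= indicE mem_set ?mulr1.
      by rewrite lerDl; apply: sumr_ge0 => i _; rewrite mulr_ge0 ?sqr_ge0// indicE.
    move: l1 l2; rewrite ler_pdivlMr// ltr_pdivrMr// -natr1 /= in_itv/= /b.
    move=> l1 l2; apply/andP; split; lra.
apply: (@le_trans _ _ (\sum_(l < L) ((\int[leb]_t (a t * (c * (\1_(seg M) t * \1_`[b l, b l + h[ t)))) ^+ 2 + 2 * h ^+ 2 * H))).
  apply: ler_sum => l _; apply: le_trans (mesh_cell (b l) h0 H0 Ba Ha) _.
  rewrite lerD2r -cE -exprMn -(bsintZ (measurable_seg M) (lebesgue_segment_fin M))//.
  rewrite le_eqVlt; apply/predU1l; congr (_ ^+ 2); apply: eq_Rintegral => t _.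
  have [mt|/(bounded_supp_out Ba)->] := pselect (seg M t); last by rewrite !(mul0r, mulr0).
  by rewrite [\1_(seg M) t]indicE mem_set// mul1r; ring.
rewrite big_split/= lerD2l sumr_const card_ord -[_ *+ L]mulr_natl.
rewrite mulrA ler_wpM2r//; apply: le_trans Le.
by rewrite /h le_eqVlt; apply/predU1l; field; rewrite pnatr_eq0 -lt0n.
Qed.

End mesh.

(** * Inequalities for functions of class C1 supported in a cube *)

Section c1_cube.
Context {R : realType}.
Local Notation leb := (@lebesgue_measure R).
Local Notation J n f := (\int[lebesgue_rV n]_x f x).
Local Notation bsupp1 M := (@bounded_supp R _ (measurableTypeR R) (seg M)).

(** The partial derivatives g are part of the data, so that those of a slice are the
    slices of g. *)
Record c1_cube n (M : R) (phi : 'rV[R]_n -> R) (g : 'I_n -> 'rV[R]_n -> R) : Prop := {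
  c1_cont : continuous phi;
  c1_grad_cont : forall i, continuous (g i);
  c1_supp : forall x, ~ cube n M x -> phi x = 0;
  c1_grad_supp : forall i x, ~ cube n M x -> g i x = 0;
  c1_derive : forall i x, is_derive x (delta_mx ord0 i) phi (g i x) }.

Arguments c1_cont : clear implicits.
Arguments c1_cont {n M phi g} c.
Arguments c1_grad_cont : clear implicits.
Arguments c1_grad_cont {n M phi g} c i.
Arguments c1_supp {n M phi g} c x _.
Arguments c1_grad_supp {n M phi g} c i x _.
Arguments c1_derive {n M phi g} c i x.

Lemma is_derive_transport (V W : normedModType R) (f : V -> R) (f' : W -> R)
    (a v : V) (a' v' : W) (df : R) :
  (forall h, f (h *: v + a) = f' (h *: v' + a')) -> f a = f' a' ->
  is_derive a v f df -> is_derive a' v' f' df.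
Proof.
move=> ff' faa' [dv vf].
have e : (fun h : R => h^-1 *: ((f \o shift a) (h *: v) - f a)) =
         (fun h : R => h^-1 *: ((f' \o shift a') (h *: v') - f' a')).
  by apply/funext => h; rewrite /= ff' faa'.
by split; [move: dv; rewrite /derivable e|rewrite -vf /derive e].
Qed.

Lemma rV_cons_shift0 n (t h : R) (x : 'rV[R]_n) :
  h *: delta_mx ord0 ord0 + rV_cons (t, x) = rV_cons (h + t, x).
Proof.
apply/rowP => i; rewrite mxE [X in X + _ = _]mxE [X in _ * X + _ = _]mxE; case: (unliftP ord0 i) => [j|] ->.
  by rewrite !rV_consS [lift _ _ == _]eq_sym (negbTE (neq_lift _ _)) andbF mulr0 add0r.
by rewrite !rV_cons0 !eqxx mulr1.
Qed.

Lemma rV_cons_shiftS n (t h : R) (x : 'rV[R]_n) (i : 'I_n) :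
  h *: delta_mx ord0 (lift ord0 i) + rV_cons (t, x) =
  rV_cons (t, h *: delta_mx ord0 i + x).
Proof.
apply/rowP => k; rewrite mxE [X in X + _ = _]mxE [X in _ * X + _ = _]mxE; case: (unliftP ord0 k) => [j|] ->.
  by rewrite !rV_consS !mxE (inj_eq lift_inj).
by rewrite !rV_cons0 (negbTE (neq_lift _ _)) andbF mulr0 add0r.
Qed.

Section slices.
Variables (n : nat) (M : R) (phi : 'rV[R]_n.+1 -> R) (g : 'I_n.+1 -> 'rV[R]_n.+1 -> R).
Hypothesis phig : c1_cube M phi g.

Lemma c1_bounded : bounded_supp (cube n.+1 M) phi.
Proof. exact: continuous_bounded_supp (c1_cont phig) (c1_supp phig). Qed.

Lemma c1_grad_bounded i : bounded_supp (cube n.+1 M) (g i).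
Proof. exact: continuous_bounded_supp (c1_grad_cont phig i) (c1_grad_supp phig i). Qed.

Lemma c1_line_derive x t :
  is_derive t (1 : R) (fun s => phi (rV_cons (s, x))) (g ord0 (rV_cons (t, x))).
Proof.
apply: is_derive_transport (c1_derive phig ord0 (rV_cons (t, x))) => // h.
by rewrite rV_cons_shift0 /GRing.scale/= mulr1.
Qed.

Lemma c1_line_continuous x : continuous (fun t => g ord0 (rV_cons (t, x))).
Proof.
move=> t; apply: continuous_comp; first exact: continuous_rV_consl.
exact: c1_grad_cont phig _ _.
Qed.

Lemma c1_slice t : c1_cube M (fun x => phi (rV_cons (t, x)))
  (fun i x => g (lift ord0 i) (rV_cons (t, x))).
Proof.
have notin x : ~ cube n M x -> ~ cube n.+1 M (rV_cons (t, x)).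
  by move=> Mx cx; apply: Mx => i; have := cx (lift ord0 i); rewrite rV_consS.
split.
- move=> x; apply: continuous_comp; first exact: continuous_rV_consr.
  exact: c1_cont phig _.
- move=> i x; apply: continuous_comp; first exact: continuous_rV_consr.
  exact: c1_grad_cont phig _ _.
- by move=> x /notin; exact: c1_supp phig _.
- by move=> i x /notin; exact: c1_grad_supp phig _ _.
- move=> i x; apply: is_derive_transport (c1_derive phig (lift ord0 i) (rV_cons (t, x))) => // h.
  by rewrite rV_cons_shiftS.
Qed.

(** [line_holder] on each line, integrated over the lines. *)
Lemma c1_slice_holder s t :
  J n (fun x => (phi (rV_cons (t, x)) - phi (rV_cons (s, x))) ^+ 2) <=
  `|t - s| * J n.+1 (fun x => g ord0 x ^+ 2).
Proof.
have Bg2 : bounded_supp (cube n.+1 M) (fun x => g ord0 x ^+ 2).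
  exact: (bounded_suppX 1 (c1_grad_bounded ord0)).
rewrite (int_rVS2 Bg2) -(bsintZ (measurable_cube n M) (lebesgue_cube_fin n M)); last first.
  exact: bounded_supp_int_line Bg2.
apply: (bsint_le (measurable_cube n M) (lebesgue_cube_fin n M)).
- apply: (bounded_suppX 1); apply: bounded_suppB; exact: (bounded_supp_slice c1_bounded _).
- by apply: bounded_suppZ; exact: bounded_supp_int_line Bg2.
- move=> x; apply: (@line_holder _ M (fun t => phi (rV_cons (t, x)))).
  + exact: c1_line_derive.
  + exact: c1_line_continuous.
  + exact: (bounded_supp_line (c1_grad_bounded ord0) x).
Qed.

(** [line_sup] on each line, integrated over the lines and followed by the
    Cauchy-Schwarz inequality. *)
Lemma c1_slice_sup t : J n (fun x => phi (rV_cons (t, x)) ^+ 2) <=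
  2 * Num.sqrt (J n.+1 (fun x => phi x ^+ 2)) * Num.sqrt (J n.+1 (fun x => g ord0 x ^+ 2)).
Proof.
have B2 : bounded_supp (cube n.+1 M) (fun x => `|phi x * g ord0 x|).
  by apply: bounded_supp_norm; apply: bounded_suppMM; [exact: c1_bounded|exact: c1_grad_bounded].
have B3 := bounded_suppZ 2 B2.
apply: (@le_trans _ _ (J n.+1 (fun x => 2 * `|phi x * g ord0 x|))).
  rewrite (int_rVS2 B3); apply: (bsint_le (measurable_cube n M) (lebesgue_cube_fin n M)).
  - apply: (bounded_suppX 1); exact: (bounded_supp_slice c1_bounded _).
  - exact: bounded_supp_int_line B3.
  - move=> x; apply: (@line_sup _ M (fun t => phi (rV_cons (t, x)))
      (fun t => g ord0 (rV_cons (t, x)))).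
    + exact: c1_line_derive.
    + exact: c1_line_continuous.
    + exact: (bounded_supp_line c1_bounded x).
    + exact: (bounded_supp_line (c1_grad_bounded ord0) x).
rewrite (bsintZ (measurable_cube n.+1 M) (lebesgue_cube_fin n.+1 M))//.
rewrite -mulrA ler_pM2l// -sqrtrM; last by apply: bsint_ge0 => x; exact: sqr_ge0.
rewrite -[leLHS]ger0_norm; last by apply: bsint_ge0.
rewrite -sqrtr_sqr ler_wsqrtr//.
have := bsint_cauchy_schwarz (measurable_cube n.+1 M) (lebesgue_cube_fin n.+1 M)
  (bounded_supp_norm c1_bounded) (bounded_supp_norm (c1_grad_bounded ord0)).
under eq_Rintegral do rewrite -normrM.
by under [X in _ <= X * _]eq_Rintegral do rewrite real_normK ?num_real//;
  under [X in _ <= _ * X]eq_Rintegral do rewrite real_normK ?num_real//.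
Qed.

Lemma c1_poincare : 0 <= M -> J n.+1 (fun x => phi x ^+ 2) <=
  2 * M * (2 * M + 1) * J n.+1 (fun x => g ord0 x ^+ 2).
Proof.
move=> M0; have Bp2 := bounded_suppX 1 c1_bounded.
rewrite (int_rVS1 Bp2); set G := J n.+1 (fun x => g ord0 x ^+ 2).
have G0 : 0 <= G by apply: bsint_ge0 => x; exact: sqr_ge0.
have BS : bsupp1 M (\1_(seg M)) by apply: bounded_supp_indic => //; exact: measurable_seg.
apply: (@le_trans _ _ (\int[leb]_t ((2 * M + 1) * G * \1_(seg M) t))).
  apply: (bsint_le (measurable_seg M) (lebesgue_segment_fin M)).
  - exact: bounded_supp_int_slice Bp2.
  - exact: bounded_suppZ.
  - move=> t; have [mt|mt] := pselect (seg M t); last first.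
      rewrite (bounded_supp_out (bounded_supp_int_slice Bp2) mt).
      by rewrite indicE memNset// mulr0.
    rewrite indicE mem_set// mulr1.
    (* The slice at - M - 1 lies outside the cube, hence vanishes. *)
    have := c1_slice_holder (- M - 1) t.
    have -> : (fun x : 'rV[R]_n => (phi (rV_cons (t, x)) - phi (rV_cons (- M - 1, x))) ^+ 2) =
              (fun x => phi (rV_cons (t, x)) ^+ 2).
      apply/funext => x; rewrite [phi (rV_cons (- M - 1, x))](bounded_supp_out c1_bounded) ?subr0//.
      move=> /(_ ord0); rewrite rV_cons0 /seg/= in_itv/= => /andP[? _]; lra.
    move/le_trans; apply; rewrite ler_wpM2r//.
    by move: mt; rewrite /seg/= in_itv/= => /andP[? ?]; rewrite ger0_norm; lra.
rewrite (bsintZ (measurable_seg M) (lebesgue_segment_fin M))//.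
have := @bsint_indic R _ (measurableTypeR R) leb (cst 1) (seg M) (measurable_seg M).
under [in RHS]eq_Rintegral do rewrite mul1r.
rewrite Rintegral_cst ?mul1r; last exact: measurable_seg.
rewrite /= /seg lebesgue_measure_itv/= lte_fin => <-.
rewrite le_eqVlt; apply/predU1l.
case: ltP => MM /=; first ring.
have -> : M = 0 by lra.
by rewrite !mulr0 !mul0r.
Qed.

End slices.

End c1_cube.

Section ladyzhenskaya.
Context {R : realType}.
Local Notation leb := (@lebesgue_measure R).
Local Notation J n f := (\int[lebesgue_rV n]_x f x).
Local Notation bsupp1 M := (@bounded_supp R _ (measurableTypeR R) (seg M)).

Definition sqr_mass n (phi : 'rV[R]_n -> R) : R := J n (fun x => phi x ^+ 2).
Definition dirichlet n (g : 'I_n -> 'rV[R]_n -> R) : R :=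
  \sum_i J n (fun x => g i x ^+ 2).

Lemma sqr_mass_ge0 n (phi : 'rV[R]_n -> R) : 0 <= sqr_mass phi.
Proof. by apply: bsint_ge0 => x; exact: sqr_ge0. Qed.

Lemma dirichlet_ge0 n (g : 'I_n -> 'rV[R]_n -> R) : 0 <= dirichlet g.
Proof. by apply: sumr_ge0 => i _; apply: bsint_ge0 => x; exact: sqr_ge0. Qed.

Lemma integral_rV0 (f : 'rV[R]_0 -> R) : continuous f -> J 0 f = f 0.
Proof.
move=> cf; rewrite /Rintegral [X in fine X](_ : _ = (f 0)%:E)//.
rewrite (@integral_dirac _ _ (0 : 'rV[R]_0) _ _ measurableT); last first.
  by apply/measurable_EFinP; exact: continuous_measurable_rV.
by rewrite diracT mul1e.
Qed.

Section slicing.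
Variables (n : nat) (M : R) (phi : 'rV[R]_n.+1 -> R) (g : 'I_n.+1 -> 'rV[R]_n.+1 -> R).
Hypothesis phig : c1_cube M phi g.

Let mass_t t := sqr_mass (fun x => phi (rV_cons (t, x))).
Let dir_t t := dirichlet (fun i x => g (lift ord0 i) (rV_cons (t, x))).

Let Bphi2 := bounded_suppX 1 (c1_bounded phig).
Let Bg2 i := bounded_suppX 1 (c1_grad_bounded phig i).

Lemma bounded_supp_mass_t : bsupp1 M mass_t.
Proof. exact: bounded_supp_int_slice Bphi2. Qed.

Lemma bounded_supp_dir_t : bsupp1 M dir_t.
Proof. by apply: bounded_supp_sum => i; exact: bounded_supp_int_slice (Bg2 _). Qed.

Lemma int_mass_t : \int[leb]_t mass_t t = sqr_mass phi.
Proof. by rewrite /sqr_mass (int_rVS1 Bphi2). Qed.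

Lemma dirichletS : dirichlet g = J n.+1 (fun x => g ord0 x ^+ 2) + \int[leb]_t dir_t t.
Proof.
rewrite /dirichlet big_ord_recl; congr (_ + _).
rewrite (bsint_sum (measurable_seg M) (lebesgue_segment_fin M)).
  by apply: eq_bigr => i _; rewrite (int_rVS1 (Bg2 _)).
by move=> i; exact: bounded_supp_int_slice (Bg2 _).
Qed.

Lemma int_dir_t_le : \int[leb]_t dir_t t <= dirichlet g.
Proof. by rewrite dirichletS lerDr; apply: bsint_ge0 => x; exact: sqr_ge0. Qed.

Lemma first_partial_le : J n.+1 (fun x => g ord0 x ^+ 2) <= dirichlet g.
Proof. by rewrite dirichletS lerDl; apply: bsint_ge0 => t; exact: dirichlet_ge0. Qed.

(** One step of Ladyzhenskaya's argument: a bound on the slices which is linear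
    in their mass can be integrated, since the mass of a slice is bounded
    uniformly. *)
Lemma quartic_step (c : R) (p : R -> R) : 0 <= c -> bsupp1 M p -> (forall t, 0 <= p t) ->
  (forall t, J n (fun x => phi (rV_cons (t, x)) ^+ 4) <= c * mass_t t * p t) ->
  J n.+1 (fun x => phi x ^+ 4) <=
  c * (2 * Num.sqrt (sqr_mass phi) * Num.sqrt (dirichlet g)) * \int[leb]_t p t.
Proof.
move=> c0 Bp p0 H; have B4 := bounded_suppX 3 (c1_bounded phig).
rewrite (int_rVS1 B4) -(bsintZ (measurable_seg M) (lebesgue_segment_fin M))//.
apply: (bsint_le (measurable_seg M) (lebesgue_segment_fin M)).
- exact: bounded_supp_int_slice B4.
- exact: bounded_suppZ.
- move=> t; apply: le_trans (H t) _; rewrite ler_wpM2r// ler_wpM2l//.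
  apply: le_trans (c1_slice_sup phig t) _.
  by rewrite ler_wpM2l ?mulr_ge0 ?sqrtr_ge0// ler_wsqrtr// first_partial_le.
Qed.

End slicing.

Local Notation a phi := (Num.sqrt (sqr_mass phi)).
Local Notation b g := (Num.sqrt (dirichlet g)).

(** In dimension 1 the slices are points, for which the fourth power is the square
    of the mass; each further dimension trades a factor [a phi] for [b g]. *)
Lemma quartic1 M (phi : 'rV[R]_1 -> R) g : c1_cube M phi g ->
  J 1 (fun x => phi x ^+ 4) <= 2 * a phi ^+ 3 * b g.
Proof.
move=> phig; have := @quartic_step 0 M phi g phig 1 _ ler01 (bounded_supp_mass_t phig).
rewrite (int_mass_t phig)// -[X in _ * X](sqr_sqrtr (sqr_mass_ge0 phi)) => H.
apply: le_trans (H _ _) _; first by move=> t; exact: sqr_mass_ge0.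
  move=> t; have ct k : continuous (fun x => phi (rV_cons (t, x)) ^+ k).
    move=> x; apply: (@continuous_comp _ _ _ (fun x => phi (rV_cons (t, x))) (fun y : R => y ^+ k) x).
      exact: c1_cont (c1_slice phig t) _.
    exact: exprn_continuous.
  by rewrite mul1r -expr2 /sqr_mass !integral_rV0 -?exprM.
by rewrite le_eqVlt; apply/predU1l; ring.
Qed.

Lemma bounded_supp_sqrt M (p : R -> R) : bsupp1 M p -> bsupp1 M (fun t => Num.sqrt (p t)).
Proof.
move=> [mp [K pK] p0]; split.
- have ms : measurable_fun setT (@Num.sqrt R).
    by apply: continuous_measurable_fun; exact: sqrt_continuous.
  exact: (measurableT_comp ms mp).
- by exists (Num.sqrt K) => t; rewrite ger0_norm ?sqrtr_ge0// ler_wsqrtr// (le_trans (ler_norm _)).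
- by move=> t /p0 ->; rewrite sqrtr0.
Qed.

Lemma quartic2 M (phi : 'rV[R]_2 -> R) g : c1_cube M phi g ->
  J 2 (fun x => phi x ^+ 4) <= 4 * a phi ^+ 2 * b g ^+ 2.
Proof.
move=> phig; have Bm := bounded_supp_sqrt (bounded_supp_mass_t phig).
have Bd := bounded_supp_sqrt (bounded_supp_dir_t phig).
have := quartic_step phig (ler0n R 2) (bounded_suppMM Bm Bd) _ _ => H.
apply: le_trans (H _ _) _.
- by move=> t; rewrite mulr_ge0 ?sqrtr_ge0.
- move=> t; apply: le_trans (quartic1 (c1_slice phig t)) _.
  rewrite exprS sqr_sqrtr ?sqr_mass_ge0// le_eqVlt; apply/predU1l.
  by move: (sqr_mass _) (Num.sqrt _) (Num.sqrt _) => ? ? ?; ring.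
set K := \int[leb]_t _.
have KK : K <= a phi * b g.
  rewrite -[leLHS]ger0_norm; last by apply: bsint_ge0 => t; rewrite mulr_ge0 ?sqrtr_ge0.
  rewrite -sqrtrM ?sqr_mass_ge0// -sqrtr_sqr ler_wsqrtr//.
  apply: le_trans (bsint_cauchy_schwarz (measurable_seg M) (lebesgue_segment_fin M) Bm Bd) _.
  apply: ler_pM; try by apply: bsint_ge0 => t; exact: sqr_ge0.
    under eq_Rintegral do rewrite sqr_sqrtr ?sqr_mass_ge0//.
    by rewrite (int_mass_t phig).
  under eq_Rintegral do rewrite sqr_sqrtr ?dirichlet_ge0//.
  exact: (int_dir_t_le phig).
have := ler_wpM2l (_ : 0 <= 2 * (2 * a phi * b g)) KK; rewrite !mulr_ge0 ?sqrtr_ge0//.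
move=> /(_ isT)/le_trans; apply.
by rewrite le_eqVlt; apply/predU1l; ring.
Qed.

Lemma quartic3 M (phi : 'rV[R]_3 -> R) g : c1_cube M phi g ->
  J 3 (fun x => phi x ^+ 4) <= 8 * a phi * b g ^+ 3.
Proof.
move=> phig.
have := quartic_step phig (ler0n R 4) (bounded_supp_dir_t phig) _ _ => H.
apply: le_trans (H _ _) _.
- by move=> t; exact: dirichlet_ge0.
- move=> t; apply: le_trans (quartic2 (c1_slice phig t)) _.
  by rewrite !sqr_sqrtr ?sqr_mass_ge0 ?dirichlet_ge0.
have := ler_wpM2l (_ : 0 <= 4 * (2 * a phi * b g)) (int_dir_t_le phig).
rewrite !mulr_ge0 ?sqrtr_ge0// => /(_ isT)/le_trans; apply.
rewrite -[X in _ * X](sqr_sqrtr (dirichlet_ge0 g)) le_eqVlt; apply/predU1l.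
ring.
Qed.

Lemma c1_poincare_norm n M (phi : 'rV[R]_n.+1 -> R) g : 0 <= M -> c1_cube M phi g ->
  a phi <= Num.sqrt (2 * M * (2 * M + 1)) * b g.
Proof.
move=> M0 phig; rewrite -sqrtrM; last by apply: mulr_ge0; lra.
rewrite ler_wsqrtr// (le_trans (c1_poincare phig M0))// ler_wpM2l ?(first_partial_le phig)//.
by apply: mulr_ge0; lra.
Qed.

Lemma poincare_bound d M : (0 < d)%N -> 0 <= M ->
  exists2 P, 0 <= P & forall (phi : 'rV[R]_d -> R) g, c1_cube M phi g ->
    a phi <= P * b g.
Proof.
case: d => // n _ M0; exists (Num.sqrt (2 * M * (2 * M + 1))); first exact: sqrtr_ge0.
by move=> phi g; exact: c1_poincare_norm.
Qed.

(** The Poincare inequality turns the surplus factors [a phi] of the lower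
    dimensions into [b g], which gives one form of the bound for all of them. *)
Lemma quartic_bound d M : (1 <= d <= 3)%N -> 0 <= M ->
  exists2 C, 0 <= C & forall (phi : 'rV[R]_d -> R) g, c1_cube M phi g ->
    J d (fun x => phi x ^+ 4) <= C * a phi * b g ^+ 3.
Proof.
move=> d13 M0; set P := Num.sqrt (2 * M * (2 * M + 1)).
have P0 : 0 <= P by exact: sqrtr_ge0.
case: d d13 => [|[|[|[|d]]]]// _.
- exists (2 * P ^+ 2); first by rewrite mulr_ge0 ?sqr_ge0.
  move=> phi g phig; apply: le_trans (quartic1 phig) _.
  have := c1_poincare_norm M0 phig; rewrite -/P.
  have := sqrtr_ge0 (sqr_mass phi); have := sqrtr_ge0 (dirichlet g).
  move: (Num.sqrt _) (Num.sqrt _) => x y y0 x0 xy.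
  have : x ^+ 2 <= (P * y) ^+ 2 by rewrite ler_pXn2r ?nnegrE ?mulr_ge0.
  move=> /(ler_wpM2l (mulr_ge0 (mulr_ge0 (ler0n R 2) x0) y0)) H.
  by apply: le_trans (le_trans H _); rewrite le_eqVlt; apply/predU1l; ring.
- exists (4 * P); first by rewrite mulr_ge0.
  move=> phi g phig; apply: le_trans (quartic2 phig) _.
  have := c1_poincare_norm M0 phig; rewrite -/P.
  have := sqrtr_ge0 (sqr_mass phi); have := sqrtr_ge0 (dirichlet g).
  move: (Num.sqrt _) (Num.sqrt _) => x y y0 x0 xy.
  have H := ler_wpM2l (mulr_ge0 (mulr_ge0 (ler0n R 4) x0) (sqr_ge0 y)) xy.
  by apply: le_trans (le_trans H _); rewrite le_eqVlt; apply/predU1l; ring.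
- exists 8 => // phi g phig; exact: (quartic3 phig).
Qed.

End ladyzhenskaya.

Section rellich.
Context {R : realType}.
Local Notation leb := (@lebesgue_measure R).
Local Notation J n f := (\int[lebesgue_rV n]_x f x).
Local Notation bsupp1 M := (@bounded_supp R _ (measurableTypeR R) (seg M)).

Definition rV_tail n (y : 'rV[R]_n.+1) : 'rV[R]_n := \row_i y ord0 (lift ord0 i).

Lemma rV_tail_cons n t (x : 'rV[R]_n) : rV_tail (rV_cons (t, x)) = x.
Proof. by apply/rowP => i; rewrite mxE rV_consS. Qed.

Lemma bounded_supp_tensor n M (v : R -> R) (w : 'rV[R]_n -> R) :
  bsupp1 M v -> bounded_supp (cube n M) w ->
  bounded_supp (cube n.+1 M) (fun y => v (y ord0 ord0) * w (rV_tail y)).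
Proof.
move=> [mv [K vK] v0] [mw [L wL] w0]; split.
- apply: measurable_funM.
    exact: (measurableT_comp mv (measurable_row_coord (ord0 : 'I_n.+1))).
  apply: (measurableT_comp mw); apply: measurable_row_funP => i.
  by under eq_fun do rewrite mxE; exact: measurable_row_coord.
- by exists (K * L) => y; rewrite normrM ler_pM.
- move=> y yM; have [y0|/v0->] := pselect (seg M (y ord0 ord0)); last by rewrite mul0r.
  rewrite w0 ?mulr0// => yt; apply: yM => i.
  by case: (unliftP ord0 i) => [j|] ->//; have := yt j; rewrite mxE.
Qed.

Lemma c1_slice_integral_holder n M (phi : 'rV[R]_n.+1 -> R) g (w : 'rV[R]_n -> R) s t :
  c1_cube M phi g -> bounded_supp (cube n M) w ->
  (J n (fun x => phi (rV_cons (t, x)) * w x) - J n (fun x => phi (rV_cons (s, x)) * w x)) ^+ 2 <=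
  `|t - s| * (sqr_mass w * dirichlet g).
Proof.
move=> phig Bw.
have Bs u := bounded_supp_slice (c1_bounded phig) u.
rewrite -(bsintB (measurable_cube n M) (lebesgue_cube_fin n M)); [|exact: bounded_suppMM..].
under eq_Rintegral do rewrite -mulrBl.
have Bd := bounded_suppB (Bs t) (Bs s).
apply: le_trans (bsint_cauchy_schwarz (measurable_cube n M) (lebesgue_cube_fin n M) Bd Bw) _.
rewrite mulrA mulrAC ler_wpM2r ?sqr_mass_ge0//.
apply: le_trans (c1_slice_holder phig s t) _.
by rewrite ler_wpM2l// (first_partial_le phig).
Qed.

(** The Rellich theorem in quantitative form: up to an arbitrarily small
    multiple of the Dirichlet energy, the L2 norm is controlled by finitely many
    integrals against fixed functions.  By induction on the dimension: the
    induction hypothesis on the slices leaves the integrals of the slices against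
    the functions w i.  As functions of the slicing coordinate these are Hoelder
    continuous of exponent 1/2, hence given up to a small error by their means
    over a fine mesh. *)
Lemma finite_rank_approx n (M e : R) : 0 <= M -> 0 < e ->
  exists (I : finType) (w : I -> 'rV[R]_n -> R),
    (forall i, bounded_supp (cube n M) (w i)) /\
    forall phi g, c1_cube M phi g ->
      sqr_mass phi <= \sum_i (J n (fun x => phi x * w i x)) ^+ 2 + e * dirichlet g.
Proof.
move=> M0; elim: n e => [|n IH] e e0.
  exists unit, (fun=> cst 1); split=> [_|phi g phig].
    by split => //; [exists 1 => x; rewrite normr1|move=> x []; case].
  rewrite big_const card_unit/= addr0 /sqr_mass.
  have ct k : continuous (fun x => phi x ^+ k).
    move=> x; apply: (@continuous_comp _ _ _ phi (fun y : R => y ^+ k) x).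
      exact: c1_cont phig _.
    exact: exprn_continuous.
  rewrite integral_rV0//; under eq_Rintegral do rewrite mulr1.
  by rewrite (integral_rV0 (c1_cont phig)) lerDl mulr_ge0 ?dirichlet_ge0 ?ltW.
have e20 : 0 < e / 2 by rewrite divr_gt0.
have [I [w [Bw wP]]] := IH _ e20.
(* The Hoelder constants of all these functions add up to at most W * dirichlet g. *)
pose W := \sum_i sqr_mass (w i) + 1.
have W0 : 0 < W by rewrite ltr_wpDl// sumr_ge0// => i _; exact: sqr_mass_ge0.
have [L [v [Bv vP]]] := mesh_approx M0 (divr_gt0 e20 W0).
exists (I * 'I_L)%type, (fun il (y : 'rV[R]_n.+1) => v il.2 (y ord0 ord0) * w il.1 (rV_tail y)).
split=> [[i l]|phi g phig]; first exact: bounded_supp_tensor.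
pose a i t := J n (fun x => phi (rV_cons (t, x)) * w i x).
have Bphi := c1_bounded phig.
have BT i : bounded_supp (cube n.+1 M) (fun y => phi y * (\1_(seg M) (y ord0 ord0) * w i (rV_tail y))).
  apply: bounded_suppMM => //; apply: bounded_supp_tensor => //.
  by apply: bounded_supp_indic => //; exact: measurable_seg.
have Ba i : bsupp1 M (a i).
  have := bounded_supp_int_slice (BT i); congr bounded_supp; apply/funext => t.
  apply: eq_Rintegral => x _; rewrite rV_cons0 rV_tail_cons indicE.
  have [mt|mt] := pselect (seg M t); first by rewrite mem_set// mul1r.
  by rewrite (bounded_supp_out Bphi) ?mul0r// => /(_ ord0); rewrite rV_cons0.
have Da := dirichlet_ge0 g.
rewrite -(int_mass_t phig).
apply: (@le_trans _ _ (\int[leb]_t (\sum_i a i t ^+ 2 +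
    e / 2 * dirichlet (fun i x => g (lift ord0 i) (rV_cons (t, x)))))).
  apply: (bsint_le (measurable_seg M) (lebesgue_segment_fin M)).
  - exact: bounded_supp_mass_t phig.
  - apply: bounded_suppD.
      by apply: bounded_supp_sum => i; exact: (bounded_suppX 1).
    by apply: bounded_suppZ; exact: bounded_supp_dir_t phig.
  - by move=> t; exact: wP (c1_slice phig t).
rewrite (bsintD (measurable_seg M) (lebesgue_segment_fin M)); last 2 first.
- by apply: bounded_supp_sum => i; exact: (bounded_suppX 1).
- by apply: bounded_suppZ; exact: bounded_supp_dir_t phig.
rewrite (bsintZ (measurable_seg M) (lebesgue_segment_fin M)); last first.
  exact: bounded_supp_dir_t phig.
rewrite (bsint_sum (measurable_seg M) (lebesgue_segment_fin M)); last first.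
  by move=> i; exact: (bounded_suppX 1).
have step i : \int[leb]_t (a i t ^+ 2) <=
    \sum_l (\int[leb]_t (a i t * v l t)) ^+ 2 + e / 2 / W * (sqr_mass (w i) * dirichlet g).
  apply: vP => // [|s t]; first by rewrite mulr_ge0 ?sqr_mass_ge0.
  exact: (c1_slice_integral_holder s t phig (Bw i)).
apply: (@le_trans _ _ (\sum_i (\sum_l (\int[leb]_t (a i t * v l t)) ^+ 2 +
   e / 2 / W * (sqr_mass (w i) * dirichlet g)) + e / 2 * dirichlet g)).
  apply: lerD; first by apply: ler_sum => i _; exact: step.
  by rewrite ler_wpM2l ?(ltW e20)// (int_dir_t_le phig).
rewrite big_split/= -addrA; apply: lerD.
  rewrite pair_big/= le_eqVlt; apply/predU1l; apply: eq_bigr => -[i l] _ /=.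
  congr (_ ^+ 2); rewrite (@int_rVS1 _ n M); last first.
    by apply: bounded_suppMM => //; exact: bounded_supp_tensor.
  apply: eq_Rintegral => t _.
  rewrite mulrC -(bsintZ (measurable_cube n M) (lebesgue_cube_fin n M)).
    by apply: eq_Rintegral => x _; rewrite rV_cons0 rV_tail_cons; ring.
  by apply: bounded_suppMM => //; exact: (bounded_supp_slice Bphi t).
rewrite -mulr_sumr -mulr_suml.
have : \sum_i sqr_mass (w i) <= W by rewrite lerDl.
move=> /(ler_wpM2r Da)/(ler_wpM2l (ltW (divr_gt0 e20 W0))).
have -> : e / 2 / W * (W * dirichlet g) = e / 2 * dirichlet g by field; rewrite gt_eqF.
by move=> H; move: (e / 2 / W * _) H => y H; lra.
Qed.

End rellich.

(** * Test functions *)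

Section test_functions.
Context {R : realType} {d : nat}.
Implicit Types (Omega : set 'rV[R]_d) (phi psi f : 'rV[R]_d -> R) (M : R).

Lemma bounded_subset_cube Omega : bounded_set Omega ->
  exists2 M : R, 0 <= M & Omega `<=` cube d M.
Proof.
case=> K [_ HK]; exists (`|K| + 1); first by rewrite addr_ge0.
move=> x Ox i; have := HK (`|K| + 1); rewrite (le_lt_trans (ler_norm _)) ?ltrDl//.
move=> /(_ isT _ Ox) xK; rewrite /seg/= in_itv/= -ler_norml (le_trans _ xK)//.
rewrite [leRHS](mx_normrE x).
exact: (@Order.TotalTheory.le_bigmax _ _ _ 0 (fun ij : 'I_1 * 'I_d => `|x ij.1 ij.2|) (ord0, i)).
Qed.

Lemma support_ofP phi x : ~ support_of phi x -> \forall y \near x, phi y = 0.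
Proof.
move=> sx; have : nbhs x (~` support_of phi).
  by apply: open_nbhs_nbhs; split => //; exact/closed_openC/closed_closure.
apply: filterS => y sy; apply/eqP; apply: contrapT => /negP py.
by apply: sy; exact: subset_closure.
Qed.

Lemma support_of_out phi x : ~ support_of phi x -> phi x = 0.
Proof. by move/support_ofP/nbhs_singleton. Qed.

Lemma partial_out i phi x : ~ support_of phi x -> partial i phi x = 0.
Proof.
move/support_ofP => p0; rewrite /partial (@near_eq_derive _ _ _ _ (cst 0))//.
exact: derive_cst.
Qed.

Lemma support_of_partial i phi : support_of (partial i phi) `<=` support_of phi.
Proof.
have -> : support_of phi = closure (support_of phi).
  by apply/closure_id; exact: closed_closure.
apply: closureS => x /= /eqP px; apply: contrapT => sx; exact/px/partial_out.
Qed.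

Lemma smooth_partial i phi : smooth phi -> smooth (partial i phi).
Proof. by move=> sphi s x; have := sphi (rcons s i) x; rewrite foldr_rcons. Qed.

Lemma test_function_partial Omega i phi :
  test_function Omega phi -> test_function Omega (partial i phi).
Proof.
move=> [sphi cphi Ophi]; split; first exact: smooth_partial.
  by apply: subclosed_compact cphi (@support_of_partial i phi); exact: closed_closure.
exact: subset_trans (@support_of_partial i phi) Ophi.
Qed.

Lemma smooth_lin a phi psi : smooth phi -> smooth psi -> smooth (a *: phi + psi).
Proof.
move=> sphi spsi s.
have E : foldr partial (a *: phi + psi) s = a *: foldr partial phi s + foldr partial psi s.
  elim: s => //= i s ->; apply/funext => x; rewrite /partial.
  have dphi := diff_derivable (v := delta_mx ord0 i) (sphi s x).
  have dpsi := diff_derivable (v := delta_mx ord0 i) (spsi s x).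
  by rewrite deriveD ?deriveZ//; exact: derivableZ.
by move=> x; rewrite E; apply: differentiableD => //; exact: differentiableZ.
Qed.

Lemma test_function_lin Omega a phi psi : test_function Omega phi ->
  test_function Omega psi -> test_function Omega (a *: phi + psi).
Proof.
move=> [sphi cphi Ophi] [spsi cpsi Opsi].
have sub : support_of (a *: phi + psi) `<=` support_of phi `|` support_of psi.
  rewrite -closureU; apply: closureS => x /= /eqP px.
  have [p0|] := eqVneq (phi x) 0; last by left.
  right; apply/eqP => q0; apply: px.
  by rewrite (_ : (_ + _) x = a * phi x + psi x)// p0 q0 mulr0 addr0.
split; first exact: smooth_lin.
  by apply: subclosed_compact (compactU cphi cpsi) sub; exact: closed_closure.
by move=> x /sub[/Ophi|/Opsi].
Qed.

Lemma partial_lin i a phi psi : smooth phi -> smooth psi ->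
  partial i (a *: phi + psi) = a *: partial i phi + partial i psi.
Proof.
move=> sphi spsi; apply/funext => x; rewrite /partial.
have dphi := diff_derivable (v := delta_mx ord0 i) (sphi [::] x).
have dpsi := diff_derivable (v := delta_mx ord0 i) (spsi [::] x).
by rewrite deriveD ?deriveZ//; exact: derivableZ.
Qed.

Lemma test_function_c1 Omega M phi : Omega `<=` cube d M -> test_function Omega phi ->
  c1_cube M phi (fun i => partial i phi).
Proof.
move=> OM [sphi _ Ophi].
have out x : ~ cube d M x -> ~ support_of phi x by move=> Mx /Ophi/OM.
split.
- move=> x; exact: differentiable_continuous (sphi [::] x).
- move=> i x; exact: differentiable_continuous (sphi [:: i] x).
- by move=> x /out; exact: support_of_out.
- by move=> i x /out; exact: partial_out.
- by move=> i x; apply: DeriveDef; [exact: diff_derivable (sphi [::] x)|].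
Qed.

Lemma test_function_out Omega phi x : test_function Omega phi -> ~ Omega x -> phi x = 0.
Proof. by move=> [_ _ Ophi] Ox; apply: support_of_out => /Ophi. Qed.

End test_functions.

(** * The space H_0^1 *)

Section H10.
Context {R : realType} {d : nat}.
Variables (Omega : set 'rV[R]_d) (M : R).
Hypotheses (oO : open Omega) (M0 : 0 <= M) (OM : Omega `<=` cube d M).
Implicit Types (u v w z phi : 'rV[R]_d -> R) (g : 'I_d -> 'rV[R]_d -> R).

Local Notation leb := (lebesgue_rV d : {measure set 'rV[R]_d -> \bar R}).
Local Notation L2n := (si_norm (L2_inner Omega)).
Local Notation H1n := (si_norm (H10_inner Omega)).

Let mO : measurable Omega. Proof. exact: open_measurable_rV. Qed.

Let O_fin : (leb Omega < +oo)%E.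
Proof.
apply: le_lt_trans (lebesgue_cube_fin d M).
by apply: le_measure => //; rewrite inE//; exact: measurable_cube.
Qed.

Lemma L2_semi_inner : semi_inner (L2 Omega) (L2_inner Omega).
Proof. exact: (l2_semi_inner leb mO). Qed.

Local Notation SI := L2_semi_inner.

Lemma bounded_supp_L2 f : bounded_supp (cube d M) f -> L2 Omega f.
Proof.
move=> Bf.
have [mf f2] := bounded_supp_sq_integrable (measurable_cube d M) (lebesgue_cube_fin d M) Bf.
by split; [exact: measurable_funTS|apply: integrableS f2].
Qed.

Lemma test_c1 phi : test_function Omega phi -> c1_cube M phi (fun i => partial i phi).
Proof. exact: test_function_c1 OM. Qed.

Lemma test_bounded phi : test_function Omega phi -> bounded_supp (cube d M) phi.
Proof.
by move=> /test_c1 c; exact: continuous_bounded_supp (c1_cont c) (c1_supp c).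
Qed.

Lemma test_L2 phi : test_function Omega phi -> L2 Omega phi.
Proof. by move/test_bounded/bounded_supp_L2. Qed.

Lemma int_test f : (forall x, ~ Omega x -> f x = 0) ->
  \int[leb]_(x in Omega) f x = \int[leb]_x f x.
Proof.
move=> f0; rewrite Rintegral_mkcond; apply: eq_Rintegral => x _.
by rewrite patchE; case: ifPn => // xO; rewrite f0// => /mem_set; exact/negP.
Qed.

Lemma L2_inner_test phi w : test_function Omega phi ->
  L2_inner Omega phi w = \int[leb]_x (phi x * w x).
Proof.
move=> tphi; apply: int_test => x Ox.
by rewrite (test_function_out tphi Ox) mul0r.
Qed.

Lemma sqr_mass_test phi : test_function Omega phi ->
  sqr_mass phi = L2_inner Omega phi phi.
Proof. by move=> tphi; rewrite L2_inner_test//; apply: eq_Rintegral => x _; rewrite expr2. Qed.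

Lemma dirichlet_test phi : test_function Omega phi ->
  dirichlet (fun i => partial i phi) =
  \sum_(i < d) L2_inner Omega (partial i phi) (partial i phi).
Proof.
by move=> tphi; apply: eq_bigr => i _; rewrite -sqr_mass_test//; exact: test_function_partial.
Qed.

Lemma grad_approx u g : H10_with_gradient Omega u g ->
  exists phi_ : nat -> 'rV[R]_d -> R,
    [/\ forall n, test_function Omega (phi_ n),
        L2n (phi_ n - u) @[n --> \oo] --> 0 &
        forall i, L2n (partial i (phi_ n) - g i) @[n --> \oo] --> 0].
Proof.
move=> [u2 g2 _ dense].
have /choice[phi_ Hphi] : forall n : nat, exists phi, test_function Omega phi /\
    L2_norm Omega (u \- phi) ^+ 2 +
    \sum_(i < d) L2_norm Omega (g i \- partial i phi) ^+ 2 < n.+1%:R^-1.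
  move=> n; have /dense[phi tphi H] : 0 < (n.+1%:R^-1 : R) by rewrite invr_gt0 ltr0n.
  by exists phi.
have tphi n := (Hphi n).1.
have tpphi n i : test_function Omega (partial i (phi_ n)) by exact: test_function_partial.
have c0 := @cvgr_sqrt_harmonic R.
have sum0 n : 0 <= \sum_(i < d) L2_norm Omega (g i \- partial i (phi_ n)) ^+ 2.
  by apply: sumr_ge0 => i _; exact: sqr_ge0.
exists phi_; split=> // [|i]; apply: cvg_ler_norm0 c0 => n.
- rewrite ger0_norm ?si_norm_ge0// (si_norm_distC SI)//; last exact: test_L2.
  rewrite -[leLHS]ger0_norm ?si_norm_ge0// -sqrtr_sqr ler_wsqrtr//.
  by apply: ltW; apply: le_lt_trans (Hphi n).2; rewrite lerDl.
- rewrite ger0_norm ?si_norm_ge0// (si_norm_distC SI)//; last exact: test_L2.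
  rewrite -[leLHS]ger0_norm ?si_norm_ge0// -sqrtr_sqr ler_wsqrtr//.
  apply: ltW; apply: le_lt_trans (Hphi n).2.
  rewrite (bigD1 i)//= addrCA lerDl addr_ge0 ?sqr_ge0//.
  by apply: sumr_ge0 => j _; exact: sqr_ge0.
Qed.

(** Two weak gradients differ by a function that is orthogonal to all test
    functions; being also a limit of test functions, it vanishes. *)
Lemma weak_gradient_unique u g g' : H10_with_gradient Omega u g ->
  H10_with_gradient Omega u g' -> forall i, L2n (g i - g' i) = 0.
Proof.
move=> ug ug' i; have [_ g2 wg _] := ug; have [_ g2' wg' _] := ug'.
have [phi_ [tphi _ cphi]] := grad_approx ug.
have [psi_ [tpsi _ cpsi]] := grad_approx ug'.
have tp n : test_function Omega (partial i (phi_ n)) by exact: test_function_partial.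
have tq n : test_function Omega (partial i (psi_ n)) by exact: test_function_partial.
have gg : L2 Omega (g i - g' i) by exact: (si_B SI).
have orth phi : test_function Omega phi -> L2_inner Omega (g i - g' i) phi = 0.
  move=> tph; have := wg i phi tph; rewrite wg'// => /oppr_inj e.
  by rewrite (si_BBl SI)//; [rewrite e subrr|exact: test_L2].
have lim0 (p_ : nat -> 'rV[R]_d -> R) p : (forall n, test_function Omega (p_ n)) ->
    L2 Omega p -> L2n (p_ n - p) @[n --> \oo] --> 0 -> L2_inner Omega p (g i - g' i) = 0.
  move=> tp_ p2 cp; have c := si_cvg_l SI (fun n => test_L2 (tp_ n)) p2 gg cp.
  have E : (fun n => L2_inner Omega (p_ n) (g i - g' i)) = cst 0.
    by apply/funext => n; rewrite (si_sym SI (test_L2 (tp_ n)) gg) orth.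
  have c0 : (fun n => L2_inner Omega (p_ n) (g i - g' i)) @ \oo --> (0 : R).
    by rewrite E; exact: cvg_cst.
  exact: cvg_unique c c0.
have z1 := lim0 _ _ tp (g2 i) (cphi i).
have z2 := lim0 _ _ tq (g2' i) (cpsi i).
by rewrite /si_norm (si_BBl SI)// z1 z2 subrr sqrtr0.
Qed.

Lemma grad_spec u : H10 Omega u -> H10_with_gradient Omega u (grad Omega u).
Proof. by move=> [g ug]; exact: (xgetPex (fun=> cst 0) (ex_intro _ g ug)). Qed.

Lemma H10_L2 u : H10 Omega u -> L2 Omega u. Proof. by move=> /grad_spec[]. Qed.

Lemma grad_L2 u i : H10 Omega u -> L2 Omega (grad Omega u i).
Proof. by move=> /grad_spec[]. Qed.

Lemma H10_with_gradient_lin a u v g h : H10_with_gradient Omega u g ->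
  H10_with_gradient Omega v h ->
  H10_with_gradient Omega (a *: u + v) (fun i => a *: g i + h i).
Proof.
move=> ug vh; have [u2 g2 wg _] := ug; have [v2 h2 wh _] := vh.
have [phi_ [tphi cphi cphi']] := grad_approx ug.
have [psi_ [tpsi cpsi cpsi']] := grad_approx vh.
have tp n i : test_function Omega (partial i (phi_ n)) by exact: test_function_partial.
have tq n i : test_function Omega (partial i (psi_ n)) by exact: test_function_partial.
split.
- exact: (si_lin SI).
- by move=> i; exact: (si_lin SI).
- move=> i phi tph; rewrite !(si_linl SI)//; try exact: test_L2; last first.
    by apply: test_L2; exact: test_function_partial.
  by rewrite wg// wh// mulrN opprD.
- move=> e e0.
  pose t n := a *: phi_ n + psi_ n.
  have key (p_ q_ : nat -> 'rV[R]_d -> R) p q : (forall n, L2 Omega (p_ n)) ->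
      (forall n, L2 Omega (q_ n)) -> L2 Omega p -> L2 Omega q ->
      L2n (p_ n - p) @[n --> \oo] --> 0 -> L2n (q_ n - q) @[n --> \oo] --> 0 ->
      L2n ((a *: p + q) - (a *: p_ n + q_ n)) ^+ 2 @[n --> \oo] --> 0.
    move=> p2 q2 p2' q2' cp cq.
    have c : L2n ((a *: p + q) - (a *: p_ n + q_ n)) @[n --> \oo] --> 0.
      apply: (@cvg_ler_norm0 _ _ (fun n => `|a| * L2n (p_ n - p) + L2n (q_ n - q))).
        move=> n; rewrite ger0_norm ?si_norm_ge0//.
        have -> : a *: p + q - (a *: p_ n + q_ n) = - (a *: (p_ n - p) + (q_ n - q)).
          by rewrite scalerBr [in RHS]opprD !opprB opprD addrACA.
        have S1 : L2 Omega (p_ n - p) by exact: (si_B SI).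
        have S2 : L2 Omega (q_ n - q) by exact: (si_B SI).
        rewrite (si_normN SI); last exact: (si_lin SI).
        rewrite -(si_normZ SI)//; apply: (si_norm_triangle SI) => //; exact: (si_Z SI).
      rewrite -(addr0 0) -[X in _ --> X + _](mulr0 `|a|).
      by apply: cvgD => //; apply: cvgM => //; exact: cvg_cst.
    by rewrite -(mulr0 0); under eq_fun do rewrite expr2; exact: cvgM.
  have c0 : L2n ((a *: u + v) - t n) ^+ 2 +
     \sum_(i < d) L2n ((a *: g i + h i) - partial i (t n)) ^+ 2 @[n --> \oo] -->
     0 + \sum_(i < d) (0 : R).
    apply: cvgD; first by apply: key => // n; exact: test_L2.
    apply: (cvg_big (op := +%R)); first exact: add_continuous.
    move=> i _.
    have -> : (fun n => L2n (a *: g i + h i - partial i (t n)) ^+ 2) =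
      (fun n => L2n (a *: g i + h i - (a *: partial i (phi_ n) + partial i (psi_ n))) ^+ 2).
      by apply/funext => n; rewrite /t partial_lin//; [have [] := tphi n|have [] := tpsi n].
    by apply: key => // n; exact: test_L2.
  move: c0; rewrite big1// addr0 => /cvgr0_natE/(_ (divr_gt0 e0 (ltr0n R 2))).
  move=> [N /(_ N (leqnn N)) HN]; exists (t N); first exact: test_function_lin.
  apply: le_lt_trans (ler_norm _) _; apply: le_lt_trans HN _; lra.
Qed.

Lemma H10_lin a u v : H10 Omega u -> H10 Omega v -> H10 Omega (a *: u + v).
Proof. by move=> [g ug] [h vh]; eexists; exact: H10_with_gradient_lin ug vh. Qed.

Lemma test_function0 : test_function Omega (0 : 'rV[R]_d -> R).
Proof.
have s0 : support_of (0 : 'rV[R]_d -> R) = set0.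
  rewrite /support_of (_ : [set x | _] = set0) ?closure0//.
  by apply/seteqP; split => // x /=; rewrite eqxx.
split; last 2 first.
- by rewrite s0; exact: compact0.
- by rewrite s0; exact: sub0set.
move=> s; have -> : foldr partial (0 : 'rV[R]_d -> R) s = cst 0.
  by elim: s => //= i s ->; apply/funext => x; rewrite /partial derive_cst.
by move=> x; exact: differentiable_cst.
Qed.

Lemma H10_with_gradient0 : H10_with_gradient Omega 0 (fun=> 0).
Proof.
have S0 := si_zero SI; split=> // [i phi tph|e e0].
  by rewrite !(si_B0l SI) ?oppr0//; apply: test_L2 => //; exact: test_function_partial.
exists 0; first exact: test_function0.
have n0 : L2n (0 - 0) = 0 by rewrite subrr /si_norm (si_B0l SI)// sqrtr0.
have p0 i : partial i (0 : 'rV[R]_d -> R) = 0.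
  by apply/funext => x; exact: derive_cst.
rewrite [L2_norm _ _]n0 expr0n/= add0r big1// => i _.
by rewrite p0 [L2_norm _ _]n0 expr0n.
Qed.

Lemma L2_inner_eql u u' w : L2 Omega u -> L2 Omega u' -> L2 Omega w ->
  L2n (u - u') = 0 -> L2_inner Omega u w = L2_inner Omega u' w.
Proof.
move=> Su Su' Sw e; apply/eqP; rewrite -subr_eq0 -(si_BBl SI)//.
by apply/eqP; apply: (si_norm0_l SI) => //; exact: (si_B SI).
Qed.

(** Weak gradients being unique up to null sets, the choice made by [grad] is
    immaterial. *)
Lemma H10_innerE u v g h : H10_with_gradient Omega u g -> H10_with_gradient Omega v h ->
  H10_inner Omega u v = \sum_(i < d) L2_inner Omega (g i) (h i).
Proof.
move=> ug vh; have [_ g2 _ _] := ug; have [_ h2 _ _] := vh.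
have Hu : H10 Omega u by exists g. have Hv : H10 Omega v by exists h.
apply: eq_bigr => i _.
have Gu := grad_L2 i Hu; have Gv := grad_L2 i Hv.
rewrite (L2_inner_eql Gu (g2 i) Gv (weak_gradient_unique (grad_spec Hu) ug i)).
rewrite (si_sym SI (g2 i) Gv) (si_sym SI (g2 i) (h2 i)).
exact: L2_inner_eql Gv (h2 i) (g2 i) (weak_gradient_unique (grad_spec Hv) vh i).
Qed.

Lemma H10_semi_inner : semi_inner (H10 Omega) (H10_inner Omega).
Proof.
split=> [|a u v|u v Hu Hv|a u v w Hu Hv Hw|u Hu].
- by exists (fun=> 0); exact: H10_with_gradient0.
- exact: H10_lin.
- by apply: eq_bigr => i _; rewrite (si_sym SI)//; exact: grad_L2.
- rewrite (H10_innerE (H10_with_gradient_lin a (grad_spec Hu) (grad_spec Hv)) (grad_spec Hw)).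
  rewrite /H10_inner mulr_sumr -big_split/=; apply: eq_bigr => i _.
  by rewrite (si_linl SI)//; exact: grad_L2.
- by apply: sumr_ge0 => i _; apply: (si_ge0 SI); exact: grad_L2.
Qed.

Local Notation HI := H10_semi_inner.

Lemma H10_sqr u g : H10_with_gradient Omega u g ->
  H1n u ^+ 2 = \sum_(i < d) L2n (g i) ^+ 2.
Proof.
move=> ug; have [_ g2 _ _] := ug; rewrite (si_norm_sqr HI); last by exists g.
by rewrite (H10_innerE ug ug); apply: eq_bigr => i _; rewrite (si_norm_sqr SI).
Qed.

(** Inequalities for test functions extend to H_0^1 along such sequences. *)
Lemma H10_approx u : H10 Omega u -> exists phi_ : nat -> 'rV[R]_d -> R,
  [/\ forall n, test_function Omega (phi_ n), L2n (phi_ n - u) @[n --> \oo] --> 0 &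
      Num.sqrt (dirichlet (fun i => partial i (phi_ n))) @[n --> \oo] --> H1n u].
Proof.
move=> Hu; have [phi_ [tphi c1 c2]] := grad_approx (grad_spec Hu); exists phi_; split=> //.
have tp n i : test_function Omega (partial i (phi_ n)) by exact: test_function_partial.
apply: cvgr_sqrt.
have -> : (fun n => dirichlet (fun i => partial i (phi_ n))) =
    (fun n => \sum_(i < d) L2n (partial i (phi_ n)) ^+ 2).
  apply/funext => n; rewrite dirichlet_test//; apply: eq_bigr => i _.
  by rewrite (si_norm_sqr SI)//; exact: test_L2.
rewrite -(si_norm_sqr HI)// (H10_sqr (grad_spec Hu)).
apply: (cvg_big (op := +%R)) => [|i _]; first exact: add_continuous.
have c : L2n (partial i (phi_ n)) @[n --> \oo] --> L2n (grad Omega u i).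
  by apply: (si_cvg_norm SI) (c2 i) => [n|]; [exact: test_L2|exact: grad_L2].
exact: cvgr_exp.
Qed.

Lemma H10_approx_norm u (phi_ : nat -> 'rV[R]_d -> R) : L2 Omega u ->
  (forall n, test_function Omega (phi_ n)) -> L2n (phi_ n - u) @[n --> \oo] --> 0 ->
  Num.sqrt (sqr_mass (phi_ n)) @[n --> \oo] --> L2n u.
Proof.
move=> u2 tphi c; have -> : (fun n => Num.sqrt (sqr_mass (phi_ n))) = (fun n => L2n (phi_ n)).
  by apply/funext => n; rewrite sqr_mass_test.
by apply: (si_cvg_norm SI) c => // n; exact: test_L2.
Qed.

Lemma H10_poincare : (0 < d)%N -> exists2 P, 0 <= P & forall u, H10 Omega u ->
  L2n u <= P * H1n u.
Proof.
move=> d0; have [P P0 HP] := poincare_bound d0 M0; exists P => // u Hu.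
have [phi_ [tphi c1 c2]] := H10_approx Hu.
apply: ler_cvg_to (H10_approx_norm (H10_L2 Hu) tphi c1) (cvgM (cvg_cst P) c2) _.
by apply: nearW => n; exact: HP (test_c1 (tphi n)).
Qed.

(** Ladyzhenskaya's inequality.  The fourth powers pass to the limit by Fatou's
    lemma, along a subsequence of test functions that converges almost everywhere. *)
Lemma H10_quartic : (1 <= d <= 3)%N -> exists2 C, 0 <= C & forall u, H10 Omega u ->
  L2 Omega (fun x => u x ^+ 2) /\
  L2_inner Omega (fun x => u x ^+ 2) (fun x => u x ^+ 2) <= C * L2n u * H1n u ^+ 3.
Proof.
move=> d13; have [C C0 HC] := quartic_bound d13 M0; exists C => // u Hu.
have u2 := H10_L2 Hu; have mu2 : measurable_fun Omega (fun x => u x ^+ 2).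
  by apply: measurable_funX; exact: u2.1.
have [phi_ [tphi c1 c2]] := H10_approx Hu.
have [k kinc kae] := l2_cvg_ae_subseq mO O_fin (fun n => test_L2 (tphi n)) u2 c1.
set K := C * L2n u * H1n u ^+ 3.
have cK : C * Num.sqrt (sqr_mass (phi_ n)) *
    Num.sqrt (dirichlet (fun i => partial i (phi_ n))) ^+ 3 @[n --> \oo] --> K.
  apply: cvgM.
    by apply: cvgM; [exact: cvg_cst|exact: H10_approx_norm].
  exact: cvgr_exp.
have quartic_le e : 0 < e -> (\int[leb]_(x in Omega) ((u x ^+ 2) ^+ 2)%:E <= (K + e)%:E)%E.
  move=> e0; have [N HN] : exists N, forall n, (N <= n)%N ->
      \int[leb]_(x in Omega) (phi_ n x ^+ 4) <= K + e.
    have [N _ HN] : \forall n \near \oo, `|K - C * Num.sqrt (sqr_mass (phi_ n)) *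
        Num.sqrt (dirichlet (fun i => partial i (phi_ n))) ^+ 3| <= e.
      by move/cvgrPdist_le : cK; exact.
    exists N => n Nn.
    have := HN n Nn => /=; rewrite distrC => /(le_trans (ler_norm _)).
    rewrite lerBlDl; apply: le_trans; rewrite int_test.
      exact: HC (test_c1 (tphi n)).
    by move=> x Ox; rewrite (test_function_out (tphi n) Ox) expr0n.
  apply: (@fatou_bound _ _ _ _ _ mO (fun j x => phi_ (k (j + N)%N) x ^+ 4)).
  - move=> n; apply: measurable_funX; exact: (test_L2 (tphi _)).1.
  - exact: measurable_funX.
  - by move=> n x _; rewrite (exprM _ 2 2) sqr_ge0.
  - by move=> *; exact: sqr_ge0.
  - apply: filterS kae => x + Ox => /(_ Ox) cx; rewrite -exprM.
    apply: (@cvgr_exp _ 4 (fun j => phi_ (k (j + N)%N) x)).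
    by apply: (@cvgr_infty_subseq _ (fun j => phi_ (k j) x) (addn^~ N)) cx => i j; rewrite ltn_add2r.
  - move=> n; rewrite [leLHS](@Rintegral_fine _ _ _ _ _ mO (fun x => phi_ (k (n + N)%N) x ^+ 4)).
      rewrite lee_fin; apply: HN.
      have kge m : (m <= k m)%N by elim: m => // m IH; rewrite (leq_ltn_trans IH)// kinc.
      by rewrite (leq_trans _ (kge _)) ?leq_addl.
    have := (bounded_supp_L2 (bounded_suppX 1 (test_bounded (tphi (k (n + N)%N))))).2.
    by apply: eq_integrable => // x _; rewrite /= -exprM.
have fin : leb.-integrable Omega (EFin \o (fun x => (u x ^+ 2) ^+ 2)).
  apply: integral_le_integrable (quartic_le _ ltr01) => //; first exact: measurable_funX.
  by move=> *; exact: sqr_ge0.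
split; first by split.
rewrite /L2_inner; under eq_Rintegral do rewrite -expr2.
apply/ler_addgt0Pr => e e0; rewrite -lee_fin; apply: le_trans (quartic_le e e0).
by rewrite (Rintegral_fine mO fin).
Qed.

Lemma H10_finite_rank e : 0 < e -> exists (I : finType) (w : I -> 'rV[R]_d -> R),
  (forall i, L2 Omega (w i)) /\
  forall u, H10 Omega u ->
    L2n u ^+ 2 <= \sum_i (L2_inner Omega u (w i)) ^+ 2 + e * H1n u ^+ 2.
Proof.
move=> e0; have [I [w [Bw wP]]] := finite_rank_approx d M0 e0; exists I, w.
have w2 i : L2 Omega (w i) by exact: bounded_supp_L2.
split=> // u Hu; have [phi_ [tphi c1 c2]] := H10_approx Hu.
have u2 := H10_L2 Hu.
have cL := @cvgr_exp _ 2 _ _ (H10_approx_norm u2 tphi c1).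
apply: ler_cvg_to cL _ _; last first.
- apply: nearW => n; rewrite sqr_sqrtr ?sqr_mass_ge0//; exact: wP (test_c1 (tphi n)).
- apply: cvgD.
    apply: (cvg_big (op := +%R)) => [|i _]; first exact: add_continuous.
    apply: cvgr_exp; have := si_cvg_l SI (fun n => test_L2 (tphi n)) u2 (w2 i) c1.
    by under eq_fun do rewrite L2_inner_test//.
  apply: cvgM; first exact: cvg_cst.
  by under eq_fun do rewrite -[dirichlet _]sqr_sqrtr ?dirichlet_ge0//; exact: cvgr_exp.
Qed.

(** The functions and each of their weak derivatives converge in L2; the equation
    of the weak gradient and the density of test functions pass to the limit. *)
Lemma H10_complete : (0 < d)%N -> si_complete (H10 Omega) (H10_inner Omega).
Proof.
move=> d0 u_ Hu_ cu; have [P P0 HP] := H10_poincare d0.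
have u2 n := H10_L2 (Hu_ n).
have L2c := l2_complete mO O_fin.
have part_le i m n : L2n (grad Omega (u_ m) i - grad Omega (u_ n) i) <= H1n (u_ m - u_ n).
  rewrite -ler_sqr ?nnegrE ?si_norm_ge0//.
  have := H10_with_gradient_lin (-1) (grad_spec (Hu_ n)) (grad_spec (Hu_ m)).
  have -> : -1 *: u_ n + u_ m = u_ m - u_ n by rewrite scaleN1r addrC.
  move/H10_sqr ->; rewrite (bigD1 i)//= scaleN1r [- _ + _]addrC lerDl.
  by apply: sumr_ge0 => j _; exact: sqr_ge0.
have [u Su uu] : exists2 u, L2 Omega u & L2n (u_ n - u) @[n --> \oo] --> 0.
  apply: L2c => // e e0; have P1 : 0 < P + 1 by rewrite ltr_wpDl.
  have [N HN] := cu _ (divr_gt0 e0 P1); exists N => m n Nm Nn.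
  apply: le_trans (HP _ (si_B HI (Hu_ m) (Hu_ n))) _.
  apply: (@le_trans _ _ (P * (e / (P + 1)))); first by rewrite ler_wpM2l// HN.
  by rewrite mulrA ler_pdivrMr// mulrC ler_wpM2l ?(ltW e0)// lerDl.
have /choice[g /all_and2[g2 cg]] : forall i, exists gi : 'rV[R]_d -> R, L2 Omega gi /\
    L2n (grad Omega (u_ n) i - gi) @[n --> \oo] --> 0.
  move=> i; have [||gi g2 cg] := L2c (fun n => grad Omega (u_ n) i).
  - by move=> n; exact: grad_L2.
  - move=> e /cu[N HN]; exists N => m n Nm Nn; apply: le_trans (HN m n Nm Nn).
    exact: part_le.
  - by exists gi.
have cS : L2n (u_ n - u) ^+ 2 + \sum_(i < d) L2n (grad Omega (u_ n) i - g i) ^+ 2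
    @[n --> \oo] --> (0 : R).
  have cX (p : nat -> R) : p @ \oo --> (0 : R) -> p n ^+ 2 @[n --> \oo] --> (0 : R).
    by move=> /(@cvgr_exp _ 2 _ _); rewrite expr0n.
  have c0 : L2n (u_ n - u) ^+ 2 + \sum_(i < d) L2n (grad Omega (u_ n) i - g i) ^+ 2
      @[n --> \oo] --> 0 + \sum_(i < d) (0 : R).
    apply: cvgD; first exact: cX.
    by apply: (cvg_big (op := +%R)) => [|i _]; [exact: add_continuous|exact: cX].
  by rewrite big1 ?addr0 in c0.
have sqr_triangle (p q s : 'rV[R]_d -> R) : L2 Omega p -> L2 Omega q -> L2 Omega s ->
    L2n (p - s) ^+ 2 <= 2 * L2n (q - p) ^+ 2 + 2 * L2n (q - s) ^+ 2.
  move=> p2 q2 s2; have := si_norm_triangle SI (si_B SI p2 q2) (si_B SI q2 s2).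
  rewrite addrA subrK (si_norm_distC SI p2 q2) => H.
  have := si_norm_ge0 (L2_inner Omega) (p - s); move: H.
  move: (L2n (p - s)) (L2n (q - p)) (L2n (q - s)) => a b c abc a0.
  have : a ^+ 2 <= (b + c) ^+ 2 by rewrite ler_pXn2r ?nnegrE// (le_trans a0).
  have := sqr_ge0 (b - c); nra.
have ug : H10_with_gradient Omega u g.
  split=> // [i phi tph|e e0].
    have tp : L2 Omega phi by exact: test_L2.
    have tq : L2 Omega (partial i phi) by apply: test_L2; exact: test_function_partial.
    have c1 := si_cvg_l SI u2 Su tq uu.
    have c2 := si_cvg_l SI (fun n => grad_L2 i (Hu_ n)) (g2 i) tp (cg i).
    have c3 : L2_inner Omega (u_ n) (partial i phi) @[n --> \oo] --> - L2_inner Omega (g i) phi.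
      have -> : (fun n => L2_inner Omega (u_ n) (partial i phi)) =
                (fun n => - L2_inner Omega (grad Omega (u_ n) i) phi).
        by apply/funext => n; have [_ _ wg _] := grad_spec (Hu_ n); exact: wg.
      exact: cvgN.
    exact: cvg_unique c1 c3.
  have e4 : 0 < e / 4 by rewrite divr_gt0.
  have [N HN] := cvgr0_natE cS (divr_gt0 e4 (ltr0n R 2)).
  have [_ _ _ dense] := grad_spec (Hu_ N); have [phi tph Hphi] := dense _ e4.
  have tp : L2 Omega phi by exact: test_L2.
  have tq i : L2 Omega (partial i phi) by apply: test_L2; exact: test_function_partial.
  exists phi => //; apply: (@le_lt_trans _ _
    (2 * (L2n (u_ N - u) ^+ 2 + \sum_(i < d) L2n (grad Omega (u_ N) i - g i) ^+ 2) +
     2 * (L2n (u_ N - phi) ^+ 2 +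
          \sum_(i < d) L2n (grad Omega (u_ N) i - partial i phi) ^+ 2))).
    have H1 := sqr_triangle u (u_ N) phi Su (u2 N) tp.
    have H2 : \sum_(i < d) L2n (g i - partial i phi) ^+ 2 <=
        2 * \sum_(i < d) L2n (grad Omega (u_ N) i - g i) ^+ 2 +
        2 * \sum_(i < d) L2n (grad Omega (u_ N) i - partial i phi) ^+ 2.
      rewrite !mulr_sumr -big_split/=; apply: ler_sum => i _.
      by apply: sqr_triangle => //; exact: grad_L2.
    apply: le_trans (lerD H1 H2) _.
    by rewrite le_eqVlt; apply/predU1l; ring.
  have := le_trans (ler_norm _) (HN N (leqnn N)); move: Hphi; rewrite -!/(L2n _).
  set x := L2n (u_ N - u) ^+ 2 + _; set y := L2_norm _ _ ^+ 2 + _ => Hy Hx.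
  have : y < e / 4 by exact: Hy.
  rewrite -[X in _ + 2 * X]/y; lra.
have Hu : H10 Omega u by exists g.
exists u => //.
have H1E n : H1n (u_ n - u) ^+ 2 = \sum_(i < d) L2n (grad Omega (u_ n) i - g i) ^+ 2.
  have := H10_with_gradient_lin (-1) ug (grad_spec (Hu_ n)).
  have -> : -1 *: u + u_ n = u_ n - u by rewrite scaleN1r addrC.
  by move/H10_sqr ->; apply: eq_bigr => i _; rewrite scaleN1r addrC.
apply: (@cvg_ler_norm0 _ _ (fun n => Num.sqrt (L2n (u_ n - u) ^+ 2 +
    \sum_(i < d) L2n (grad Omega (u_ n) i - g i) ^+ 2))).
  move=> n; rewrite -H1E -sqrtr_sqr ler_wsqrtr// lerDr; exact: sqr_ge0.
by have := cvgr_sqrt cS; rewrite sqrtr0.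
Qed.

End H10.

(** * Riemannian gradient descent on a sphere *)

Section descent.
Context {R : realType} {E : lmodType R}.
Variables (H L : set E) (a m : E -> E -> R).
Hypotheses (aSI : semi_inner H a) (mSI : semi_inner L m) (HL : H `<=` L).
Local Notation N := (si_norm a).
Local Notation n2 := (si_norm m).
Variables (P : R).
Hypotheses (P0 : 0 <= P) (HP : forall u, H u -> n2 u <= P * N u).
(* F stands for the part of the energy without derivatives, GN u for the Riesz
   representative in H of its derivative at u, and GU u for that of m(., u); fb,
   KF and KN are bounds in terms of norms only, so that the constants of the
   scheme depend on the starting point only through its norm. *)
Variables (F : E -> R) (fb KN : R -> R) (KF : R -> R -> R).
Variables (GU GN : E -> E).
Hypotheses
  (F_ge0 : forall u, H u -> 0 <= F u)
  (F_le : forall u, H u -> F u <= fb (N u))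
  (KF_ge0 : forall b c, 0 <= KF b c)
  (F_step : forall u g t b c, H u -> H g -> 0 <= t <= 1 -> N u <= b -> N g <= c ->
     F (u - t *: g) <= F u - t * a g (GN u) + t ^+ 2 * KF b c * N g ^+ 2)
  (F_scale : forall v t, H v -> 0 <= t <= 1 -> F (t *: v) <= F v)
  (H_GU : forall u, L u -> H (GU u))
  (GU_E : forall u z, L u -> H z -> a z (GU u) = m z u)
  (H_GN : forall u, H u -> H (GN u))
  (KN_ge0 : forall b, 0 <= b -> 0 <= KN b)
  (KN_le : forall b c, 0 <= b -> b <= c -> KN b <= KN c)
  (GN_le : forall u, H u -> N (GN u) <= KN (N u))
  (GN_cont : forall (u_ : nat -> E) u B, (forall n, H (u_ n)) -> H u ->
     (forall n, N (u_ n) <= B) -> n2 (u_ n - u) @[n --> \oo] --> 0 ->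
     N (GN (u_ n) - GN u) @[n --> \oo] --> 0)
  (compact_emb : forall (u_ : nat -> E) u B, (forall n, H (u_ n)) -> H u ->
     (forall n, N (u_ n) <= B) ->
     (forall v, H v -> a (u_ n) v @[n --> \oo] --> a u v) ->
     n2 (u_ n - u) @[n --> \oo] --> 0).

Definition on_sphere u := H u /\ n2 u = 1.

Definition sphere_energy u := 2^-1 * N u ^+ 2 + F u.

Definition free_gradient u := u + GN u.

Definition sphere_gradient u :=
  u + GN u - (1 + m (GN u) u) / N (GU u) ^+ 2 *: GU u.

(** The a-product of GU u with u is the square of n2 u, that is 1. *)
Lemma GU_norm_gt0 u : on_sphere u -> 0 < N (GU u).
Proof.
move=> [Hu u1]; have Lu := HL Hu; have HG := H_GU Lu.
rewrite lt_def si_norm_ge0 andbT; apply/eqP => G0.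
have := GU_E Lu Hu; rewrite (si_sym aSI Hu HG) (si_norm0_l aSI HG Hu G0).
rewrite -(si_norm_sqr mSI Lu) u1 expr1n => /eqP.
by rewrite eq_sym oner_eq0.
Qed.

Lemma H_free_gradient u : H u -> H (free_gradient u).
Proof. by move=> Hu; apply: (si_D aSI Hu); exact: H_GN. Qed.

Lemma H_sphere_gradient u : H u -> H (sphere_gradient u).
Proof.
move=> Hu; apply: (si_B aSI); first exact: H_free_gradient.
by apply: (si_Z aSI); exact/H_GU/HL.
Qed.

(** The Riemannian gradient is the gradient minus its projection on GU u, and
    orthogonality to GU u for a is orthogonality to u for m. *)
Lemma sphere_gradient_orthogonal u : on_sphere u -> m (sphere_gradient u) u = 0.
Proof.
move=> su; have [Hu u1] := su; have Lu := HL Hu; have HG := H_GU Lu.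
have HD := H_free_gradient Hu; have HN := H_GN Hu; have Hg := H_sphere_gradient Hu.
rewrite -(GU_E Lu Hg) (si_BBl aSI HD (si_Z aSI _ HG) HG) (si_ZBl aSI _ HG HG).
rewrite -(si_norm_sqr aSI HG) divfK; last by rewrite expf_neq0// gt_eqF// GU_norm_gt0.
rewrite (GU_E Lu HD) (si_DBl mSI Lu (HL HN) Lu) -(si_norm_sqr mSI Lu) u1.
by rewrite expr1n subrr.
Qed.

(** By orthogonality, the projection term does not contribute. *)
Lemma sphere_gradient_sqr u : on_sphere u ->
  N (sphere_gradient u) ^+ 2 = a (sphere_gradient u) (free_gradient u).
Proof.
move=> su; have [Hu _] := su; have Lu := HL Hu; have HG := H_GU Lu.
have HD := H_free_gradient Hu; have Hg := H_sphere_gradient Hu.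
rewrite (si_norm_sqr aSI Hg) {2}/sphere_gradient (si_BBr aSI HD (si_Z aSI _ HG) Hg).
by rewrite (si_ZBr aSI _ HG Hg) (GU_E Lu Hg) sphere_gradient_orthogonal// mulr0 subr0.
Qed.

Lemma sphere_gradient_le u : on_sphere u -> N (sphere_gradient u) <= N (free_gradient u).
Proof.
move=> su; have [Hu _] := su; have Hg := H_sphere_gradient Hu.
have := le_trans (ler_norm _) (si_cauchy_schwarz aSI Hg (H_free_gradient Hu)).
rewrite -(sphere_gradient_sqr su).
have := si_norm_ge0 a (sphere_gradient u).
have := si_norm_ge0 a (free_gradient u).
move: (N (sphere_gradient u)) (N _) => x y y0; rewrite le_eqVlt => /predU1P[<-//|x0].
by rewrite expr2 ler_pM2l.
Qed.

Lemma free_gradient_le u b : H u -> N u <= b -> N (free_gradient u) <= b + KN b.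
Proof.
move=> Hu ub; apply: le_trans (si_norm_triangle aSI Hu (H_GN Hu)) _.
apply: lerD => //; apply: le_trans (GN_le Hu) _.
by apply: KN_le => //; exact: si_norm_ge0.
Qed.

(** The derivative of the energy along the gradient is its squared norm, and the
    remainder is quadratic in the step. *)
Lemma sphere_energy_step u t b c : on_sphere u -> 0 <= t <= 1 -> N u <= b ->
  N (free_gradient u) <= c ->
  sphere_energy (u - t *: sphere_gradient u) <= sphere_energy u -
    t * (1 - t * (2^-1 + KF b c)) * N (sphere_gradient u) ^+ 2.
Proof.
move=> su t01 ub fc; have [Hu _] := su; set g := sphere_gradient u.
have Hg : H g by exact: H_sphere_gradient.
have gc : N g <= c by exact: le_trans (sphere_gradient_le su) fc.
have := sphere_gradient_sqr su; rewrite -/g /free_gradient (si_DBr aSI Hu (H_GN Hu) Hg).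
have := F_step Hu Hg t01 ub gc; rewrite /sphere_energy.
have -> : N (u - t *: g) ^+ 2 = N u ^+ 2 - 2 * t * a g u + t ^+ 2 * N g ^+ 2.
  rewrite -scaleNr (si_norm_sqr aSI); last exact: (si_D aSI Hu (si_Z aSI _ Hg)).
  rewrite (si_sqrD aSI _ Hu Hg) (si_sym aSI Hu Hg) -!(si_norm_sqr aSI)//.
  by move: (N u) (N g) (a g u) => x y z; ring.
move: (F _) (F u) (a g (GN u)) (a g u) (N u) (N g) (KF b c) => f1 f0 x y p q k h1 h2.
nra.
Qed.

(** Orthogonality makes the descent step leave the unit ball, so that retracting
    it to the sphere is a contraction, which lowers the energy. *)
Lemma retraction_step u t b c : on_sphere u -> 0 <= t <= 1 -> N u <= b ->
  N (free_gradient u) <= c ->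
  let v := u - t *: sphere_gradient u in
  on_sphere ((n2 v)^-1 *: v) /\ sphere_energy ((n2 v)^-1 *: v) <= sphere_energy v.
Proof.
move=> su t01 ub fc v; have [Hu u1] := su; have Hg := H_sphere_gradient Hu.
have Hv : H v by exact: (si_B aSI Hu (si_Z aSI _ Hg)).
have Lu := HL Hu; have Lg := HL Hg; have Lv := HL Hv.
have v1 : 1 <= n2 v.
  rewrite -ler_sqr ?nnegrE ?si_norm_ge0// expr1n /v -scaleNr (si_norm_sqr mSI); last first.
    exact: (si_D mSI Lu (si_Z mSI _ Lg)).
  rewrite (si_sqrD mSI _ Lu Lg) (si_sym mSI Lu Lg) sphere_gradient_orthogonal//.
  rewrite mulr0 addr0 -(si_norm_sqr mSI Lu) u1 expr1n lerDl mulr_ge0 ?sqr_ge0//.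
  exact: (si_ge0 mSI).
have v0 : 0 < n2 v by exact: lt_le_trans v1.
have vi0 : 0 <= (n2 v)^-1 by rewrite invr_ge0 ltW.
have vi1 : (n2 v)^-1 <= 1 by rewrite invf_le1.
split; first split.
- exact: (si_Z aSI).
- by rewrite (si_normZ mSI _ Lv) ger0_norm// mulVf// gt_eqF.
- apply: lerD; last by apply: F_scale => //; rewrite vi0.
  rewrite (si_normZ aSI _ Hv) ger0_norm// exprMn ler_wpM2l//.
  by rewrite ler_piMl ?sqr_ge0// expr_le1.
Qed.

Section scheme.
Variables (r : R).

(* A bound for the energy of a starting point of norm r. *)
Let E0 := 2^-1 * r ^+ 2 + fb r.
(** F being nonnegative, a bound for the energy bounds the norm; the summand 1 only
    makes the constant positive. *)
Definition descent_Cu := Num.sqrt (2 * E0) + 1.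
Definition descent_Cg := descent_Cu + KN descent_Cu.
(** With this bound on the step, the remainder in [sphere_energy_step] takes away at
    most half of the first-order decrease. *)
Definition descent_Ca := Num.min 1 (2 * (2^-1 + KF descent_Cu descent_Cg))^-1.

Lemma descent_Cu_gt0 : 0 < descent_Cu.
Proof. by rewrite ltr_wpDl// sqrtr_ge0. Qed.

Lemma descent_Cg_gt0 : 0 < descent_Cg.
Proof. by rewrite ltr_wpDr ?descent_Cu_gt0// KN_ge0// ltW// descent_Cu_gt0. Qed.

Let K_gt0 : 0 < 2^-1 + KF descent_Cu descent_Cg.
Proof. by rewrite ltr_wpDr// invr_gt0. Qed.

Lemma descent_Ca_gt0 : 0 < descent_Ca.
Proof. by rewrite lt_min ltr01 invr_gt0 mulr_gt0. Qed.

Lemma descent_Ca_le1 : descent_Ca <= 1.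
Proof. by rewrite ge_min lexx. Qed.

Variables (u_ : nat -> E) (alpha : nat -> R) (amin amax : R).
Hypotheses (amin0 : 0 < amin) (amaxC : amax <= descent_Ca)
  (ha : forall n, amin <= alpha n <= amax).
Hypotheses (s0 : on_sphere (u_ 0%N)) (r0 : N (u_ 0%N) = r)
  (uS : forall n, let v := u_ n - alpha n *: sphere_gradient (u_ n) in
        u_ n.+1 = (n2 v)^-1 *: v).

Let sphere_energy_bound u : on_sphere u -> sphere_energy u <= E0 -> N u <= descent_Cu.
Proof.
move=> [Hu _] uE; apply: (@le_trans _ _ (Num.sqrt (2 * E0))); last by rewrite lerDl.
rewrite -[leLHS]ger0_norm ?si_norm_ge0// -sqrtr_sqr ler_wsqrtr//.
by have := F_ge0 Hu; move: uE; rewrite /sphere_energy; move: (F u) (N u ^+ 2) (E0) => *; lra.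
Qed.

Let step n : on_sphere (u_ n) -> sphere_energy (u_ n) <= E0 ->
  on_sphere (u_ n.+1) /\
  amin / 2 * N (sphere_gradient (u_ n)) ^+ 2 <= sphere_energy (u_ n) - sphere_energy (u_ n.+1).
Proof.
move=> su uE; have ub := sphere_energy_bound su uE; have [Hu _] := su.
have fc : N (free_gradient (u_ n)) <= descent_Cg by exact: free_gradient_le.
have /andP[a1 a2] := ha n; have a3 : alpha n <= descent_Ca by exact: le_trans amaxC.
have a0 : 0 < alpha n by exact: lt_le_trans a1.
have a01 : 0 <= alpha n <= 1 by rewrite ltW//= (le_trans a3 descent_Ca_le1).
have [sS eS] := retraction_step su a01 ub fc; rewrite uS; split=> //.
have := sphere_energy_step su a01 ub fc.
have aK : alpha n * (2^-1 + KF descent_Cu descent_Cg) <= 2^-1.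
  have : alpha n <= (2 * (2^-1 + KF descent_Cu descent_Cg))^-1.
    by apply: le_trans a3 _; rewrite ge_min lexx orbT.
  move=> /(ler_wpM2r (ltW K_gt0))/le_trans; apply.
  by rewrite invfM mulfVK// gt_eqF.
move: eS aK; have := sqr_ge0 (N (sphere_gradient (u_ n))).
move: (sphere_energy _) (sphere_energy (u_ n - _)) (sphere_energy (u_ n)) (N _ ^+ 2)
  (2^-1 + _) => e1 e2 e3 q k q0 e12 aK e23.
have h1 : 0 <= alpha n * (2^-1 - alpha n * k) * q.
  by rewrite mulr_ge0// mulr_ge0 ?(ltW a0)// subr_ge0.
have h2 : 0 <= (alpha n - amin) * q by rewrite mulr_ge0// subr_ge0.
nra.
Qed.

Let iterates n : on_sphere (u_ n) /\ sphere_energy (u_ n) <= E0.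
Proof.
elim: n => [|n [su uE]].
  split=> //; have [H0 _] := s0; rewrite /sphere_energy r0 lerD2l -r0; exact: F_le.
have [sS dE] := step su uE; split=> //; apply: le_trans uE.
rewrite -subr_ge0; apply: le_trans dE; rewrite mulr_ge0 ?sqr_ge0//.
by rewrite divr_ge0// ltW.
Qed.

Lemma descent_on_sphere n : on_sphere (u_ n). Proof. exact: (iterates n).1. Qed.

Lemma descent_bound n : N (u_ n) <= descent_Cu.
Proof. by have [su uE] := iterates n; exact: sphere_energy_bound. Qed.

Lemma descent_gradient_bound n : N (free_gradient (u_ n)) <= descent_Cg.
Proof. by apply: free_gradient_le (descent_bound n); exact: (descent_on_sphere n).1. Qed.

Lemma descent_decay n : amin / 2 * N (sphere_gradient (u_ n)) ^+ 2 <=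
  sphere_energy (u_ n) - sphere_energy (u_ n.+1).
Proof. by have [su uE] := iterates n; exact: (step su uE).2. Qed.

(** The energy is nonincreasing and nonnegative, so its decrements, which dominate
    the squared gradients, tend to 0. *)
Lemma sphere_gradient_cvg0 : N (sphere_gradient (u_ n)) @[n --> \oo] --> 0.
Proof.
have dn : cvgn (fun n => sphere_energy (u_ n)).
  apply: nonincreasing_is_cvgn.
    apply/nonincreasing_seqP => n; rewrite -subr_ge0; apply: le_trans (descent_decay n).
    by rewrite mulr_ge0 ?sqr_ge0// divr_ge0// ltW.
  exists 0 => _ [n _ <-]; have [Hu _] := descent_on_sphere n.
  by rewrite addr_ge0 ?F_ge0// mulr_ge0 ?sqr_ge0.
have c0 : sphere_energy (u_ n) - sphere_energy (u_ n.+1) @[n --> \oo] --> (0 : R).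
  rewrite -(subrr (limn (fun n => sphere_energy (u_ n)))); apply: cvgB => //.
  by apply: (@cvgr_infty_subseq _ (fun n => sphere_energy (u_ n)) succn) dn => i j.
have c1 : N (sphere_gradient (u_ n)) ^+ 2 @[n --> \oo] --> (0 : R).
  apply: (@cvg_ler_norm0 _ _ (fun n => 2 / amin * (sphere_energy (u_ n) - sphere_energy (u_ n.+1)))).
    move=> n; rewrite ger0_norm ?sqr_ge0// -ler_pdivrMl ?divr_gt0// invf_div.
    exact: descent_decay.
  by rewrite -(mulr0 (2 / amin)); apply: cvgM => //; exact: cvg_cst.
have := cvgr_sqrt c1; rewrite sqrtr0.
by under eq_fun do rewrite sqrtr_sqr ger0_norm ?si_norm_ge0//.
Qed.

(** Strong convergence follows from the equation satisfied by the iterates: compactness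
    turns the weak limit into a limit for m, along which GU and GN are continuous. *)
Lemma descent_weak_limit (k : nat -> nat) (ustar : E) :
  {homo k : i j / (i < j)%N >-> (i < j)%N} -> H ustar ->
  (forall v, H v -> a (u_ (k n)) v @[n --> \oo] --> a ustar v) ->
  [/\ on_sphere ustar, N (sphere_gradient ustar) = 0 &
      N (u_ (k n) - ustar) @[n --> \oo] --> 0].
Proof.
move=> kinc Hs wc; pose v n := u_ (k n).
have Hv n : H (v n) by exact: (descent_on_sphere (k n)).1.
have Lv n := HL (Hv n); have Ls := HL Hs.
have vB n : N (v n) <= descent_Cu by exact: descent_bound.
have c2 : n2 (v n - ustar) @[n --> \oo] --> 0 by exact: compact_emb vB wc.
have us : on_sphere ustar.
  split=> //; have := si_cvg_norm mSI Lv Ls c2.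
  have -> : (fun n => n2 (v n)) = cst 1.
    by apply/funext => n; exact: (descent_on_sphere (k n)).2.
  by move=> c; apply/esym; apply: cvg_unique (cvg_cst _) c.
have cN := GN_cont Hv Hs vB c2.
have HNv n := H_GN (Hv n); have HNs := H_GN Hs.
have HUv n := H_GU (Lv n); have HUs := H_GU Ls.
have cU : N (GU (v n) - GU ustar) @[n --> \oo] --> 0.
  apply: (@cvg_ler_norm0 _ _ (fun n => P * n2 (v n - ustar))); last first.
    by rewrite -(mulr0 P); apply: cvgM => //; exact: cvg_cst.
  move=> n; rewrite ger0_norm ?si_norm_ge0//.
  have Hd := si_B aSI (HUv n) HUs; set w := GU (v n) - GU ustar in Hd *.
  have : N w ^+ 2 <= P * N w * n2 (v n - ustar).
    rewrite (si_norm_sqr aSI Hd) {2}/w (si_BBr aSI (HUv n) HUs Hd) !GU_E//.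
    rewrite -(si_BBr mSI (Lv n) Ls (HL Hd)).
    apply: le_trans (le_trans (ler_norm _) (si_cauchy_schwarz mSI (HL Hd) (si_B mSI (Lv n) Ls))) _.
    by rewrite ler_wpM2r ?si_norm_ge0// HP.
  have := si_norm_ge0 a w; have := si_norm_ge0 m (v n - ustar).
  move: (N w) (n2 _) => x y y0; rewrite le_eqVlt => /predU1P[<- _|x0]; first by rewrite mulr_ge0.
  by rewrite expr2 mulrAC ler_pM2r.
have cvg2 (p_ q_ : nat -> E) p q : (forall n, H (p_ n)) -> (forall n, H (q_ n)) -> H p -> H q ->
    N (p_ n - p) @[n --> \oo] --> 0 -> N (q_ n - q) @[n --> \oo] --> 0 ->
    a (p_ n) (q_ n) @[n --> \oo] --> a p q.
  move=> Hp_ Hq_ Hp Hq cp cq.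
  have cn := si_cvg_norm aSI Hp_ Hp cp.
  apply: (@cvg_ler_dist _ _ (fun n => N (p_ n) * N (q_ n - q) + N (p_ n - p) * N q)).
    move=> n; have -> : a (p_ n) (q_ n) - a p q = a (p_ n) (q_ n - q) + a (p_ n - p) q.
      by rewrite (si_BBr aSI)// (si_BBl aSI)//; ring.
    apply: le_trans (ler_normD _ _) _.
    by apply: lerD; apply: (si_cauchy_schwarz aSI) => //; exact: (si_B aSI).
  have -> : 0 = N p * 0 + 0 * N q :> R by ring.
  by apply: cvgD; apply: cvgM => //; exact: cvg_cst.
pose co u := (1 + m (GN u) u) / N (GU u) ^+ 2.
have cco : co (v n) @[n --> \oo] --> co ustar.
  apply: cvgM.
    apply: cvgD; first exact: cvg_cst.
    rewrite -(GU_E Ls HNs).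
    by under eq_fun do rewrite -(GU_E (Lv _) (HNv _)); exact: cvg2.
  apply: cvgV; first by rewrite expf_neq0// gt_eqF// GU_norm_gt0.
  by apply: cvgr_exp; exact: (si_cvg_norm aSI HUv HUs cU).
(* The iterates are, up to their vanishing gradients, continuous functions of
   quantities that converge strongly. *)
pose y := co ustar *: GU ustar - GN ustar.
have Hy : H y by exact: (si_B aSI (si_Z aSI _ HUs) HNs).
have gE u : sphere_gradient u = u - (co u *: GU u - GN u).
  by rewrite /sphere_gradient -/(co u) opprB addrA.
have cg : N (sphere_gradient (v n)) @[n --> \oo] --> 0.
  exact: (cvgr_infty_subseq kinc sphere_gradient_cvg0).
have cy : N (v n - y) @[n --> \oo] --> 0.
  apply: (@cvg_ler_norm0 _ _ (fun n => N (sphere_gradient (v n)) +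
    (`|co (v n) - co ustar| * N (GU (v n)) + `|co ustar| * N (GU (v n) - GU ustar) +
     N (GN (v n) - GN ustar)))).
    move=> n; rewrite ger0_norm ?si_norm_ge0//.
    have Hg := H_sphere_gradient (Hv n).
    have HU1 := si_Z aSI (co (v n) - co ustar) (HUv n).
    have HU2 := si_Z aSI (co ustar) (si_B aSI (HUv n) HUs).
    have HN1 := si_B aSI (HNv n) HNs.
    have -> : v n - y = sphere_gradient (v n) + (((co (v n) - co ustar) *: GU (v n) +
        co ustar *: (GU (v n) - GU ustar)) - (GN (v n) - GN ustar)).
      rewrite gE /y scalerBl scalerBr [X in _ + (X - _)]addrA subrK.
      move: (co (v n) *: _) (co ustar *: _) (GN (v n)) (GN ustar) => A C D B.
      have -> : A - C - (D - B) = (A - D) - (C - B).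
        by rewrite !opprB [B - C]addrC [in RHS]addrACA [- D + B]addrC.
      by rewrite addrA subrK.
    have H12 := si_D aSI HU1 HU2; have H3 := si_B aSI H12 HN1.
    apply: le_trans (si_norm_triangle aSI Hg H3) _; rewrite lerD2l.
    apply: le_trans (si_norm_triangleB aSI H12 HN1) _; rewrite lerD2r.
    apply: le_trans (si_norm_triangle aSI HU1 HU2) _.
    by rewrite !(si_normZ aSI)//; exact: (si_B aSI (HUv n) HUs).
  have cd : `|co (v n) - co ustar| @[n --> \oo] --> (0 : R).
    rewrite -(normr0 R); apply: cvg_norm; rewrite -(subrr (co ustar)).
    by apply: cvgB => //; exact: cvg_cst.
  have -> : 0 = 0 + (0 * N (GU ustar) + `|co ustar| * 0 + 0) :> R by ring.
  apply: cvgD => //; apply: cvgD => //; apply: cvgD.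
    by apply: cvgM => //; exact: (si_cvg_norm aSI HUv HUs cU).
  by apply: cvgM => //; exact: cvg_cst.
have Hsy := si_B aSI Hs Hy.
have sy0 : N (ustar - y) = 0.
  have c3 := si_cvg_l aSI Hv Hy Hsy cy.
  have e : a y (ustar - y) = a ustar (ustar - y) by exact: cvg_unique c3 (wc _ Hsy).
  apply/eqP; rewrite -sqrf_eq0 (si_norm_sqr aSI Hsy) (si_BBl aSI Hs Hy Hsy).
  by rewrite e subrr.
split=> //; first by rewrite gE.
apply: (@cvg_ler_norm0 _ _ (fun n => N (v n - y))) cy => n.
rewrite ger0_norm ?si_norm_ge0//.
have -> : v n - ustar = (v n - y) - (ustar - y) by move: (y) => y'; rewrite opprB addrA subrK.
by have := si_norm_triangleB aSI (si_B aSI (Hv n) Hy) Hsy; rewrite sy0 addr0.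
Qed.

End scheme.

End descent.

(** * The potential *)

Section gross_pitaevskii.
Context {R : realType} {d : nat}.
Variables (Omega : set 'rV[R]_d) (M : R) (V : 'rV[R]_d -> R) (Vmax beta : R).
Hypotheses (d13 : (1 <= d <= 3)%N).
Hypotheses (oO : open Omega) (M0 : 0 <= M) (OM : Omega `<=` cube d M).
Local Notation leb := (lebesgue_rV d : {measure set 'rV[R]_d -> \bar R}).
Hypotheses (mV : measurable_fun Omega V)
  (hV : {ae leb, forall x : 'rV[R]_d, Omega x -> 0 <= V x <= Vmax}) (beta0 : 0 <= beta).
Local Notation E := ('rV[R]_d -> R : lmodType R).
Implicit Types (u v w z g : E).

Local Notation L2n := (si_norm (L2_inner Omega)).
Local Notation H1n := (si_norm (H10_inner Omega)).
Local Notation SI := (L2_semi_inner oO).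
Local Notation HI := (H10_semi_inner oO OM).

Let d0 : (0 < d)%N. Proof. by case/andP: d13. Qed.
Let mO : measurable Omega. Proof. exact: open_measurable_rV. Qed.
Let HL2 := (@H10_L2 R d Omega).

Let W : R := Num.max 0 Vmax.
Let W0 : 0 <= W. Proof. by rewrite /W le_max lexx. Qed.

(* V is bounded only almost everywhere; its truncation Vc is bounded everywhere. *)
Let Vc x : R := Num.max 0 (Num.min (V x) Vmax).

Let mVc : measurable_fun Omega Vc.
Proof. by apply: measurable_maxr => //; apply: measurable_minr. Qed.

Let Vc_bound x : 0 <= Vc x <= W.
Proof.
rewrite /Vc /W le_max lexx/= ge_max le_max lexx/= le_max; apply/orP; right.
by rewrite ge_min lexx orbT.
Qed.

Let VcE : {ae leb, forall x, Omega x -> V x = Vc x}.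
Proof.
apply: filterS hV => x + Ox => /(_ Ox)/andP[V0 V1].
by rewrite /Vc; rewrite min_l// max_r.
Qed.

Let L2_Vc u : L2 Omega u -> L2 Omega (fun x => Vc x * u x).
Proof.
move=> u2; apply: (@sq_integrable_le _ _ _ leb Omega mO _ (W *: u)).
- by apply: measurable_funM => //; exact: u2.1.
- exact: (si_Z SI).
- move=> x _; have /andP[c0 c1] := Vc_bound x.
  rewrite [in leRHS](_ : (W *: u) x = W * u x)// !normrM (ger0_norm c0) (ger0_norm W0).
  by rewrite ler_wpM2r.
Qed.

Lemma L2_V u : L2 Omega u -> L2 Omega (fun x => V x * u x).
Proof.
move=> u2; have [mc c2] := L2_Vc u2.
have mVu : measurable_fun Omega (fun x => V x * u x).
  by apply: measurable_funM => //; exact: u2.1.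
split=> //; apply/integrableP; split; first by apply/measurable_EFinP/measurable_funX.
move/integrableP : c2 => [_]; congr (_ < +oo)%E; apply: ae_eq_integral => //.
- by apply: measurableT_comp => //; apply/measurable_EFinP/measurable_funX.
- by apply: measurableT_comp => //; apply/measurable_EFinP/measurable_funX.
- by apply: filterS VcE => x + Ox => /(_ Ox) ->.
Qed.

Let L2_inner_V u v : L2 Omega u -> L2 Omega v ->
  L2_inner Omega (fun x => V x * u x) v = L2_inner Omega (fun x => Vc x * u x) v.
Proof.
move=> u2 v2; apply: (l2_inner_ae mO (L2_V u2) (L2_Vc u2) v2).
by apply: filterS VcE => x + Ox => /(_ Ox) ->.
Qed.

Lemma L2_norm_V u : L2 Omega u -> L2n (fun x => V x * u x) <= W * L2n u.
Proof.
move=> u2; have c2 := L2_Vc u2; have v2 := L2_V u2.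
have -> : L2n (fun x => V x * u x) = L2n (fun x => Vc x * u x).
  apply: (si_norm_inj SI v2 c2); apply: l2_norm0_of_ae => //.
    exact: (si_B SI v2 c2).
  apply: filterS VcE => x + Ox => /(_ Ox) e.
  by rewrite (_ : (_ - _) x = V x * u x - Vc x * u x)// e subrr.
rewrite -(ger0_norm W0) -(si_normZ SI)//; apply: l2_norm_le => //.
  exact: (si_Z SI).
move=> x _; have /andP[p0 p1] := Vc_bound x.
rewrite [in leRHS](_ : (W *: u) x = W * u x)// !normrM (ger0_norm p0) (ger0_norm W0).
by rewrite ler_wpM2r.
Qed.

Lemma L2_inner_V_ge0 u : L2 Omega u -> 0 <= L2_inner Omega (fun x => V x * u x) u.
Proof.
move=> u2; rewrite L2_inner_V//; apply: Rintegral_ge0 => x _.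
by have /andP[c0 _] := Vc_bound x; rewrite -mulrA mulr_ge0// -expr2 sqr_ge0.
Qed.

(** * Products of functions of H_0^1 *)

Variables P C : R.
Hypotheses (P0 : 0 <= P) (HP : forall u, H10 Omega u -> L2n u <= P * H1n u).
Hypotheses (C0 : 0 <= C) (HC : forall u, H10 Omega u ->
  L2 Omega (fun x => u x ^+ 2) /\
  L2_inner Omega (fun x => u x ^+ 2) (fun x => u x ^+ 2) <= C * L2n u * H1n u ^+ 3).

Let S := Num.sqrt (C * P).
Let S0 : 0 <= S. Proof. exact: sqrtr_ge0. Qed.

Lemma L2_sqr u : H10 Omega u -> L2 Omega (fun x => u x ^+ 2).
Proof. by case/HC. Qed.

Lemma L2_norm_sqr u : H10 Omega u ->
  L2n (fun x => u x ^+ 2) <= Num.sqrt (C * L2n u * H1n u ^+ 3).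
Proof. by case/HC => _ H; exact: ler_wsqrtr. Qed.

Lemma L2_norm_sqr_H1 u : H10 Omega u -> L2n (fun x => u x ^+ 2) <= S * H1n u ^+ 2.
Proof.
move=> Hu; apply: le_trans (L2_norm_sqr Hu) _.
have n0 := si_norm_ge0 (H10_inner Omega) u.
rewrite -[H1n u ^+ 2]ger0_norm ?sqr_ge0// -sqrtr_sqr -sqrtrM ?mulr_ge0//.
rewrite ler_wsqrtr// -mulrA -[leRHS]mulrA ler_wpM2l//.
have := ler_wpM2r (exprn_ge0 3 n0) (HP Hu); move=> /le_trans; apply.
by rewrite le_eqVlt; apply/predU1l; move: (H1n u) => a; ring.
Qed.

Lemma L2_mul u v : H10 Omega u -> H10 Omega v -> L2 Omega (fun x => u x * v x).
Proof.
move=> Hu Hv; have [mu _] := HL2 Hu; have [mv _] := HL2 Hv.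
split; first exact: measurable_funM.
have := sq_integrable_mul mO (L2_sqr Hu) (L2_sqr Hv).
by apply: eq_integrable => // x _; rewrite /= exprMn.
Qed.

Lemma L2_norm_mul_sqr u v : H10 Omega u -> H10 Omega v ->
  L2n (fun x => u x * v x) ^+ 2 <= L2n (fun x => u x ^+ 2) * L2n (fun x => v x ^+ 2).
Proof.
move=> Hu Hv; rewrite (si_norm_sqr SI); last exact: L2_mul.
have := si_cauchy_schwarz SI (L2_sqr Hu) (L2_sqr Hv).
move=> /(le_trans (ler_norm _)); apply: le_trans.
by rewrite le_eqVlt; apply/predU1l; apply: eq_Rintegral => x _; ring.
Qed.

Lemma L2_norm_mul u v : H10 Omega u -> H10 Omega v ->
  L2n (fun x => u x * v x) <= S * H1n u * H1n v.
Proof.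
move=> Hu Hv; have n0 := si_norm_ge0 (H10_inner Omega).
rewrite -ler_sqr ?nnegrE ?si_norm_ge0 ?mulr_ge0//.
apply: le_trans (L2_norm_mul_sqr Hu Hv) _.
apply: le_trans (ler_pM (si_norm_ge0 _ _) (si_norm_ge0 _ _) (L2_norm_sqr_H1 Hu) (L2_norm_sqr_H1 Hv)) _.
by rewrite le_eqVlt; apply/predU1l; move: (H1n u) (H1n v) (S) => a b s; ring.
Qed.

(** * The Green operator *)

(** Only the functional z |-> (z, w) has to be bounded on H_0^1: this covers the
    cubic term without an L^6 estimate, which its square-integrability would take. *)
Lemma green_spec w (K : R) :
  (forall a z1 z2, H10 Omega z1 -> H10 Omega z2 ->
    L2_inner Omega (a *: z1 + z2) w = a * L2_inner Omega z1 w + L2_inner Omega z2 w) ->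
  (forall z, H10 Omega z -> `|L2_inner Omega z w| <= K * H1n z) ->
  H10 Omega (green Omega w) /\
  forall z, H10 Omega z -> H10_inner Omega z (green Omega w) = L2_inner Omega z w.
Proof.
move=> wlin wK.
have [v Hv vE] := si_riesz HI (H10_complete oO M0 OM d0) wlin wK.
exact: (xgetPex (cst 0) (ex_intro [set v : 'rV[R]_d -> R |
  H10 Omega v /\ forall z, H10 Omega z -> H10_inner Omega z v = L2_inner Omega z w]
  v (conj Hv vE))).
Qed.

Lemma green_L2_spec w : L2 Omega w -> H10 Omega (green Omega w) /\
  forall z, H10 Omega z -> H10_inner Omega z (green Omega w) = L2_inner Omega z w.
Proof.
move=> w2; apply: (@green_spec w (P * L2n w)) => [a z1 z2 H1 H2|z Hz].
  by rewrite (si_linl SI)//; exact: HL2.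
have := si_cauchy_schwarz SI (HL2 Hz) w2; move/le_trans; apply.
by rewrite mulrAC ler_wpM2r ?si_norm_ge0// HP.
Qed.

Definition nonlinearity u : 'rV[R]_d -> R :=
  fun x => V x * u x + beta * `|u x| ^+ 2 * u x.

(** Regrouped in this way, the pairing with the cubic term only involves functions
    that are square-integrable by the L^4 bound. *)
Lemma L2_inner_nonlinearity z u : H10 Omega z -> H10 Omega u ->
  L2_inner Omega z (nonlinearity u) =
  L2_inner Omega z (fun x => V x * u x) +
  beta * L2_inner Omega (fun x => z x * u x) (fun x => u x ^+ 2).
Proof.
move=> Hz Hu; rewrite /L2_inner -RintegralZl//; last first.
  exact: sq_integrable_mul (L2_mul Hz Hu) (L2_sqr Hu).
rewrite -RintegralD//.
- by apply: eq_Rintegral => x _; rewrite /nonlinearity real_normK ?num_real//; ring.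
- exact: sq_integrable_mul (HL2 Hz) (L2_V (HL2 Hu)).
- have := integrableZl mO beta (sq_integrable_mul mO (L2_mul Hz Hu) (L2_sqr Hu)).
  by apply: eq_integrable.
Qed.

Let KN (a : R) := P ^+ 2 * W * a + beta * S ^+ 2 * a ^+ 3.

Lemma nonlinearity_bound z u : H10 Omega z -> H10 Omega u ->
  `|L2_inner Omega z (nonlinearity u)| <= KN (H1n u) * H1n z.
Proof.
move=> Hz Hu; rewrite L2_inner_nonlinearity//.
have z2 := HL2 Hz; have u2 := HL2 Hu.
have n0 := si_norm_ge0 (H10_inner Omega).
apply: le_trans (ler_normD _ _) _; rewrite /KN mulrDl; apply: lerD.
  apply: le_trans (si_cauchy_schwarz SI z2 (L2_V u2)) _.
  apply: (@le_trans _ _ (P * H1n z * (W * (P * H1n u)))).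
    apply: ler_pM; rewrite ?si_norm_ge0 ?HP//.
    by apply: le_trans (L2_norm_V u2) _; rewrite ler_wpM2l ?HP.
  by rewrite le_eqVlt; apply/predU1l; move: (H1n u) (H1n z) (W) => a b s; ring.
rewrite normrM (ger0_norm beta0) -!mulrA ler_wpM2l//.
apply: le_trans (si_cauchy_schwarz SI (L2_mul Hz Hu) (L2_sqr Hu)) _.
apply: le_trans (ler_pM (si_norm_ge0 _ _) (si_norm_ge0 _ _) (L2_norm_mul Hz Hu) (L2_norm_sqr_H1 Hu)) _.
by rewrite le_eqVlt; apply/predU1l; move: (H1n u) (H1n z) (S) => a b s; ring.
Qed.

Local Notation GN u := (green_nonlinear Omega V beta u).
Local Notation GU u := (green Omega u).

Lemma green_nonlinear_spec u : H10 Omega u -> H10 Omega (GN u) /\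
  forall z, H10 Omega z -> H10_inner Omega z (GN u) = L2_inner Omega z (nonlinearity u).
Proof.
move=> Hu; apply: (@green_spec (nonlinearity u) (KN (H1n u))) => [a z1 z2 H1 H2|z Hz].
  have H12 := H10_lin oO OM a H1 H2.
  rewrite !L2_inner_nonlinearity// (si_linl SI a (HL2 H1) (HL2 H2) (L2_V (HL2 Hu))).
  have -> : (fun x => (a *: z1 + z2) x * u x) =
      a *: (fun x => z1 x * u x) + (fun x => z2 x * u x).
    apply/funext => x; rewrite (_ : (a *: z1 + z2) x = a * z1 x + z2 x)//.
    by rewrite mulrDl -mulrA.
  rewrite (si_linl SI a (L2_mul H1 Hu) (L2_mul H2 Hu) (L2_sqr Hu)).
  by move: (L2_inner _ _ _) (L2_inner _ _ _) (L2_inner _ _ _) (L2_inner _ _ _) => *; ring.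
exact: nonlinearity_bound.
Qed.

Lemma H10_norm_dual v (K : R) : 0 <= K -> H10 Omega v ->
  (forall z, H10 Omega z -> `|H10_inner Omega z v| <= K * H1n z) -> H1n v <= K.
Proof.
move=> K0 Hv HK; have [->//|vn0] := eqVneq (H1n v) 0.
have v0 : 0 < H1n v by rewrite lt_def vn0 si_norm_ge0.
have := HK v Hv; rewrite -(si_norm_sqr HI)// ger0_norm ?sqr_ge0// expr2.
by rewrite ler_pM2r.
Qed.

Lemma green_nonlinear_norm u : H10 Omega u -> H1n (GN u) <= KN (H1n u).
Proof.
move=> Hu; have [HG GE] := green_nonlinear_spec Hu.
have n0 := si_norm_ge0 (H10_inner Omega) u.
apply: H10_norm_dual => // [|z Hz]; last by rewrite GE// nonlinearity_bound.
by rewrite /KN addr_ge0 ?mulr_ge0 ?exprn_ge0.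
Qed.

(** * The energy *)

Lemma energyE u : H10 Omega u -> energy Omega V beta u =
  2^-1 * H1n u ^+ 2 + 2^-1 * L2_inner Omega (fun x => V x * u x) u +
  beta / 4 * L2_inner Omega (fun x => u x ^+ 2) (fun x => u x ^+ 2).
Proof.
move=> Hu; have u2 := HL2 Hu.
have ig i : leb.-integrable Omega (EFin \o (fun x => grad Omega u i x ^+ 2)).
  exact: (grad_L2 i Hu).2.
have isum := integrable_EFin_sum mO (index_enum 'I_d) ig.
have iV : leb.-integrable Omega (EFin \o (fun x => V x * `|u x| ^+ 2)).
  have := sq_integrable_mul mO (L2_V u2) u2; apply: eq_integrable => // x _.
  by rewrite /= real_normK ?num_real// expr2 mulrA.
have iQ : leb.-integrable Omega (EFin \o (fun x => `|u x| ^+ 4)).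
  have := sq_integrable_mul mO (L2_sqr Hu) (L2_sqr Hu); apply: eq_integrable => // x _.
  by rewrite /= (exprM _ 2 2) real_normK ?num_real.
have iZ (c : R) (f : 'rV[R]_d -> R) : leb.-integrable Omega (EFin \o f) ->
    leb.-integrable Omega (EFin \o (fun x => c * f x)).
  by move=> /(integrableZl mO c); apply: eq_integrable.
rewrite /energy RintegralD//; last 2 first.
- exact: (integrableD mO (iZ _ _ isum) (iZ _ _ iV)).
- exact: iZ.
rewrite RintegralD//; [|exact: iZ..].
rewrite !RintegralZl//; congr (_ * _ + _ * _ + _ * _).
- rewrite (si_norm_sqr HI)// Rintegral_sum// /H10_inner.
- by apply: eq_Rintegral => x _; rewrite real_normK ?num_real// expr2 mulrA.
- by apply: eq_Rintegral => x _; rewrite (exprM _ 2 2) real_normK ?num_real.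
Qed.

(* Unification must not unfold the choices behind these functions. *)
#[local] Opaque green green_nonlinear grad.

Let quart u := L2_inner Omega (fun x => u x ^+ 2) (fun x => u x ^+ 2).
Let pot u := L2_inner Omega (fun x => V x * u x) u.

Lemma quart_ge0 u : 0 <= quart u.
Proof. by apply: Rintegral_ge0 => x _; rewrite -expr2 sqr_ge0. Qed.

(** The square of u ^+ 2 - 2 a g u + a ^+ 2 g ^+ 2, in which the cubic term in a is
    absorbed by the quadratic and the quartic ones. *)
Lemma quart_expand u g a : H10 Omega u -> H10 Omega g ->
  quart (u - a *: g) <= quart u -
    4 * a * L2_inner Omega (fun x => g x * u x) (fun x => u x ^+ 2) +
    8 * a ^+ 2 * L2n (fun x => g x * u x) ^+ 2 + 3 * a ^+ 4 * L2n (fun x => g x ^+ 2) ^+ 2.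
Proof.
move=> Hu Hg; set A := fun x => u x ^+ 2; set B := fun x => g x * u x.
set G := fun x => g x ^+ 2.
have A2 : L2 Omega A by exact: L2_sqr.
have B2 : L2 Omega B by exact: L2_mul.
have G2 : L2 Omega G by exact: L2_sqr.
have eqE : (fun x => (u - a *: g) x ^+ 2) = A + (- 2 * a) *: B + a ^+ 2 *: G.
  apply/funext => x; rewrite (_ : (u - a *: g) x = u x - a * g x)//.
  rewrite (_ : (_ + _) x = u x ^+ 2 + (- 2 * a) * (g x * u x) + a ^+ 2 * g x ^+ 2)//.
  by ring.
have AB2 : L2 Omega (A + (- 2 * a) *: B) by apply: (si_D SI) => //; exact: (si_Z SI).
rewrite /quart eqE (si_sqrD SI _ AB2 G2) (si_sqrD SI _ A2 B2).
rewrite (si_DBl SI A2 (si_Z SI _ B2) G2) (si_ZBl SI _ B2 G2).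
have AG : L2_inner Omega A G = L2_inner Omega B B.
  by apply: eq_Rintegral => x _; rewrite /A /G /B; ring.
rewrite AG (si_sym SI A2 B2) (si_norm_sqr SI B2) (si_norm_sqr SI G2).
have := si_ge0 SI (si_D SI B2 (si_Z SI (a) G2)).
rewrite (si_sqrD SI _ B2 G2) => /(mulr_ge0 (sqr_ge0 a)).
move: (L2_inner Omega A A) (L2_inner Omega B A) (L2_inner Omega B B)
  (L2_inner Omega B G) (L2_inner Omega G G) => p q r s t; nra.
Qed.

Lemma pot_expand u g a : H10 Omega u -> H10 Omega g ->
  pot (u - a *: g) = pot u - 2 * a * L2_inner Omega g (fun x => V x * u x) + a ^+ 2 * pot g.
Proof.
move=> Hu Hg; have u2 := HL2 Hu; have g2 := HL2 Hg.
have Vu := L2_V u2; have Vg := L2_V g2.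
have eqE : (fun x => V x * (u - a *: g) x) =
    (- a) *: (fun x => V x * g x) + (fun x => V x * u x).
  apply/funext => x; rewrite (_ : (u - a *: g) x = u x - a * g x)//.
  by rewrite (_ : (_ + _) x = (- a) * (V x * g x) + V x * u x)//; ring.
rewrite /pot eqE (si_linl SI _ Vg Vu); last exact: (si_B SI u2 (si_Z SI _ g2)).
rewrite !(si_BBr SI u2 (si_Z SI a g2))// !(si_ZBr SI a g2)//.
have -> : L2_inner Omega (fun x => V x * g x) u = L2_inner Omega g (fun x => V x * u x).
  by apply: eq_Rintegral => x _; ring.
rewrite (si_sym SI Vu g2).
by move: (L2_inner _ _ _) (L2_inner _ _ _) (L2_inner _ _ _) => p q r; ring.
Qed.

Let pot_ge0 u : H10 Omega u -> 0 <= pot u.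
Proof. by move=> Hu; apply: L2_inner_V_ge0; exact: HL2. Qed.

Let pot_le u : H10 Omega u -> pot u <= W * P ^+ 2 * H1n u ^+ 2.
Proof.
move=> Hu; have u2 := HL2 Hu.
apply: le_trans (le_trans (ler_norm _) (si_cauchy_schwarz SI (L2_V u2) u2)) _.
have h1 := L2_norm_V u2; have h2 := HP Hu.
have := si_norm_ge0 (L2_inner Omega) u.
move: (L2n (fun x => V x * u x)) (L2n u) (H1n u) h1 h2 => p q s h1 h2 q0.
apply: (@le_trans _ _ (W * q * q)); first by rewrite ler_wpM2r.
rewrite -mulrA -expr2 -mulrA ler_wpM2l// -exprMn ler_pXn2r ?nnegrE//.
exact: le_trans h2.
Qed.

Let quart_le u : H10 Omega u -> quart u <= S ^+ 2 * H1n u ^+ 4.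
Proof.
move=> Hu; rewrite /quart -(si_norm_sqr SI (L2_sqr Hu)).
have := L2_norm_sqr_H1 Hu; have := si_norm_ge0 (L2_inner Omega) (fun x => u x ^+ 2).
move: (L2n _) (H1n u) => p q p0 h; rewrite (exprM q 2 2) -exprMn.
by rewrite ler_pXn2r ?nnegrE// (le_trans p0).
Qed.

Definition lower_energy u := 2^-1 * pot u + beta / 4 * quart u.
Definition lower_energy_bound (b : R) :=
  2^-1 * (W * P ^+ 2 * b ^+ 2) + beta / 4 * (S ^+ 2 * b ^+ 4).
Definition lower_energy_const (b c : R) :=
  2^-1 * (W * P ^+ 2) + beta / 4 * S ^+ 2 * (8 * b ^+ 2 + 3 * c ^+ 2).

Lemma energy_lower u : H10 Omega u ->
  energy Omega V beta u = 2^-1 * H1n u ^+ 2 + lower_energy u.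
Proof. by move=> Hu; rewrite energyE// /lower_energy addrA. Qed.

Let b40 : 0 <= beta / 4. Proof. by rewrite divr_ge0. Qed.

Lemma lower_energy_ge0 u : H10 Omega u -> 0 <= lower_energy u.
Proof.
by move=> Hu; rewrite addr_ge0 ?mulr_ge0 ?pot_ge0 ?quart_ge0.
Qed.

Lemma lower_energy_le u : H10 Omega u -> lower_energy u <= lower_energy_bound (H1n u).
Proof. by move=> Hu; rewrite lerD ?ler_wpM2l ?pot_le ?quart_le. Qed.

Lemma lower_energy_const_ge0 b c : 0 <= lower_energy_const b c.
Proof.
have := sqr_ge0 b; have := sqr_ge0 c; have := sqr_ge0 P; have := sqr_ge0 S.
rewrite /lower_energy_const; move: (b ^+ 2) (c ^+ 2) (P ^+ 2) (S ^+ 2) => x y p s *.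
apply: addr_ge0; first by rewrite !mulr_ge0.
by apply: mulr_ge0; [rewrite mulr_ge0|rewrite addr_ge0 ?mulr_ge0].
Qed.

(** The first-order term of the lower-order energy in a direction g is the
    pairing of g with the nonlinearity, and the remainder is quadratic in g. *)
Lemma lower_energy_step u g t b c : H10 Omega u -> H10 Omega g -> 0 <= t <= 1 ->
  H1n u <= b -> H1n g <= c ->
  lower_energy (u - t *: g) <= lower_energy u - t * H10_inner Omega g (GN u) +
    t ^+ 2 * lower_energy_const b c * H1n g ^+ 2.
Proof.
move=> Hu Hg /andP[t0 t1] ub gc; rewrite (green_nonlinear_spec Hu).2// L2_inner_nonlinearity//.
have qe := quart_expand t Hu Hg; have pe := pot_expand t Hu Hg.
have potg := pot_le Hg.
have N0u := si_norm_ge0 (H10_inner Omega) u; have N0g := si_norm_ge0 (H10_inner Omega) g.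
have Bb : L2n (fun x => g x * u x) ^+ 2 <= S ^+ 2 * b ^+ 2 * H1n g ^+ 2.
  have := L2_norm_mul Hg Hu; have := si_norm_ge0 (L2_inner Omega) (fun x => g x * u x).
  move: (L2n _) (H1n g) (H1n u) N0g N0u ub => p q s q0 s0 sb p0 h.
  have h' : p <= S * b * q.
    by apply: le_trans h _; rewrite mulrAC ler_wpM2r// ler_wpM2l.
  by rewrite -!exprMn ler_pXn2r ?nnegrE// (le_trans p0).
have Gb : L2n (fun x => g x ^+ 2) ^+ 2 <= S ^+ 2 * c ^+ 2 * H1n g ^+ 2.
  have := L2_norm_sqr_H1 Hg; have := si_norm_ge0 (L2_inner Omega) (fun x => g x ^+ 2).
  move: (L2n _) (H1n g) N0g gc => p q q0 qc p0 h.
  have h' : p <= S * c * q.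
    by apply: le_trans h _; rewrite expr2 mulrA ler_wpM2r// ler_wpM2l.
  by rewrite -!exprMn ler_pXn2r ?nnegrE// (le_trans p0).
rewrite /lower_energy /lower_energy_const pe.
move: (quart (u - _)) (quart u) (pot u) (pot g) (L2n (fun x => g x * u x) ^+ 2)
  (L2n (fun x => g x ^+ 2) ^+ 2) (L2_inner Omega g (fun x => V x * u x))
  (L2_inner Omega (fun x => g x * u x) (fun x => u x ^+ 2)) (H1n g ^+ 2)
  (sqr_ge0 (H1n g)) qe potg Bb Gb.
move: (S ^+ 2) (sqr_ge0 S) (W * P ^+ 2).
move=> s s0 wp qv qu pu pg b2 g2 lV lu ng ng0 qe potg Bb Gb.
have t40 : t ^+ 4 <= t ^+ 2.
  by rewrite (exprM _ 2 2) -[leRHS]mulr1 [leLHS]expr2 ler_wpM2l ?sqr_ge0 ?expr_le1.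
have G0 : 0 <= s * c ^+ 2 * ng by apply: mulr_ge0 => //; apply: mulr_ge0 => //; exact: sqr_ge0.
have q1 : qv <= qu - 4 * t * lu + 8 * t ^+ 2 * (s * b ^+ 2 * ng) +
    3 * t ^+ 2 * (s * c ^+ 2 * ng).
  apply: le_trans qe _; apply: lerD; first apply: lerD => //.
    by rewrite ler_wpM2l// mulr_ge0 ?sqr_ge0.
  apply: (@le_trans _ _ (3 * t ^+ 4 * (s * c ^+ 2 * ng))).
    by rewrite ler_wpM2l// mulr_ge0 ?exprn_ge0.
  by rewrite ler_wpM2r// ler_wpM2l.
have q2 := ler_wpM2l b40 q1.
have p2 := ler_wpM2l (sqr_ge0 t) potg.
apply: le_trans (lerD (lexx _) q2) _.
have -> : forall x y : R, (x <= y) = (0 <= y - x) by move=> x y; rewrite subr_ge0.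
have -> : 2^-1 * pu + beta / 4 * qu - t * (lV + beta * lu) +
  t ^+ 2 * (2^-1 * wp + beta / 4 * s * (8 * b ^+ 2 + 3 * c ^+ 2)) * ng -
  (2^-1 * (pu - 2 * t * lV + t ^+ 2 * pg) +
   beta / 4 * (qu - 4 * t * lu + 8 * t ^+ 2 * (s * b ^+ 2 * ng) + 3 * t ^+ 2 * (s * c ^+ 2 * ng))) =
  2^-1 * (t ^+ 2 * (wp * ng) - t ^+ 2 * pg) by field.
apply: mulr_ge0; first by rewrite invr_ge0.
by rewrite subr_ge0.
Qed.

Lemma lower_energy_scale v t : H10 Omega v -> 0 <= t <= 1 ->
  lower_energy (t *: v) <= lower_energy v.
Proof.
move=> Hv /andP[t0 t1]; have v2 := HL2 Hv.
have tt1 : t ^+ 2 <= 1 by rewrite expr_le1.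
have pE : pot (t *: v) = t ^+ 2 * pot v.
  rewrite /pot (_ : (fun x => _) = t *: (fun x => V x * v x)).
    by rewrite (si_ZBl SI _ (L2_V v2) (si_Z SI _ v2)) (si_ZBr SI _ v2 (L2_V v2)) mulrA -expr2.
  by apply/funext => x; rewrite (_ : (t *: v) x = t * v x)// mulrCA.
have qE : quart (t *: v) = t ^+ 2 * (t ^+ 2 * quart v).
  have H := L2_sqr Hv.
  rewrite /quart (_ : (fun x => _) = t ^+ 2 *: (fun x => v x ^+ 2)).
    by rewrite (si_ZBl SI _ H (si_Z SI _ H)) (si_ZBr SI _ H H).
  by apply/funext => x; rewrite (_ : (t *: v) x = t * v x)// exprMn.
have q0 := quart_ge0 v; have p0 := pot_ge0 Hv.
have tq : t ^+ 2 * (t ^+ 2 * quart v) <= quart v.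
  apply: (@le_trans _ _ (t ^+ 2 * quart v)); last by rewrite ler_piMl.
  by rewrite ler_wpM2l ?sqr_ge0// ler_piMl.
rewrite /lower_energy pE qE; apply: lerD; last by rewrite ler_wpM2l.
by rewrite ler_wpM2l// ler_piMl.
Qed.

(** * Convergence of the scheme *)

(** The difference of the cubes is (u_n - u) * Q with Q bounded in L2.  In L4,
    u_n - u is controlled by its L2 norm through the quartic inequality. *)
Lemma green_nonlinear_cont (u_ : nat -> E) u B : (forall n, H10 Omega (u_ n)) ->
  H10 Omega u -> (forall n, H1n (u_ n) <= B) -> L2n (u_ n - u) @[n --> \oo] --> 0 ->
  H1n (GN (u_ n) - GN u) @[n --> \oo] --> 0.
Proof.
move=> Hu_ Hu uB cu; pose D := B + H1n u.
have N0 := si_norm_ge0 (H10_inner Omega).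
have B0 : 0 <= B by apply: le_trans (uB 0%N).
have D0 : 0 <= D by rewrite addr_ge0.
have Hd n : H10 Omega (u_ n - u) by exact: (si_B HI (Hu_ n) Hu).
have dD n : H1n (u_ n - u) <= D.
  by apply: le_trans (si_norm_triangleB HI (Hu_ n) Hu) _; rewrite lerD2r.
pose q n := Num.sqrt (C * L2n (u_ n - u) * D ^+ 3).
have cq : q n @[n --> \oo] --> 0.
  have -> : 0 = Num.sqrt (C * 0 * D ^+ 3) :> R by rewrite mulr0 mul0r sqrtr0.
  by apply: cvgr_sqrt; apply: cvgM; [apply: cvgM => //|]; exact: cvg_cst.
have dq n : L2n (fun x => (u_ n - u) x ^+ 2) <= q n.
  apply: le_trans (L2_norm_sqr (Hd n)) _; rewrite ler_wsqrtr// ler_wpM2l.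
    by [].
    by rewrite mulr_ge0 ?si_norm_ge0.
  by rewrite ler_pXn2r ?nnegrE ?N0.
pose K n := P * (W * L2n (u_ n - u)) + beta * (Num.sqrt S * Num.sqrt (q n) * (3 * (S * D ^+ 2))).
apply: (@cvg_ler_norm0 _ _ K); last first.
  have -> : 0 = P * (W * 0) + beta * (Num.sqrt S * Num.sqrt 0 * (3 * (S * D ^+ 2))) :> R.
    by rewrite sqrtr0 !(mulr0, mul0r) addr0.
  apply: cvgD; first by apply: cvgM; [exact: cvg_cst|apply: cvgM => //; exact: cvg_cst].
  apply: cvgM; first exact: cvg_cst.
  apply: cvgM; last exact: cvg_cst.
  by apply: cvgM; [exact: cvg_cst|exact: cvgr_sqrt].
move=> n; rewrite ger0_norm ?si_norm_ge0//.
have [HN1 E1] := green_nonlinear_spec (Hu_ n); have [HN2 E2] := green_nonlinear_spec Hu.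
apply: H10_norm_dual; first by rewrite /K addr_ge0 ?mulr_ge0 ?sqrtr_ge0 ?si_norm_ge0 ?sqr_ge0.
  exact: (si_B HI HN1 HN2).
move=> z Hz; rewrite (si_BBr HI HN1 HN2 Hz) (E1 _ Hz) (E2 _ Hz).
rewrite (L2_inner_nonlinearity Hz (Hu_ n)) (L2_inner_nonlinearity Hz Hu).
have z2 := HL2 Hz; have u2 := HL2 Hu; have un2 := HL2 (Hu_ n); have d2 := HL2 (Hd n).
set dl := u_ n - u in Hd dD dq d2 *.
pose Q x := u_ n x ^+ 2 + u_ n x * u x + u x ^+ 2.
have QE : Q = (fun x => u_ n x ^+ 2) + (fun x => u_ n x * u x) + (fun x => u x ^+ 2) by [].
have s1 := L2_sqr (Hu_ n); have s2 := L2_mul (Hu_ n) Hu; have s3 := L2_sqr Hu.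
have s12 := si_D SI s1 s2.
have Q2 : L2 Omega Q by rewrite QE; exact: (si_D SI s12 s3).
have QD : L2n Q <= 3 * (S * D ^+ 2).
  have uD : H1n u <= D by rewrite lerDr.
  have unD : H1n (u_ n) <= D by rewrite (le_trans (uB n))// lerDl.
  have SD y : 0 <= y -> y <= D -> S * y ^+ 2 <= S * D ^+ 2.
    by move=> y0 yD; rewrite ler_wpM2l// ler_pXn2r ?nnegrE.
  have q1 : L2n (fun x => u_ n x ^+ 2) <= S * D ^+ 2.
    apply: le_trans (L2_norm_sqr_H1 (Hu_ n)) _.
    exact: SD (N0 _) unD.
  have q2 : L2n (fun x => u_ n x * u x) <= S * D ^+ 2.
    apply: le_trans (L2_norm_mul (Hu_ n) Hu) _; rewrite -mulrA ler_wpM2l// expr2.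
    exact: (ler_pM (N0 _) (N0 _) unD uD).
  have q3 : L2n (fun x => u x ^+ 2) <= S * D ^+ 2.
    apply: le_trans (L2_norm_sqr_H1 Hu) _.
    exact: SD (N0 _) uD.
  rewrite QE; apply: le_trans (si_norm_triangle SI s12 s3) _.
  apply: le_trans (lerD (si_norm_triangle SI s1 s2) (lexx _)) _.
  apply: le_trans (lerD (lerD q1 q2) q3) _.
  by move: (S * D ^+ 2) => y; rewrite le_eqVlt; apply/predU1l; ring.
have zd : L2n (fun x => z x * dl x) <= Num.sqrt S * H1n z * Num.sqrt (q n).
  have h := L2_norm_mul_sqr Hz (Hd n).
  have h2 := ler_pM (si_norm_ge0 _ _) (si_norm_ge0 _ _) (L2_norm_sqr_H1 Hz) (dq n).
  have := le_trans h h2; have := si_norm_ge0 (L2_inner Omega) (fun x => z x * dl x).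
  have q0 : 0 <= q n by exact: sqrtr_ge0.
  move: (L2n _) (H1n z) (N0 z) (q n) q0 => p s s0' r r0 p0 H.
  rewrite -ler_sqr ?nnegrE ?mulr_ge0 ?sqrtr_ge0// !exprMn !sqr_sqrtr//.
have E3 : L2_inner Omega (fun x => z x * u_ n x) (fun x => u_ n x ^+ 2) -
    L2_inner Omega (fun x => z x * u x) (fun x => u x ^+ 2) =
    L2_inner Omega (fun x => z x * dl x) Q.
  rewrite /L2_inner -RintegralB//; last 2 first.
  - exact: sq_integrable_mul (L2_mul Hz (Hu_ n)) s1.
  - exact: sq_integrable_mul (L2_mul Hz Hu) s3.
  apply: eq_Rintegral => x _; rewrite /Q (_ : dl x = u_ n x - u x)//; ring.
have E4 : L2_inner Omega z (fun x => V x * u_ n x) - L2_inner Omega z (fun x => V x * u x) =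
    L2_inner Omega z (fun x => V x * dl x).
  rewrite -(si_BBr SI (L2_V un2) (L2_V u2) z2); congr (L2_inner Omega z _).
  by apply/funext => x; rewrite (_ : (_ - _) x = V x * u_ n x - V x * u x)// -mulrBr.
have t1 : `|L2_inner Omega z (fun x => V x * dl x)| <= P * H1n z * (W * L2n dl).
  apply: le_trans (si_cauchy_schwarz SI z2 (L2_V d2)) _.
  by apply: ler_pM; rewrite ?si_norm_ge0 ?HP// L2_norm_V.
have t2 : `|L2_inner Omega (fun x => z x * dl x) Q| <=
    Num.sqrt S * H1n z * Num.sqrt (q n) * (3 * (S * D ^+ 2)).
  apply: le_trans (si_cauchy_schwarz SI (L2_mul Hz (Hd n)) Q2) _.
  by apply: ler_pM; rewrite ?si_norm_ge0.
move: E3 E4 t1 t2; rewrite /K.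
move: (L2_inner Omega z (fun x => V x * u_ n x)) (L2_inner Omega z (fun x => V x * u x))
  (L2_inner Omega (fun x => z x * u_ n x) _) (L2_inner Omega (fun x => z x * u x) _)
  (L2_inner Omega z (fun x => V x * dl x)) (L2_inner Omega (fun x => z x * dl x) Q)
  (H1n z) (L2n dl) (Num.sqrt S) (Num.sqrt (q n)) (3 * (S * D ^+ 2)).
move=> x1 x2 x3 x4 x5 x6 nz nd s r k e3 e4 t1 t2.
have -> : x1 + beta * x3 - (x2 + beta * x4) = x5 + beta * x6 by rewrite -e3 -e4; ring.
apply: le_trans (ler_normD _ _) _; rewrite normrM (ger0_norm beta0).
apply: le_trans (lerD t1 (ler_wpM2l beta0 t2)) _.
by rewrite le_eqVlt; apply/predU1l; ring.
Qed.

(** Rellich's theorem: weak convergence in H_0^1 makes finitely many L2 pairings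
    small at once, and these control the L2 norm up to a small multiple of the
    bounded H_0^1 norm. *)
Lemma H10_compact (u_ : nat -> E) u B : (forall n, H10 Omega (u_ n)) ->
  H10 Omega u -> (forall n, H1n (u_ n) <= B) ->
  (forall v, H10 Omega v -> H10_inner Omega (u_ n) v @[n --> \oo] --> H10_inner Omega u v) ->
  L2n (u_ n - u) @[n --> \oo] --> 0.
Proof.
move=> Hu_ Hu uB wu; pose D := B + H1n u.
have N0 := si_norm_ge0 (H10_inner Omega).
have D0 : 0 <= D by rewrite addr_ge0//; exact: le_trans (uB 0%N).
have Hd n : H10 Omega (u_ n - u) by exact: (si_B HI (Hu_ n) Hu).
have dD n : H1n (u_ n - u) <= D.
  by apply: le_trans (si_norm_triangleB HI (Hu_ n) Hu) _; rewrite lerD2r.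
apply: cvgr0_nat => e e0.
have D1 : 0 < 2 * (D ^+ 2 + 1) by rewrite mulr_gt0// ltr_wpDl// sqr_ge0.
have e20 : 0 < e ^+ 2 by rewrite exprn_gt0.
have [I [w [w2 wP]]] := H10_finite_rank oO M0 OM (divr_gt0 e20 D1).
have cw i : L2_inner Omega (u_ n - u) (w i) @[n --> \oo] --> 0.
  have [HG GE] := green_L2_spec (w2 i).
  have -> : (fun n => L2_inner Omega (u_ n - u) (w i)) =
    (fun n => H10_inner Omega (u_ n) (green Omega (w i)) - H10_inner Omega u (green Omega (w i))).
    by apply/funext => n; rewrite -(GE _ (Hd n)) (si_BBl HI (Hu_ n) Hu HG).
  rewrite -(subrr (H10_inner Omega u (green Omega (w i)))).
  by apply: cvgB; [exact: wu|exact: cvg_cst].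
have cS : \sum_i (L2_inner Omega (u_ n - u) (w i)) ^+ 2 @[n --> \oo] --> 0.
  have : \sum_i (L2_inner Omega (u_ n - u) (w i)) ^+ 2 @[n --> \oo] --> \sum_(i : I) (0 : R) ^+ 2.
    apply: (cvg_big (op := +%R)) => [|i _]; first exact: add_continuous.
    exact: cvgr_exp (cw i).
  by rewrite big1// => i _; rewrite expr0n.
have [N HN] := cvgr0_natE cS (divr_gt0 e20 (ltr0n R 2)); exists N => n Nn.
rewrite ger0_norm ?si_norm_ge0// -ler_sqr ?nnegrE ?si_norm_ge0 ?(ltW e0)//.
apply: le_trans (wP _ (Hd n)) _.
have h1 := le_trans (ler_norm _) (HN n Nn).
have h2 : e ^+ 2 / (2 * (D ^+ 2 + 1)) * H1n (u_ n - u) ^+ 2 <= e ^+ 2 / 2.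
  apply: (@le_trans _ _ (e ^+ 2 / (2 * (D ^+ 2 + 1)) * (D ^+ 2 + 1))).
    rewrite ler_wpM2l ?divr_ge0 ?(ltW e20) ?(ltW D1)//.
    apply: (@le_trans _ _ (D ^+ 2)); last by rewrite lerDl.
    by rewrite ler_pXn2r ?nnegrE ?N0.
  rewrite invfM mulrA mulfVK// gt_eqF// ltr_wpDl// sqr_ge0//.
apply: le_trans (lerD h1 h2) _; lra.
Qed.

Let KN_ge0 b : 0 <= b -> 0 <= KN b.
Proof. by move=> b0; rewrite /KN addr_ge0 ?mulr_ge0 ?exprn_ge0. Qed.

Let KN_le b c : 0 <= b -> b <= c -> KN b <= KN c.
Proof.
move=> b_ge0 bc; have c_ge0 := le_trans b_ge0 bc.
have k1 : 0 <= P ^+ 2 * W by rewrite mulr_ge0 ?exprn_ge0.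
have k2 : 0 <= beta * S ^+ 2 by rewrite mulr_ge0 ?exprn_ge0.
by apply: lerD; apply: ler_wpM2l => //; rewrite ler_pXn2r ?nnegrE.
Qed.

Let H_GU u (u2 : L2 Omega u) := (green_L2_spec u2).1.
Let GU_E u z (u2 : L2 Omega u) (Hz : H10 Omega z) := (green_L2_spec u2).2 z Hz.
Let H_GN u (Hu : H10 Omega u) := (green_nonlinear_spec Hu).1.

Lemma H1_schemeS alpha u0 n :
  let u := H1_scheme Omega V beta alpha u0 n in
  let v := u - alpha n *: sphere_gradient (H10_inner Omega) (L2_inner Omega)
    (green Omega) (green_nonlinear Omega V beta) u in
  H1_scheme Omega V beta alpha u0 n.+1 = (L2n v)^-1 *: v.
Proof. by apply/funext => x; exact: mulrC. Qed.

Let gp_Cu := descent_Cu lower_energy_bound.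
Let gp_Cg := descent_Cg lower_energy_bound KN.
Let gp_Ca := descent_Ca lower_energy_bound KN lower_energy_const.

Section scheme.
Variables (r amin amax : R) (alpha : nat -> R) (u0 : E).
Hypotheses (amin0 : 0 < amin) (amaxC : amax <= gp_Ca r)
  (ha : forall n, amin <= alpha n <= amax) (u0S : on_manifold Omega u0)
  (u0r : H10_norm Omega u0 = r).
Let u_ := H1_scheme Omega V beta alpha u0.
Let uS n := H1_schemeS alpha u0 n.

Lemma H1_scheme_on_manifold n : on_manifold Omega (u_ n).
Proof.
exact: (descent_on_sphere HI SI HL2 lower_energy_ge0 lower_energy_le
  lower_energy_const_ge0 lower_energy_step lower_energy_scale H_GU GU_E H_GN KN_le
  green_nonlinear_norm amin0 amaxC ha u0S u0r uS n).
Qed.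

Lemma H1_scheme_decay n : [/\ H10_norm Omega (u_ n) <= gp_Cu r,
  H10_norm Omega (riemannian_H1_gradient Omega V beta (u_ n)) <=
    H10_norm Omega (H1_gradient Omega V beta (u_ n)) <= gp_Cg r &
  amin / 2 * H10_norm Omega (riemannian_H1_gradient Omega V beta (u_ n)) ^+ 2 <=
    energy Omega V beta (u_ n) - energy Omega V beta (u_ n.+1)].
Proof.
split.
- exact: (descent_bound HI SI HL2 lower_energy_ge0 lower_energy_le
    lower_energy_const_ge0 lower_energy_step lower_energy_scale H_GU GU_E H_GN KN_le
    green_nonlinear_norm amin0 amaxC ha u0S u0r uS n).
- apply/andP; split.
    exact: (sphere_gradient_le HI SI HL2 H_GU GU_E H_GN (H1_scheme_on_manifold n)).
  exact: (descent_gradient_bound HI SI HL2 lower_energy_ge0 lower_energy_le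
    lower_energy_const_ge0 lower_energy_step lower_energy_scale H_GU GU_E H_GN KN_le
    green_nonlinear_norm amin0 amaxC ha u0S u0r uS n).
- rewrite (energy_lower (H1_scheme_on_manifold n).1) (energy_lower (H1_scheme_on_manifold n.+1).1).
  exact: (descent_decay HI SI HL2 lower_energy_ge0 lower_energy_le
    lower_energy_const_ge0 lower_energy_step lower_energy_scale H_GU GU_E H_GN KN_le
    green_nonlinear_norm amin0 amaxC ha u0S u0r uS n).
Qed.

Lemma H1_scheme_weak_limit ustar : weak_limit_point Omega u_ ustar ->
  critical_point Omega V beta ustar /\
  exists2 k : nat -> nat, {homo k : m n / (m < n)%N >-> (m < n)%N} &
    H10_strong_cvg Omega (u_ \o k) ustar.
Proof.
move=> [Hs [k kinc wk]].
have wc v : H10 Omega v ->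
    H10_inner Omega (u_ (k n)) v @[n --> \oo] --> H10_inner Omega ustar v.
  move=> Hv; apply: (wk (fun z => H10_inner Omega z v)); split.
    by move=> a z1 z2 H1 H2; exact: (si_linl HI a H1 H2 Hv).
  exists (H1n v) => z Hz; rewrite mulrC; exact: (si_cauchy_schwarz HI Hz Hv).
have [us g0 sc] := descent_weak_limit HI SI HL2 P0 HP lower_energy_ge0 lower_energy_le
  lower_energy_const_ge0 lower_energy_step lower_energy_scale H_GU GU_E H_GN KN_le
  green_nonlinear_norm green_nonlinear_cont H10_compact amin0 amaxC ha u0S u0r uS kinc Hs wc.
split; last by exists k.
split=> //; have Hg := H_sphere_gradient (L2_inner Omega) HI HL2 H_GU H_GN Hs.
apply: (l2_norm0_ae mO (HL2 Hg)).
apply/eqP; rewrite eq_le si_norm_ge0 andbT.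
by have := HP Hg; rewrite g0 mulr0.
Qed.

End scheme.

Lemma H1_scheme_constants r : exists Cu Cg Ca : R,
  [/\ 0 < Cu, 0 < Cg, 0 < Ca, Ca <= 1 &
   forall u0 : 'rV[R]_d -> R, on_manifold Omega u0 -> H10_norm Omega u0 = r ->
     energy_decay_property Omega V beta Cu Cg Ca u0 /\
     forall (amin amax : R) (alpha : nat -> R),
       0 < amin -> amin <= amax -> amax <= Ca ->
       (forall n : nat, amin <= alpha n <= amax) ->
     forall ustar : 'rV[R]_d -> R,
       weak_limit_point Omega (H1_scheme Omega V beta alpha u0) ustar ->
       critical_point Omega V beta ustar /\
       exists2 k : nat -> nat, {homo k : m n / (m < n)%N >-> (m < n)%N} &
         H10_strong_cvg Omega (H1_scheme Omega V beta alpha u0 \o k) ustar].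
Proof.
exists (gp_Cu r), (gp_Cg r), (gp_Ca r); split.
- exact: descent_Cu_gt0.
- exact: descent_Cg_gt0.
- exact: (descent_Ca_gt0 _ _ lower_energy_const_ge0).
- exact: descent_Ca_le1.
move=> u0 u0S u0r; split=> [amin amax alpha amin0 _ amaxC ha n|].
  exact: (H1_scheme_decay amin0 amaxC ha u0S u0r n).
move=> amin amax alpha amin0 _ amaxC ha ustar.
exact: (H1_scheme_weak_limit amin0 amaxC ha u0S u0r).
Qed.

End gross_pitaevskii.

Theorem theorem3p3 (R : realType) (d : nat) (hd : (1 <= d <= 3)%N)
  (Omega : set 'rV[R]_d) (hOmega : bounded_lipschitz_domain Omega)
  (V : 'rV[R]_d -> R) (Vmax : R) (mV : measurable_fun Omega V)
  (hV : {ae (lebesgue_rV d : {measure set 'rV[R]_d -> \bar R}),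
           forall x : 'rV[R]_d, Omega x -> 0 <= V x <= Vmax})
  (beta : R) (hbeta : 0 <= beta) (r : R) :
  exists Cu Cg Ca : R,
    [/\ 0 < Cu, 0 < Cg, 0 < Ca, Ca <= 1 &
     forall u0 : 'rV[R]_d -> R, on_manifold Omega u0 -> H10_norm Omega u0 = r ->
       energy_decay_property Omega V beta Cu Cg Ca u0 /\
       forall (amin amax : R) (alpha : nat -> R),
         0 < amin -> amin <= amax -> amax <= Ca ->
         (forall n : nat, amin <= alpha n <= amax) ->
       forall ustar : 'rV[R]_d -> R,
         weak_limit_point Omega (H1_scheme Omega V beta alpha u0) ustar ->
         critical_point Omega V beta ustar /\
         exists2 k : nat -> nat, {homo k : m n / (m < n)%N >-> (m < n)%N} &
           H10_strong_cvg Omega (H1_scheme Omega V beta alpha u0 \o k) ustar].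
Proof.
have [oO _ _ bO _] := hOmega; have [M M0 OM] := bounded_subset_cube bO.
have /andP[d0 _] := hd.
have [P P0 HP] := H10_poincare oO M0 OM d0; have [C C0 HC] := H10_quartic oO M0 OM hd.
exact: (H1_scheme_constants hd oO M0 OM mV hV hbeta P0 HP C0 HC r).
Qed.
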